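(* Let $1\le k\le l$, and let $y^1,\dots,y^{l+1}$ and $(g^{ij}(y))$ be the coordinates and the metric on the orbit space of $\widetilde W^{(k)}(B_l)$ described in the context. Define $\bar y^j=y^j$ for $1\le j\le l-1$, $\bar y^l=(y^l)^2$, and $\bar y^{l+1}=y^{l+1}$ if $k\le l-1$, $\bar y^{l+1}=\frac12y^{l+1}$ if $k=l$. Then the components of the metric in the coordinates $\bar y^1,\dots,\bar y^{l+1}$ coincide with the components $g^{ij}_{C}(\bar y)$ of the metric corresponding to the root system of type $C_l$ with the same $k$ (see context). Consequently, the Frobenius manifold structure obtained in this way from $B_l$ by fixing the $k$-th vertex of its Dynkin diagram (intersection form $(g^{ij})$, invariant flat metric $\partial g^{ij}/\partial\bar y^k$, unity $\partial/\partial\bar y^k$) is isomorphic to the one obtained from $C_l$ by choosing the $k$-th vertex of the Dynkin diagram of $C_l$.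
   Context: Throughout $x_0=0$ and $\sigma_j$ is the $j$-th elementary symmetric polynomial. **Type $B_l$.** Let $V=\mathbb R^l$ with orthonormal basis $e_1,\dots,e_l$, simple roots $\alpha_j=e_j-e_{j+1}$ $(j<l)$, $\alpha_l=e_l$, coroots $\alpha_j^\vee$, fundamental weights $\omega_j$, Weyl group $W$, $\mathbf x=\sum x_j\alpha^\vee_j$. The group $\widetilde W^{(k)}(B_l)$ acts on $V\oplus\mathbb R$ and is generated by $(\mathbf x,x_{l+1})\mapsto(w(\mathbf x)+\sum m_j\alpha_j^\vee,x_{l+1})$, $w\in W$, $m_j\in\mathbb Z$, and $(\mathbf x,x_{l+1})\mapsto(\mathbf x+\omega_k,x_{l+1}-1)$. The numbers $d_j=(\omega_j,\omega_k)$ are: if $k<l$, $d_j=\min(j,k)$ for $j\le l-1$ and $d_l=k/2$; if $k=l$, $d_j=j/2$ for $j\le l-1$ and $d_l=l/4$. The metric is $$(dx_m,dx_n)^\sim=\frac1{4\pi^2}\Big[(1-\tfrac12\delta_{n,l})m-\tfrac l4\delta_{n,l}\delta_{m,l}\Big]\ (1\le m\le n\le l),\quad (dx_m,dx_{l+1})^\sim=0\ (m\le l),\quad (dx_{l+1},dx_{l+1})^\sim=-\frac1{4\pi^2d_k}.$$ Put $\zeta_j^{1/2}=2\cos\pi(x_j-x_{j-1})$ for $j\le l-1$, $\zeta_l^{1/2}=2\cos\pi(2x_l-x_{l-1})$, so that $\zeta_j=(\zeta_j^{1/2})^2$. Invariant Fourier polynomials: $y_j(\mathbf x)=\sigma_j(\zeta_1,\dots,\zeta_l)$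 for $j\le l-1$, $y_l(\mathbf x)=\zeta_1^{1/2}\cdots\zeta_l^{1/2}$. Coordinates on the orbit space (the spectrum of the ring of $\widetilde W^{(k)}(B_l)$-invariant Fourier polynomials $\sum a_{m_1,\dots,m_{l+1}}e^{2\pi i(m_1x_1+\dots+m_lx_l+\frac1fm_{l+1}x_{l+1})}$, $f$ the determinant of the Cartan matrix, bounded as $\mathbf x=\mathbf x^0-i\omega_k\tau$, $x_{l+1}=x_{l+1}^0+i\tau$, $\tau\to+\infty$): $y^j=e^{2\pi id_jx_{l+1}}y_j(\mathbf x)$ for $j\le l$, $y^{l+1}=2\pi ix_{l+1}$ (the last one local, away from $e^{2\pi i x_{l+1}}=0$). The metric is $g^{ij}(y)=\sum_{a,b}\frac{\partial y^i}{\partial x_a}\frac{\partial y^j}{\partial x_b}(dx_a,dx_b)^\sim$. **Type $C_l$.** $g_C^{ij}(y)$ is defined by the same formula from $(dx_m,dx_n)^\sim=\frac m{4\pi^2}$ $(1\le m\le n\le l)$, $(dx_m,dx_{l+1})^\sim=0$ $(m\le l)$, $(dx_{l+1},dx_{l+1})^\sim=-\frac1{4\pi^2k}$, $\zeta_j=e^{2\pi i(x_j-x_{j-1})}+e^{-2\pi i(x_j-x_{j-1})}+2$ $(1\le j\le l)$, $y^j=e^{2\pi i\min(j,k)x_{l+1}}\sigma_j(\zeta_1,\dots,\zeta_l)$ $(1\le j\le l)$, $y^{l+1}=2\pi ix_{l+1}$. The Frobenius manifold obtained from $C_l$ and $k$ is the Frobenius structure of charge $1$ on the locus $y^l\neq0$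 of the orbit space with intersection form $(g_C^{ij})$, invariant flat metric $(\partial g_C^{ij}/\partial y^k)$ (both as bilinear forms on the cotangent bundle), unity $\partial/\partial y^k$ and Euler vector field $\frac1k\big(\sum_{j=1}^l\min(j,k)\,y^j\,\partial/\partial y^j+\partial/\partial y^{l+1}\big)$. A Frobenius structure of charge $d$ on $M$ is a commutative associative unital multiplication on tangent spaces with an invariant nondegenerate symmetric form $\langle\,,\rangle$ ($\langle x\cdot y,z\rangle=\langle x,y\cdot z\rangle$), depending analytically on the point, such that $\langle\,,\rangle$ is flat, the unity field is covariantly constant, $(\nabla_w c)(x,y,z)$ with $c(x,y,z)=\langle x\cdot y,z\rangle$ is totally symmetric, and there is an Euler field $E$ with $\nabla\nabla E=0$, $[E,x\cdot y]-[E,x]\cdot y-x\cdot[E,y]=x\cdot y$, $E\langle x,y\rangle-\langle[E,x],y\rangle-\langle x,[E,y]\rangle=(2-d)\langle x,y\rangle$. Its intersection form is $(w_1,w_2)^*=i_E(w_1\cdot w_2)$ on 1-forms, multiplied via the identification of $TM$ with $T^*M$ by $\langle\,,\rangle$.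
   Formalization: ''Isomorphic'' means: the map to the coordinates ȳ is a surjective local biholomorphism of the loci y^l≠0 carrying product, metric, unity and Euler field, bijective only where ȳ is injective (a global bijection fails for l=k=1); the C_l Frobenius structure is taken as given. *)

(* Defs.v *)
From HB Require Import structures.
From mathcomp Require Import all_boot all_order all_algebra.
From mathcomp Require Import complex.
From mathcomp Require Import boolp classical_sets functions reals topology.
From mathcomp Require Import normedtype sequences derive exp trigo.

Set Implicit Arguments.
Unset Strict Implicit.
Unset Printing Implicit Defensive.
Import Order.TTheory GRing.Theory Num.Theory.
Import numFieldNormedType.Exports.
Local Open Scope classical_set_scope.
Local Open Scope ring_scope.

(* Declared as a numClosedFieldType so that the topology and the norm of the
   analysis library apply: 'D_v f, 'J f y and differentiability below are over
   the complex field. *)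
Definition cplx (R : realType) : numClosedFieldType := R[i].

Section ComplexFunctions.
Variable R : realType.
Local Notation C := (cplx R).

Definition piC : C := (pi : R)%:C%C.

Definition expC (z : C) : C :=
  let: Complex a b := z : R[i] in Complex (expR a * cos b) (expR a * sin b).

Definition cosC (z : C) : C := (expC ('i * z) + expC (- ('i * z))) / 2.

End ComplexFunctions.

(* Points of C^n and tangent vectors at a point are rows, written in the
   coordinate frame; a vector field is a map 'rV_n -> 'rV_n.  A bilinear form
   on tangent vectors or on 1-forms is given by its Gram matrix. *)
Section Calculus.
Variables (R : realType) (n : nat).
Local Notation C := (cplx R).
Local Notation P := 'rV[C]_n.

Definition partial (a : 'I_n) (f : P -> C) (y : P) : C :=
  'D_(delta_mx 0 a) f y.

(* Components sum_(a, b) df^i/dx_a df^j/dx_b M^ab, in the coordinates f, of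
   the contravariant form with components M at the point x. *)
Definition components (f : P -> P) (M : 'M[C]_n) (x : P) : 'M[C]_n :=
  \matrix_(i, j) \sum_a \sum_b
    partial a (fun z => f z 0 i) x * partial b (fun z => f z 0 j) x * M a b.

Definition bil (M : 'M[C]_n) (u v : P) : C := (u *m M *m v^T) 0 0.

Definition bracket (X Y : P -> P) (y : P) : P := 'D_(X y) Y y - 'D_(Y y) X y.

Definition christoffel (eta : P -> 'M[C]_n) (y : P) (i a b : 'I_n) : C :=
  2^-1 * \sum_m invmx (eta y) i m *
    (partial a (fun z => eta z m b) y + partial b (fun z => eta z m a) y
     - partial m (fun z => eta z a b) y).

Definition nabla (eta : P -> 'M[C]_n) (X Y : P -> P) (y : P) : P :=
  'D_(X y) Y y
  + \row_i \sum_a \sum_b christoffel eta y i a b * X y 0 a * Y y 0 b.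

Definition curvature (eta : P -> 'M[C]_n) (X Y Z : P -> P) (y : P) : P :=
  nabla eta X (nabla eta Y Z) y - nabla eta Y (nabla eta X Z) y
  - nabla eta (bracket X Y) Z y.

End Calculus.

Section Frobenius.
Variables (R : realType) (n : nat).
Local Notation C := (cplx R).
Local Notation P := 'rV[C]_n.

Record frobenius := Frobenius {
  fmul : P -> P -> P -> P;      (* fmul y u v: product of u and v at y *)
  fmetric : P -> 'M[C]_n;       (* Gram matrix of the form < , > *)
  funit : P -> P;
  feuler : P -> P
}.

Variable F : frobenius.

Definition fmulv (X Y : P -> P) (y : P) : P := fmul F y (X y) (Y y).

Definition fprod (X Y : P -> P) (y : P) : C := bil (fmetric F y) (X y) (Y y).

Definition ctensor (X Y Z : P -> P) (y : P) : C := fprod (fmulv X Y) Z y.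

Definition nabla_c (W X Y Z : P -> P) (y : P) : C :=
  let D := nabla (fmetric F) in
  'D_(W y) (ctensor X Y Z) y
  - ctensor (D W X) Y Z y - ctensor X (D W Y) Z y - ctensor X Y (D W Z) y.

(* A 1-form w and a tangent vector v are identified when <v, -> = w, that is
   w = v *m fmetric; the intersection form is (w1, w2)^* = i_E (w1 . w2). *)
Definition sharp (y w : P) : P := w *m invmx (fmetric F y).
Definition flat (y v : P) : P := v *m fmetric F y.

Definition intersection_form (y : P) : 'M[C]_n :=
  \matrix_(i, j)
    (flat y (fmul F y (sharp y (delta_mx 0 i)) (sharp y (delta_mx 0 j)))
     *m (feuler F y)^T) 0 0.

(* Frobenius structure of charge d on an open subset U of C^n.  Analytic means
   holomorphic, i.e. complex-differentiable at each point of U.  The identities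
   between vector fields are tensorial in the fields w, u, v, z, hence required
   on the constant fields only (the combinations of the coordinate fields). *)
Record is_frobenius (U : set P) (d : C) : Prop := IsFrobenius {
  frob_mul_analytic : forall (u v : P) y, U y ->
    differentiable (fun z => fmul F z u v) y;
  frob_metric_analytic : forall y, U y -> differentiable (fmetric F) y;
  frob_unit_analytic : forall y, U y -> differentiable (funit F) y;
  frob_euler_analytic : forall y, U y -> differentiable (feuler F) y;

  frob_mul_linear : forall y, U y -> forall (a : C) (u v w : P),
    fmul F y u (a *: v + w) = a *: fmul F y u v + fmul F y u w;
  frob_mulC : forall y, U y -> forall u v : P, fmul F y u v = fmul F y v u;
  frob_mulA : forall y, U y -> forall u v w : P,
    fmul F y u (fmul F y v w) = fmul F y (fmul F y u v) w;
  frob_mul1 : forall y, U y -> forall u : P, fmul F y (funit F y) u = u;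

  frob_metric_sym : forall y, U y -> (fmetric F y)^T = fmetric F y;
  frob_metric_nondeg : forall y, U y -> fmetric F y \in unitmx;
  frob_invariant : forall y, U y -> forall u v w : P,
    bil (fmetric F y) (fmul F y u v) w = bil (fmetric F y) u (fmul F y v w);

  frob_flat : forall y, U y -> forall u v w : P,
    curvature (fmetric F) (cst u) (cst v) (cst w) y = 0;
  frob_unit_flat : forall y, U y -> forall w : P,
    nabla (fmetric F) (cst w) (funit F) y = 0;
  frob_nabla_c_sym : forall y, U y -> forall w u v z : P,
    let D := nabla_c in
    [/\ D (cst w) (cst u) (cst v) (cst z) y = D (cst u) (cst w) (cst v) (cst z) y,
        D (cst w) (cst u) (cst v) (cst z) y = D (cst w) (cst v) (cst u) (cst z) y
      & D (cst w) (cst u) (cst v) (cst z) y = D (cst w) (cst u) (cst z) (cst v) y];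

  frob_euler_affine : forall y, U y -> forall u v : P,
    let D := nabla (fmetric F) in
    D (cst u) (D (cst v) (feuler F)) y - D (D (cst u) (cst v)) (feuler F) y = 0;
  frob_euler_mul : forall y, U y -> forall u v : P,
    let X : P -> P := cst u in let Y : P -> P := cst v in
    let E := feuler F in
    bracket E (fmulv X Y) y - fmulv (bracket E X) Y y - fmulv X (bracket E Y) y
    = fmulv X Y y;
  frob_euler_metric : forall y, U y -> forall u v : P,
    let X : P -> P := cst u in let Y : P -> P := cst v in
    let E := feuler F in
    'D_(E y) (fprod X Y) y - fprod (bracket E X) Y y - fprod X (bracket E Y) y
    = (2 - d) * fprod X Y y
}.

End Frobenius.

(* phi is a local biholomorphism on U that carries the structure F on U to the
   structure F' on phi @` U; if phi is moreover injective on U, it is an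
   isomorphism of Frobenius manifolds from U to phi @` U. *)
Definition frobenius_local_iso (R : realType) (n : nat)
    (U : set 'rV[cplx R]_n) (phi : 'rV[cplx R]_n -> 'rV[cplx R]_n)
    (F F' : frobenius R n) : Prop :=
  forall y, U y ->
    [/\ differentiable phi y /\ 'J phi y \in unitmx,
        forall u v, 'D_(fmul F y u v) phi y
                    = fmul F' (phi y) ('D_u phi y) ('D_v phi y),
        forall u v, bil (fmetric F y) u v
                    = bil (fmetric F' (phi y)) ('D_u phi y) ('D_v phi y),
        'D_(funit F y) phi y = funit F' (phi y)
      & 'D_(feuler F y) phi y = feuler F' (phi y)].

Definition frobenius_eq_on (R : realType) (n : nat) (U : set 'rV[cplx R]_n)
    (F F' : frobenius R n) : Prop :=
  forall y, U y ->
    [/\ fmul F y = fmul F' y, fmetric F y = fmetric F' y,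
        funit F y = funit F' y & feuler F y = feuler F' y].

(* Coordinates x_1, ..., x_(l+1) and y^1, ..., y^(l+1) are the entries 0, ..., l
   of a row; x_0 = 0.  The real space V + R is complexified.  A point of the
   orbit space away from e^(2 pi i x_(l+1)) = 0 is represented by its
   coordinates (y^1, ..., y^(l+1)) in C^(l+1), where y^(l+1) is a logarithmic
   coordinate: charts of the orbit space are open subsets of C^(l+1). *)
Section Types.
Variables (R : realType) (l k : nat).
Local Notation C := (cplx R).
Local Notation P := 'rV[C]_l.+1.

Definition xc (x : P) (j : nat) : C := if j is j'.+1 then x 0 (inord j') else 0.

Definition elem_sym (j : nat) (z : 'I_l -> C) : C :=
  \sum_(A : {set 'I_l} | #|A| == j) \prod_(i in A) z i.

Definition dB (j : nat) : C :=
  if (k < l)%N then (if (j < l)%N then (minn j k)%:R else k%:R / 2)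
  else (if (j < l)%N then j%:R / 2 else l%:R / 4).

(* The entry (i, j) of gramB and gramC is (dx_(i+1), dx_(j+1))^~. *)
Definition gramB : 'M[C]_l.+1 :=
  \matrix_(i, j)
    if ((i < l) && (j < l))%N then
      let m := (minn i j).+1 in let n := (maxn i j).+1 in
      (4 * piC R ^+ 2)^-1 *
      ((1 - 2^-1 * (n == l)%:R) * m%:R - l%:R / 4 * ((n == l) && (m == l))%:R)
    else if ((i == l :> nat) && (j == l :> nat))%N then
      - (4 * piC R ^+ 2 * dB k)^-1
    else 0.

Definition gramC : 'M[C]_l.+1 :=
  \matrix_(i, j)
    if ((i < l) && (j < l))%N then (minn i j).+1%:R / (4 * piC R ^+ 2)
    else if ((i == l :> nat) && (j == l :> nat))%N then
      - (4 * piC R ^+ 2 * k%:R)^-1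
    else 0.

(* zetaB_half x j, zetaB x j and zetaC x j carry the label j + 1. *)
Definition zetaB_half (x : P) (j : 'I_l) : C :=
  if (j.+1 < l)%N then 2 * cosC (piC R * (xc x j.+1 - xc x j))
  else 2 * cosC (piC R * (2 * xc x j.+1 - xc x j)).

Definition zetaB (x : P) (j : 'I_l) : C := zetaB_half x j ^+ 2.

Definition zetaC (x : P) (j : 'I_l) : C :=
  let t := 2 * piC R * 'i * (xc x j.+1 - xc x j) in expC t + expC (- t) + 2.

Definition yB_inv (x : P) (j : nat) : C :=
  if (j < l)%N then elem_sym j (zetaB x) else \prod_(i < l) zetaB_half x i.

Definition yB (x : P) : P :=
  \row_(i < l.+1)
    if (i < l)%N then
      expC (2 * piC R * 'i * dB i.+1 * xc x l.+1) * yB_inv x i.+1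
    else 2 * piC R * 'i * xc x l.+1.

Definition yC (x : P) : P :=
  \row_(i < l.+1)
    if (i < l)%N then
      expC (2 * piC R * 'i * (minn i.+1 k)%:R * xc x l.+1)
      * elem_sym i.+1 (zetaC x)
    else 2 * piC R * 'i * xc x l.+1.

Definition ybar (y : P) : P :=
  \row_(i < l.+1)
    if (i.+1 < l)%N then y 0 i
    else if i.+1 == l then y 0 i ^+ 2
    else if (k < l)%N then y 0 i else 2^-1 * y 0 i.

(* G is the metric as a function of the coordinates f: it is determined by the
   equation because yB and yC are onto C^(l+1). *)
Definition metric_in_coordinates (f : P -> P) (M : 'M[C]_l.+1)
    (G : P -> 'M[C]_l.+1) : Prop :=
  forall x, G (f x) = components f M x.

Definition locus : set P := [set y | y 0 (inord l.-1) != 0].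

Definition ek : P := delta_mx 0 (inord k.-1).

(* The Frobenius structures obtained from C_l and the k-th vertex, on an open
   part U of the locus. *)
Definition frobenius_C (GC : P -> 'M[C]_l.+1) (U : set P)
    (F : frobenius R l.+1) : Prop :=
  is_frobenius F U 1 /\
  forall y, U y ->
    [/\ intersection_form F y = GC y,
        invmx (fmetric F y)
          = \matrix_(i, j) partial (inord k.-1) (fun z => GC z i j) y,
        funit F y = ek
      & feuler F y = k%:R^-1 *:
          (\sum_(j < l.+1 | (j < l)%N)
             ((minn j.+1 k)%:R * y 0 j) *: delta_mx 0 j
           + delta_mx 0 ord_max)].

(* The same for B_l, in the coordinates y.  The unity is d/dybar^k, i.e. the
   vector field mapped to ek by the differential of ybar; the contravariant
   flat metric has components d gbar^ij / dybar^k in the coordinates ybar,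
   where gbar^ij are the components there of the intersection form. *)
Definition frobenius_B (GB : P -> 'M[C]_l.+1) (U : set P)
    (F : frobenius R l.+1) : Prop :=
  is_frobenius F U 1 /\
  forall y, U y ->
    [/\ intersection_form F y = GB y,
        'D_(funit F y) ybar y = ek
      & components ybar (invmx (fmetric F y)) y
          = \matrix_(i, j)
              'D_(funit F y) (fun z => components ybar (GB z) z i j) y].

End Types.

Arguments locus R l : clear implicits.

(* Main.v *)
Require Import Defs.
From HB Require Import structures.
From mathcomp Require Import all_boot all_order all_algebra.
From mathcomp Require Import complex ring.
From mathcomp Require Import boolp classical_sets functions reals topology.
From mathcomp Require Import normedtype landau sequences derive exp trigo.

(** In suitable coordinates both metrics are the same diagonal form.  In the
coordinates c_m = 2 cos pi (x_m - x_(m-1)), m <= l, and t = 2 pi i x_(l+1), the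
metric of type C has components diag(1 - c_m^2 / 4, 1 / k) (gramC_diagonal,
components_waves), and the map yC becomes (c, t) |-> exp(d_j t) sigma_j(c_1^2,
..., c_l^2), completed by t (hC, yC_waves).  The linear substitution
x_l |-> 2 x_l, together with x_(l+1) |-> x_(l+1) / 2 if k = l, carries the metric
of type B to that of type C (gramB_scaled); it carries yB to the same map, up to
the scaling of the last coordinate and except that sigma_l = (c_1 ... c_l)^2 is
replaced by c_1 ... c_l (hB, yB_waves).  This product is squared by ybar and the
scaling is undone (ybar_hB): thus ybar o yB and yC are the same map, with the same
metric on the source (ybar_yB_metric).

To obtain the metrics as functions of y, the contraction of two differentials
d sigma_i and d sigma_j is written as a polynomial in the sigma_j by a recursion
of Newton's type (newton, quad), which gives GC (components_hC).  The row of y^l in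
GC is divisible by y^l (GC_top); dividing by the derivative of ybar^l gives GB, also
where y^l = 0 (components_hB).

On the locus y^l != 0 the map ybar is a local biholomorphism which matches the
intersection forms (GB_GC), and the vector field mapped to d/dy^k differentiates
the one exactly as d/dy^k differentiates the other (derive_GC_ybar): the flat
metrics are matched too.  A Frobenius structure of type C is therefore pulled back
along ybar to one of type B (frobenius_B_of_C), and one of type B is pushed forward
where ybar is injective (frobenius_C_of_B).  That the axioms survive is the
naturality of the tensors that they equate (frobenius_atE), which requires the
Christoffel symbols to be holomorphic; they are, because the inverse metric is
built from polynomials, exponentials and 1 / y^l (regular_smooth).  The Euler
field, prescribed for type C, is for type B determined by the intersection form
and the unity (euler_B).  Two structures given on the whole locus are compared near
each point, where ybar is injective: the push-forward of the first one coincides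
with the second one by uniqueness (local_iso_of_unique). *)

Set Implicit Arguments.
Unset Strict Implicit.
Unset Printing Implicit Defensive.
Import Order.TTheory GRing.Theory Num.Theory.
Import numFieldNormedType.Exports.
Local Open Scope classical_set_scope.
Local Open Scope ring_scope.

(** * Differential calculus *)

Section DifferentialCalculus.
Context {K : numFieldType}.

(** Differentiability from an explicit first-order estimate, for the functions
that are not built from differentiable ones: the exponential and the square root. *)
Lemma first_order_differential (V W : normedModType K) (f : V -> W) (y : V)
    (df : {linear V -> W}) : continuous df ->
  (forall e : K, 0 < e ->
     \forall h \near 0, `|f (h + y) - f y - df h| <= e * `|h|) ->
  differentiable f y /\ forall v, 'D_v f y = df v.
Proof.
move=> cdf bf.
have fo : f \o shift y = cst (f y) + df +o_ 0 id.
  apply/eqaddoP => e e0; near=> h.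
  rewrite (_ : ((f \o shift y) - (cst (f y) + df)) h = f (h + y) - f y - df h).
    by near: h; exact: bf.
  by rewrite /= /GRing.add /GRing.opp /= opprD addrA.
have fE : 'd f y = df :> (V -> W) by exact: diff_unique cdf fo.
have dif : differentiable f y by apply/diff_locallyP; rewrite fE.
by split=> // v; rewrite deriveE // fE.
Unshelve. all: by end_near. Qed.

Lemma near_differentiable (V W : normedModType K) (f g : V -> W) (y : V) :
  {near y, f =1 g} -> differentiable f y -> differentiable g y.
Proof.
move=> fg df.
suff gf (e : K) : 0 < e ->
    \forall h \near 0, `|g (h + y) - g y - 'd f y h| <= e * `|h|.
  exact: (first_order_differential (diff_continuous df) gf).1.
move=> e0; have /diff_locally/eqaddoP/(_ e e0) bf := df.
have fg0 : \forall h \near (0 : V), f (h + y) = g (h + y).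
  by move: fg; rewrite (near_shift 0) subr0.
near=> h; rewrite -(near fg0 h) // -(nbhs_singleton fg).
have : `|((f \o shift y) - (cst (f y) + 'd f y)) h| <= e * `|h|.
  by near: h; exact: bf.
by rewrite /= /GRing.add /GRing.opp /= opprD addrA.
Unshelve. all: by end_near. Qed.

Lemma derive_linear (V W : normedModType K) (f : V -> W) (y : V) (a : K) u v :
  differentiable f y -> 'D_(a *: u + v) f y = a *: 'D_u f y + 'D_v f y.
Proof. by move=> df; rewrite !deriveE // linearP. Qed.

Lemma derive_comp (U V W : normedModType K) (f : U -> V) (g : V -> W) y v :
  differentiable f y -> differentiable g (f y) ->
  'D_v (g \o f) y = 'D_('D_v f y) g (f y).
Proof.
move=> df dg; rewrite !deriveE //; last exact: differentiable_comp.
by rewrite diff_comp.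
Qed.

Lemma scale_is_bilinear (W : normedModType K) :
  bilinear_for
    (GRing.Scale.Law.clone _ _ *:%R _) (GRing.Scale.Law.clone _ _ *:%R _)
    (fun (a : K) (w : W) => a *: w).
Proof.
split=> [u'|u] a x y /=; first by rewrite scalerDl scalerA.
by rewrite scalerDr !scalerA mulrC.
Qed.

Lemma scale_product_rule (V W : normedModType K) (f : V -> K) (g : V -> W) y :
  differentiable f y -> differentiable g y ->
  differentiable (fun z => f z *: g z) y /\
  forall v, 'D_v (fun z => f z *: g z) y
    = 'D_v f y *: g y + f y *: 'D_v g y.
Proof.
move=> df dg.
pose sM := bilinear_isBilinear.Build K K W W _ _ _ (@scale_is_bilinear W).
pose s : {bilinear K -> W -> W} := HB.pack (fun (a : K) (w : W) => a *: w) sM.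
have sc : continuous (fun p : K * W => s p.1 p.2) by exact: scale_continuous.
have dp := differentiable_pair df dg.
have ds := differentiable_bilin (f y, g y) sc.
have dfg : differentiable (fun z => f z *: g z) y.
  exact: (differentiable_comp dp ds).
split=> // v; rewrite !deriveE //.
have -> : 'd (fun z => f z *: g z) y
  = 'd (fun p => s p.1 p.2) (f y, g y) \o 'd (fun z => (f z, g z)) y :> (_ -> _).
  exact: (diff_comp dp ds).
by rewrite diff_bilin // diff_pair //= addrC.
Qed.

Lemma derive_scalel (V W : normedModType K) (f : V -> K) (w : W) y v :
  differentiable f y -> 'D_v (fun z => f z *: w) y = 'D_v f y *: w.
Proof.
move=> df; have [_ ->] := scale_product_rule df (differentiable_cst w y).
by rewrite derive_cst scaler0 addr0.
Qed.

Section Sums.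
Variables (V W : normedModType K).

Lemma differentiable_sumf (I : Type) (r : seq I) (P : pred I)
    (f : I -> V -> W) (y : V) :
  (forall i, P i -> differentiable (f i) y) ->
  differentiable (fun z => \sum_(i <- r | P i) f i z) y.
Proof.
move=> df; rewrite (_ : (fun z => _) = \sum_(i <- r | P i) f i); last first.
  by rewrite funeqE => z; rewrite fct_sumE.
by elim/big_ind : _ => // g h ? ?; apply: differentiableD.
Qed.

Lemma derive_sumf (I : Type) (r : seq I) (P : pred I)
    (f : I -> V -> W) (y v : V) :
  (forall i, P i -> differentiable (f i) y) ->
  'D_v (fun z => \sum_(i <- r | P i) f i z) y
    = \sum_(i <- r | P i) 'D_v (f i) y.
Proof.
move=> df.
elim: r => [|i r ih].
  rewrite big_nil (_ : (fun z => _) = cst 0) ?derive_cst //.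
  by rewrite funeqE => z; rewrite big_nil.
rewrite big_cons -ih; case: ifPn => Pi; last first.
  by congr ('D_v _ y); rewrite funeqE => z; rewrite big_cons (negPf Pi).
rewrite -deriveD; [|exact/diff_derivable/df|exact/diff_derivable/differentiable_sumf].
by congr ('D_v _ y); rewrite funeqE => z; rewrite big_cons Pi.
Qed.

End Sums.

Section Matrices.
Variables (V : normedModType K) (m n : nat).

Lemma differentiable_entry (f : V -> 'M[K]_(m, n)) y i j :
  differentiable f y -> differentiable (fun z => f z i j) y.
Proof.
by move=> df; exact: (differentiable_comp df (differentiable_coord (f y) i j)).
Qed.

Lemma differentiable_mx (f : V -> 'M[K]_(m, n)) y :
  (forall i j, differentiable (fun z => f z i j) y) -> differentiable f y.
Proof.
move=> df.
rewrite (_ : f = fun z => \sum_i \sum_j f z i j *: delta_mx i j).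
  by do 2!apply: differentiable_sumf => ? _; exact: differentiableZl.
by rewrite funeqE => z; rewrite -matrix_sum_delta.
Qed.

Lemma derive_entry (f : V -> 'M[K]_(m, n)) y v i j :
  differentiable f y -> 'D_v f y i j = 'D_v (fun z => f z i j) y.
Proof.
move=> df.
rewrite {1}(_ : f = fun z => \sum_i \sum_j f z i j *: delta_mx i j); last first.
  by rewrite funeqE => z; rewrite -matrix_sum_delta.
have de i' j' : differentiable (fun z => f z i' j') y.
  exact: differentiable_entry.
rewrite derive_sumf; last first.
  by move=> i' _; apply: differentiable_sumf => ? _; exact: differentiableZl.
rewrite summxE (bigD1 i) //= [X in _ + X]big1 ?addr0; last first.
  move=> i' i'i; rewrite derive_sumf; last by move=> *; exact: differentiableZl.
  rewrite summxE big1 // => j' _; rewrite derive_scalel // !mxE.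
  by rewrite eq_sym (negPf i'i) mulr0.
rewrite derive_sumf; last by move=> *; exact: differentiableZl.
rewrite summxE (bigD1 j) //= [X in _ + X]big1 ?addr0; last first.
  move=> j' j'j; rewrite derive_scalel // !mxE.
  by rewrite [j == _]eq_sym (negPf j'j) andbF mulr0.
by rewrite derive_scalel // !mxE !eqxx mulr1.
Qed.

End Matrices.

Section LinearMaps.
Variables (V W : lmodType K) (f : V -> W).
Hypothesis lf : linear f.

Lemma linD u v : f (u + v) = f u + f v.
Proof. by have := lf 1 u v; rewrite !scale1r. Qed.

Lemma lin0 : f 0 = 0.
Proof. by apply: (addIr (f 0)); rewrite -linD !add0r. Qed.

Lemma linZ a u : f (a *: u) = a *: f u.
Proof. by have := lf a u 0; rewrite lin0 !addr0. Qed.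

Lemma linN u : f (- u) = - f u.
Proof. by rewrite -scaleN1r linZ scaleN1r. Qed.

Lemma linB u v : f (u - v) = f u - f v.
Proof. by rewrite linD linN. Qed.

End LinearMaps.

Section Leibniz.
Variables (V W : normedModType K) (n : nat).
Local Notation P := 'rV[K]_n.

Lemma linear_row_sum (f : P -> W) (v : P) : linear f ->
  f v = \sum_a v 0 a *: f (delta_mx 0 a).
Proof.
move=> lf; pose fM := GRing.isLinear.Build _ _ _ _ f lf.
pose fL : {linear P -> W} := HB.pack f fM.
rewrite {1}[v]row_sum_delta -[f]/(fL : P -> W) linear_sum.
by apply: eq_bigr => a _; rewrite linearZ.
Qed.

Lemma derive_row (f : P -> W) (y v : P) : differentiable f y ->
  'D_v f y = \sum_a v 0 a *: 'D_(delta_mx 0 a) f y.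
Proof.
move=> df; apply: (linear_row_sum (f := fun v => 'D_v f y)) => a u w.
exact: derive_linear.
Qed.

Definition is_bilinear (T : P -> P -> W) : Prop :=
  (forall v, linear (T ^~ v)) /\ (forall u, linear (T u)).

(** The Leibniz rule for a field of linear maps evaluated on a vector field:
expanded on the coordinate frame it is the product rule. *)
Lemma leibniz1 (T : V -> P -> W) (X : V -> P) (y : V) :
  (\forall z \near y, linear (T z)) ->
  (forall u, differentiable (fun z => T z u) y) -> differentiable X y ->
  differentiable (fun z => T z (X z)) y /\
  forall w, 'D_w (fun z => T z (X z)) y
    = 'D_w (fun z => T z (X y)) y + T y ('D_w X y).
Proof.
move=> Tlin dT dX; have Ty := nbhs_singleton Tlin.
have dXa a : differentiable (fun z => X z 0 a) y by exact: differentiable_entry.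
have dt a := scale_product_rule (dXa a) (dT (delta_mx 0 a)).
have TS : {near y, (fun z => \sum_a X z 0 a *: T z (delta_mx 0 a))
                   =1 fun z => T z (X z)}.
  by near=> z; apply/esym/linear_row_sum; near: z.
have TS' : {near y, (fun z => T z (X y))
                    =1 fun z => \sum_a X y 0 a *: T z (delta_mx 0 a)}.
  by near=> z; apply: linear_row_sum; near: z.
split=> [|w].
  apply: near_differentiable TS _.
  by apply: differentiable_sumf => a _; have [] := dt a.
rewrite -(near_eq_derive _ TS) (near_eq_derive _ TS').
rewrite derive_sumf; last by move=> a _; have [] := dt a.
rewrite derive_sumf; last by move=> a _; exact: differentiableZ.
rewrite (linear_row_sum ('D_w X y) Ty) -big_split /=.
apply: eq_bigr => a _; have [_ ->] := dt a.
by rewrite derive_entry // addrC deriveZ //; exact: diff_derivable.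
Unshelve. all: by end_near. Qed.

(** Products, forms and connections composed with a coordinate change are all
differentiated by this rule. *)
Lemma leibniz (T : V -> P -> P -> W) (X Y : V -> P) (y : V) :
  (\forall z \near y, is_bilinear (T z)) ->
  (forall u v, differentiable (fun z => T z u v) y) ->
  differentiable X y -> differentiable Y y ->
  differentiable (fun z => T z (X z) (Y z)) y /\
  forall w, 'D_w (fun z => T z (X z) (Y z)) y
    = 'D_w (fun z => T z (X y) (Y y)) y
      + T y ('D_w X y) (Y y) + T y (X y) ('D_w Y y).
Proof.
move=> Tlin dT dX dY.
have Tr u : \forall z \near y, linear (T z u).
  by near=> z; have [] : is_bilinear (T z) by near: z.
have Tl : \forall z \near y, linear (fun u => T z u (Y z)).
  by near=> z; have [] : is_bilinear (T z) by near: z.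
have dTY u := leibniz1 (Tr u) (dT u) dY.
have [dTXY eXY] := leibniz1 Tl (fun u => (dTY u).1) dX.
split=> // w; rewrite eXY; have [_ ->] := dTY (X y).
by rewrite -!addrA [T y _ ('D_w Y y) + _]addrC.
Unshelve. all: by end_near. Qed.

End Leibniz.

End DifferentialCalculus.

(** * The Levi-Civita connection *)

(** The Christoffel symbols as a bilinear map, so that
nabla_X Y = D_X Y + Gamma(X, Y). *)
HB.lock Definition gamma (R : realType) (n : nat)
    (eta : 'rV[cplx R]_n -> 'M[cplx R]_n) (y u v : 'rV[cplx R]_n) : 'rV[cplx R]_n :=
  \row_i \sum_a \sum_b christoffel eta y i a b * u 0 a * v 0 b.

Section LeviCivita.
Context {R : realType} {n : nat}.
Local Notation C := (cplx R).
Local Notation P := 'rV[C]_n.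
Implicit Types (M : 'M[C]_n) (eta : P -> 'M[C]_n) (u v w y : P).

Lemma bil_is_bilinear M : is_bilinear (bil M : P -> P -> C).
Proof.
split=> [v|u] a x x'; rewrite /bil.
  by rewrite !mulmxDl -!scalemxAl !mxE.
by rewrite linearP /= mulmxDr -scalemxAr !mxE.
Qed.

Lemma bil_sum M u v : bil M u v = \sum_i \sum_j u 0 i * M i j * v 0 j.
Proof.
rewrite /bil mxE exchange_big /=; apply: eq_bigr => j _.
by rewrite mxE -mulr_suml; congr (_ * _); rewrite mxE.
Qed.

Lemma bil_sym M u v : M^T = M -> bil M u v = bil M v u.
Proof.
move=> Ms; rewrite !bil_sum exchange_big /=; apply: eq_bigr => j _.
by apply: eq_bigr => i _; rewrite -[in LHS]Ms mxE mulrC [u 0 i * _]mulrC mulrA.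
Qed.

Lemma bil_linl M v : linear (fun u => bil M u v : C).
Proof. exact: (bil_is_bilinear M).1. Qed.

Lemma bil_linr M u : linear (fun v => bil M u v : C).
Proof. exact: (bil_is_bilinear M).2. Qed.

Lemma bilDl M u u' v : bil M (u + u') v = bil M u v + bil M u' v.
Proof. exact: linD (bil_linl M v) u u'. Qed.

Lemma bilDr M u v v' : bil M u (v + v') = bil M u v + bil M u v'.
Proof. exact: linD (bil_linr M u) v v'. Qed.

Lemma bilBl M u u' v : bil M (u - u') v = bil M u v - bil M u' v.
Proof. exact: linB (bil_linl M v) u u'. Qed.

Lemma bilBr M u v v' : bil M u (v - v') = bil M u v - bil M u v'.
Proof. exact: linB (bil_linr M u) v v'. Qed.

Lemma bil_nondegenerate M u v : M \in unitmx ->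
  (forall w, bil M u w = bil M v w) -> u = v.
Proof.
move=> uM uv; apply: (can_inj (mulmxK uM)).
apply/rowP => i; have := uv (delta_mx 0 i).
by rewrite /bil trmx_delta -!colE !mxE.
Qed.

Lemma differentiable_bil (V : normedModType C) (M : V -> 'M[C]_n) u v (y : V) :
  differentiable M y -> differentiable (fun z => bil (M z) u v) y.
Proof.
move=> dM; have -> : (fun z => bil (M z) u v) =
    fun z => \sum_i \sum_j M z i j *: (u 0 i * v 0 j : C).
  rewrite funeqE => z; rewrite bil_sum; apply: eq_bigr => i _.
  by apply: eq_bigr => j _; rewrite mulrAC mulrC.
by do 2!apply: differentiable_sumf => ? _;
  exact/differentiableZl/differentiable_entry.
Qed.

Lemma derive_bil (V : normedModType C) (M : V -> 'M[C]_n) u v (y w : V) :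
  differentiable M y ->
  'D_w (fun z => bil (M z) u v) y = bil ('D_w M y) u v.
Proof.
move=> dM; have -> : (fun z => bil (M z) u v) =
    fun z => \sum_i \sum_j M z i j *: (u 0 i * v 0 j : C).
  rewrite funeqE => z; rewrite bil_sum; apply: eq_bigr => i _.
  by apply: eq_bigr => j _; rewrite mulrAC mulrC.
have dMij i j : differentiable (fun z => M z i j) y by exact: differentiable_entry.
rewrite derive_sumf; last first.
  by move=> i _; apply: differentiable_sumf => j _; exact: differentiableZl.
rewrite bil_sum; apply: eq_bigr => i _; rewrite derive_sumf; last first.
  by move=> j _; exact: differentiableZl.
apply: eq_bigr => j _; rewrite derive_scalel // derive_entry //.
by rewrite mulrAC [RHS]mulrC.
Qed.

Lemma nablaE eta (X Y : P -> P) y :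
  nabla eta X Y y = 'D_(X y) Y y + gamma eta y (X y) (Y y).
Proof. by rewrite gamma.unlock. Qed.

Lemma gamma_is_bilinear eta y : is_bilinear (gamma eta y).
Proof.
split=> [v|u] a x x'; apply/rowP => i; rewrite gamma.unlock !mxE mulr_sumr -big_split /=;
  apply: eq_bigr => b _; rewrite mulr_sumr -big_split /=;
  apply: eq_bigr => c _; rewrite !mxE; ring.
Qed.

(** Koszul's formula: it expresses the connection by the metric without the
inverse metric, in terms that transform well under a change of coordinates. *)
Lemma koszul eta y u v w :
  differentiable eta y -> (eta y)^T = eta y -> eta y \in unitmx ->
  bil (eta y) (gamma eta y u v) w =
    2^-1 * ('D_u (fun z => bil (eta z) w v) y + 'D_v (fun z => bil (eta z) w u) y
            - 'D_w (fun z => bil (eta z) u v) y).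
Proof.
move=> de es eu.
pose k m := \sum_a \sum_b (partial a (fun z => eta z m b) y
  + partial b (fun z => eta z m a) y - partial m (fun z => eta z a b) y)
    * u 0 a * v 0 b.
have gE : gamma eta y u v = 2^-1 *: ((\row_m k m) *m invmx (eta y)).
  apply/rowP => i; rewrite gamma.unlock !mxE.
  under [in RHS]eq_bigr do rewrite mxE mulr_suml.
  rewrite [in RHS]exchange_big mulr_sumr; apply: eq_bigr => a _ /=.
  under [in RHS]eq_bigr do rewrite mulr_suml.
  rewrite [in RHS]exchange_big mulr_sumr; apply: eq_bigr => b _ /=.
  rewrite /christoffel -!mulrA mulr_suml; congr (_ * _).
  apply: eq_bigr => m _.
  have -> : invmx (eta y) i m = invmx (eta y) m i.
    by rewrite -[in RHS](es) -trmx_inv mxE.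
  move: (partial a _ y) (partial b _ y) (partial m _ y) => pa pb pm.
  move: (invmx _ _ _) => g; ring.
have dE (x s t : P) : 'D_x (fun z => bil (eta z) s t) y
    = \sum_c \sum_i \sum_j x 0 c * partial c (fun z => eta z i j) y
                                  * s 0 i * t 0 j.
  rewrite derive_bil // derive_row // bil_sum.
  rewrite [RHS]exchange_big; apply: eq_bigr => i _ /=.
  rewrite [RHS]exchange_big; apply: eq_bigr => j _ /=.
  rewrite summxE mulr_sumr mulr_suml; apply: eq_bigr => c _.
  by rewrite mxE derive_entry // -/(partial _ _ _) [s 0 i * _]mulrC.
have -> : bil (eta y) (gamma eta y u v) w = 2^-1 * \sum_m k m * w 0 m.
  rewrite gE /bil -!scalemxAl mulmxKV // !mxE; congr (_ * _).
  by apply: eq_bigr => m _; rewrite !mxE.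
congr (_ * _); rewrite !dE.
have -> : \sum_m k m * w 0 m
  = \sum_a \sum_m \sum_b u 0 a * partial a (fun z => eta z m b) y * w 0 m * v 0 b
  + \sum_a \sum_m \sum_b v 0 b * partial b (fun z => eta z m a) y * w 0 m * u 0 a
  - \sum_a \sum_m \sum_b w 0 m * partial m (fun z => eta z a b) y * u 0 a * v 0 b.
  rewrite /k; under eq_bigr do rewrite mulr_suml.
  rewrite exchange_big -sumrN -!big_split /=; apply: eq_bigr => a _.
  rewrite -sumrN -!big_split /=; apply: eq_bigr => m _.
  rewrite mulr_suml -sumrN -!big_split /=; apply: eq_bigr => b _.
  move: (partial a _ y) (partial b _ y) (partial m _ y) => pa pb pm; ring.
congr (_ + _ - _).
  under eq_bigr do rewrite exchange_big.
  rewrite exchange_big; apply: eq_bigr => b _ /=.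
  by rewrite exchange_big.
rewrite exchange_big; apply: eq_bigr => m _ /=.
by [].
Qed.

End LeviCivita.

(** * Frobenius structures at a point *)

Section TensorFields.
Context {R : realType} {n : nat}.
Local Notation C := (cplx R).
Local Notation P := 'rV[C]_n.
Variable G : frobenius R n.
Local Notation eta := (fmetric G).
Local Notation mul := (fmul G).
Local Notation E := (feuler G).
Implicit Types (u v w t y : P).

(** The operations that occur in the axioms of a Frobenius structure, applied to
constant fields and written with tangent vectors at one point: in this form
they can be compared at a point and at its image. *)
Definition nabla_at (X : P -> P) y u : P :=
  'D_u X y + gamma eta y u (X y).

Definition riemann y u v w : P :=
  'D_u (fun z => gamma eta z v w) y + gamma eta y u (gamma eta y v w)
  - ('D_v (fun z => gamma eta z u w) y + gamma eta y v (gamma eta y u w)).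

Definition c3 y u v w : C := bil (eta y) (mul y u v) w.

Definition nabla_c3 y w u v t : C :=
  'D_w (fun z => c3 z u v t) y - c3 y (gamma eta y w u) v t
  - c3 y u (gamma eta y w v) t - c3 y u v (gamma eta y w t).

Definition hessian_euler y u v : P :=
  'D_u (fun z => nabla_at E z v) y + gamma eta y u (nabla_at E y v)
  - nabla_at E y (gamma eta y u v).

Definition lie_mul y u v : P :=
  'D_(E y) (fun z => mul z u v) y - 'D_(mul y u v) E y
  + mul y ('D_u E y) v + mul y u ('D_v E y).

Definition lie_metric y u v : C :=
  'D_(E y) (fun z => bil (eta z) u v) y
  + bil (eta y) ('D_u E y) v + bil (eta y) u ('D_v E y).

(** The axioms that are identities between tensors: unlike the analytic ones,
they make sense at a single point. *)
Record frobenius_at (d : C) (y : P) : Prop := FrobeniusAt {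
  at_mulC : forall u v, mul y u v = mul y v u;
  at_mulA : forall u v w, mul y u (mul y v w) = mul y (mul y u v) w;
  at_mul1 : forall u, mul y (funit G y) u = u;
  at_invariant : forall u v w,
    bil (eta y) (mul y u v) w = bil (eta y) u (mul y v w);
  at_flat : forall u v w, riemann y u v w = 0;
  at_unit_flat : forall w, nabla_at (funit G) y w = 0;
  at_c_sym : forall w u v t,
    [/\ nabla_c3 y w u v t = nabla_c3 y u w v t,
        nabla_c3 y w u v t = nabla_c3 y w v u t
      & nabla_c3 y w u v t = nabla_c3 y w u t v];
  at_euler_affine : forall u v, hessian_euler y u v = 0;
  at_euler_mul : forall u v, lie_mul y u v = mul y u v;
  at_euler_metric : forall u v,
    lie_metric y u v = (2 - d) * bil (eta y) u v
}.

Record tame (U : set P) : Prop := Tame {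
  reg_mul : forall u v y, U y -> differentiable (fun z => mul z u v) y;
  reg_metric : forall y, U y -> differentiable eta y;
  reg_unit : forall y, U y -> differentiable (funit G) y;
  reg_euler : forall y, U y -> differentiable E y;
  reg_bilinear : forall y, U y -> is_bilinear (mul y);
  reg_metric_sym : forall y, U y -> (eta y)^T = eta y;
  reg_metric_nondeg : forall y, U y -> eta y \in unitmx
}.

(** Transporting the identities differentiates the connection and the Euler
field: the existence of these second derivatives has to be known. *)
Record regular (U : set P) : Prop := Regular {
  regular_tame :> tame U;
  reg_gamma : forall u v y, U y -> differentiable (fun z => gamma eta z u v) y;
  reg_deuler : forall v y, U y -> differentiable (fun z => 'D_v E z) y
}.

Lemma nabla_constE u v y : nabla eta (cst u) (cst v) y = gamma eta y u v.
Proof. by rewrite nablaE derive_cst add0r. Qed.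

Lemma bracket_constE u v y : bracket (cst u : P -> P) (cst v) y = 0.
Proof. by rewrite /bracket !derive_cst subrr. Qed.

Lemma curvature_constE u v w y :
  curvature eta (cst u) (cst v) (cst w) y = riemann y u v w.
Proof.
rewrite /curvature /riemann.
have nE (a b : P) : nabla eta (cst a) (cst b) = fun z => gamma eta z a b.
  by rewrite funeqE => z; rewrite nabla_constE.
rewrite !nE !nablaE bracket_constE derive_cst add0r.
by rewrite (lin0 ((gamma_is_bilinear eta y).1 _)) subr0.
Qed.

Lemma nabla_c_constE w u v t y :
  nabla_c G (cst w) (cst u) (cst v) (cst t) y = nabla_c3 y w u v t.
Proof.
rewrite /nabla_c /nabla_c3 /ctensor /Defs.fprod /fmulv.
by rewrite !nabla_constE.
Qed.

Lemma nabla_atE (X : P -> P) u y : nabla eta (cst u) X y = nabla_at X y u.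
Proof. by rewrite nablaE. Qed.

Lemma hessian_euler_constE u v y :
  let D := nabla eta in
  D (cst u) (D (cst v) E) y - D (D (cst u) (cst v)) E y = hessian_euler y u v.
Proof.
have nE : nabla eta (cst v) E = fun z => nabla_at E z v.
  by rewrite funeqE => z; rewrite nabla_atE.
by cbv zeta; rewrite nE nabla_atE nablaE nabla_constE.
Qed.

Lemma bracket_euler_constE (u y : P) : bracket E (cst u) y = - 'D_u E y.
Proof. by rewrite /bracket derive_cst sub0r. Qed.

Lemma lie_mul_constE u v y : is_bilinear (mul y) ->
  bracket E (fmulv G (cst u) (cst v)) y - fmulv G (bracket E (cst u)) (cst v) y
    - fmulv G (cst u) (bracket E (cst v)) y = lie_mul y u v.
Proof.
move=> bm; rewrite /fmulv !bracket_euler_constE /= (linN (bm.1 _)).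
by rewrite (linN (bm.2 _)) !opprK.
Qed.

Lemma lie_metric_constE u v y :
  'D_(E y) (Defs.fprod G (cst u) (cst v)) y - Defs.fprod G (bracket E (cst u)) (cst v) y
    - Defs.fprod G (cst u) (bracket E (cst v)) y = lie_metric y u v.
Proof.
rewrite /Defs.fprod !bracket_euler_constE /= (linN (bil_linl _ _)).
by rewrite (linN (bil_linr _ _)) !opprK.
Qed.

Lemma is_frobenius_tame U d : is_frobenius G U d -> tame U.
Proof.
move=> [] dm dg du dE ml mC _ _ es en _ _ _ _ _ _ _.
split=> // y Uy; split=> [v|u] a x x'; last exact: ml.
by rewrite !(mC y Uy _ v) ml.
Qed.

Lemma is_frobenius_at U d y : is_frobenius G U d -> U y -> frobenius_at d y.
Proof.
move=> fG Uy; have bm := reg_bilinear (is_frobenius_tame fG) Uy.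
move: fG => [] _ _ _ _ ml mC mA m1 es en inv fl uf cs ea em eg.
split; [exact: mC|exact: mA|exact: m1|exact: inv|..].
- by move=> u v w; rewrite -curvature_constE fl.
- by move=> w; rewrite -nabla_atE; exact: uf.
- by move=> w u v t; rewrite -!nabla_c_constE; exact: cs.
- by move=> u v; rewrite -hessian_euler_constE; exact: ea.
- by move=> u v; rewrite -lie_mul_constE //; exact: em.
- by move=> u v; rewrite -lie_metric_constE; exact: eg.
Qed.

Lemma frobenius_at_is U d : regular U -> (forall y, U y -> frobenius_at d y) ->
  is_frobenius G U d.
Proof.
move=> rG at_.
split.
- by move=> u v y Uy; exact: reg_mul rG _ _ _ Uy.
- by move=> y Uy; exact: reg_metric rG _ Uy.
- by move=> y Uy; exact: reg_unit rG _ Uy.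
- by move=> y Uy; exact: reg_euler rG _ Uy.
- by move=> y Uy a u v w; exact: (reg_bilinear rG Uy).2.
- by move=> y Uy; exact: at_mulC (at_ y Uy).
- by move=> y Uy; exact: at_mulA (at_ y Uy).
- by move=> y Uy; exact: at_mul1 (at_ y Uy).
- by move=> y Uy; exact: reg_metric_sym rG _ Uy.
- by move=> y Uy; exact: reg_metric_nondeg rG _ Uy.
- by move=> y Uy; exact: at_invariant (at_ y Uy).
- by move=> y Uy u v w; rewrite curvature_constE; exact: at_flat (at_ y Uy) u v w.
- by move=> y Uy w; rewrite nabla_atE; exact: at_unit_flat (at_ y Uy) w.
- move=> y Uy w u v t /=; rewrite !nabla_c_constE.
  exact: at_c_sym (at_ y Uy) w u v t.
- move=> y Uy u v /=.
  exact: etrans (hessian_euler_constE u v y) (at_euler_affine (at_ y Uy) u v).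
- move=> y Uy u v /=; rewrite lie_mul_constE; last exact: (reg_bilinear rG Uy).
  exact: at_euler_mul (at_ y Uy) u v.
- move=> y Uy u v /=; rewrite lie_metric_constE.
  exact: at_euler_metric (at_ y Uy) u v.
Qed.

End TensorFields.

(** * Naturality under coordinate changes *)

Section RegularEuler.
Context {R : realType} {n : nat}.
Local Notation C := (cplx R).
Local Notation P := 'rV[C]_n.
Variables (G : frobenius R n) (U : set P).
Hypothesis rG : regular G U.

Lemma nabla_euler_linear y : U y -> linear (fun w => nabla_at G (feuler G) y w).
Proof.
move=> Uy a u v; rewrite /nabla_at (derive_linear _ _ _ (reg_euler rG Uy)).
rewrite ((gamma_is_bilinear _ _).1 _ a u v).
by rewrite scalerDr addrACA.
Qed.

Lemma differentiable_nabla_euler v y : U y ->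
  differentiable (fun z => nabla_at G (feuler G) z v) y.
Proof.
move=> Uy; apply: differentiableD; first exact: reg_deuler rG _ _ Uy.
have nl : \forall z \near y, linear (gamma (fmetric G) z v).
  by near=> z; exact: (gamma_is_bilinear _ _).2.
exact: (leibniz1 nl (fun w => reg_gamma rG v w Uy) (reg_euler rG Uy)).1.
Unshelve. all: by end_near. Qed.

End RegularEuler.

Section Naturality.
Context {R : realType} {n : nat}.
Local Notation C := (cplx R).
Local Notation P := 'rV[C]_n.

(** A local biholomorphism phi with differential A and second differential B;
the symmetry of the second and third differentials is part of the data. *)
Record coordinate_change (U : set P) (phi : P -> P) (A : P -> P -> P)
    (B : P -> P -> P -> P) : Prop := CoordinateChange {
  cc_open : open U;
  cc_diff : forall y, U y -> differentiable phi y;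
  cc_A : forall y u, U y -> 'D_u phi y = A y u;
  cc_diffA : forall v y, U y -> differentiable (fun z => A z v) y;
  cc_B : forall u v y, U y -> 'D_u (fun z => A z v) y = B y u v;
  cc_diffB : forall u v y, U y -> differentiable (fun z => B z u v) y;
  cc_sym2 : forall u v y, U y -> B y u v = B y v u;
  cc_sym3 : forall w u v y, U y ->
    'D_w (fun z => B z u v) y = 'D_u (fun z => B z w v) y;
  cc_unit : forall y, U y -> 'J phi y \in unitmx
}.

Variables (U : set P) (phi : P -> P) (A : P -> P -> P) (B : P -> P -> P -> P).
Variables (F F' : frobenius R n).
Hypothesis cc : coordinate_change U phi A B.
Hypothesis rF : regular F U.
Hypothesis rF' : regular F' (phi @` U).
Hypothesis iso : frobenius_local_iso U phi F F'.
Implicit Types (u v w t y : P).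

Local Notation g := (fmetric F).
Local Notation g' := (fmetric F').
Local Notation m := (fmul F).
Local Notation m' := (fmul F').
Local Notation E := (feuler F).
Local Notation E' := (feuler F').

Let imU y : U y -> (phi @` U) (phi y). Proof. by move=> Uy; exists y. Qed.

Let nearU y : U y -> \forall z \near y, U z.
Proof. by move=> Uy; apply: open_nbhs_nbhs; split => //; exact: cc_open cc. Qed.

Lemma D_onU (W : normedModType C) (f h : P -> W) y w : U y ->
  (forall z, U z -> f z = h z) -> 'D_w f y = 'D_w h y.
Proof.
move=> Uy fh; apply: near_eq_derive.
by apply: filterS (nearU Uy) => z /fh.
Qed.

Lemma A_linear y : U y -> linear (fun u => A y u).
Proof.
move=> Uy a u v; rewrite -!(cc_A cc _ Uy).
exact/derive_linear/(cc_diff cc Uy).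
Qed.

Lemma A_add y u v : U y -> A y (u + v) = A y u + A y v.
Proof. by move=> Uy; exact: linD (A_linear Uy) u v. Qed.

Lemma A_sub y u v : U y -> A y (u - v) = A y u - A y v.
Proof. by move=> Uy; exact: linB (A_linear Uy) u v. Qed.

Lemma A_jacobian y u : U y -> A y u = u *m 'J phi y.
Proof.
move=> Uy; rewrite -(cc_A cc _ Uy); exact/deriveEjacobian/(cc_diff cc Uy).
Qed.

Lemma A_inj y u v : U y -> A y u = A y v -> u = v.
Proof.
move=> Uy; rewrite !(A_jacobian _ Uy).
exact: can_inj (mulmxK (cc_unit cc Uy)) u v.
Qed.

Lemma A_surj y w : U y -> exists u, A y u = w.
Proof.
move=> Uy; exists (w *m invmx ('J phi y)).
by rewrite (A_jacobian _ Uy) (mulmxKV (cc_unit cc Uy)).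
Qed.

Lemma pull_leibniz (W : normedModType C) (T : P -> P -> P -> W) (X Y : P -> P) y :
  U y -> (forall z, U z -> is_bilinear (T (phi z))) ->
  (forall u v, differentiable (fun z => T z u v) (phi y)) ->
  differentiable X y -> differentiable Y y ->
  differentiable (fun z => T (phi z) (X z) (Y z)) y /\
  forall w, 'D_w (fun z => T (phi z) (X z) (Y z)) y
    = 'D_(A y w) (fun z => T z (X y) (Y y)) (phi y)
      + T (phi y) ('D_w X y) (Y y) + T (phi y) (X y) ('D_w Y y).
Proof.
move=> Uy bT dT dX dY; have dphi := cc_diff cc Uy.
have dTp u v : differentiable (fun z => T (phi z) u v) y.
  exact: (differentiable_comp dphi (dT u v)).
have nb : \forall z \near y, is_bilinear (T (phi z)).
  by apply: filterS (nearU Uy) => z /bT.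
have [dl el] := leibniz nb dTp dX dY; split=> // w; rewrite el.
by rewrite -(cc_A cc w Uy) -(derive_comp w dphi (dT _ _)).
Qed.

Lemma mulE y u v : U y -> m' (phi y) (A y u) (A y v) = A y (m y u v).
Proof. by move=> Uy; have [_ e _ _ _] := iso Uy; have := e u v; rewrite !(cc_A cc _ Uy). Qed.

Lemma metricE y u v : U y -> bil (g' (phi y)) (A y u) (A y v) = bil (g y) u v.
Proof. by move=> Uy; have [_ _ e _ _] := iso Uy; have := e u v; rewrite !(cc_A cc _ Uy). Qed.

Lemma eulerE y : U y -> E' (phi y) = A y (E y).
Proof. by move=> Uy; have [_ _ _ _ <-] := iso Uy; rewrite (cc_A cc _ Uy). Qed.

Lemma unitE y : U y -> funit F' (phi y) = A y (funit F y).
Proof. by move=> Uy; have [_ _ _ <- _] := iso Uy; rewrite (cc_A cc _ Uy). Qed.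

Lemma D_A (X : P -> P) y w : U y -> differentiable X y ->
  differentiable (fun z => A z (X z)) y /\
  'D_w (fun z => A z (X z)) y = B y w (X y) + A y ('D_w X y).
Proof.
move=> Uy dX.
have nl : \forall z \near y, linear (fun u => A z u).
  by apply: filterS (nearU Uy) => z /A_linear.
have [d e] := leibniz1 nl (fun u => cc_diffA cc u Uy) dX.
by split=> //; rewrite e (cc_B cc _ _ Uy).
Qed.

(** This differentiates the relation X' o phi = A X. *)
Lemma D_related (X X' : P -> P) y w : U y -> differentiable X y ->
  differentiable X' (phi y) -> (forall z, U z -> X' (phi z) = A z (X z)) ->
  'D_(A y w) X' (phi y) = B y w (X y) + A y ('D_w X y).
Proof.
move=> Uy dX dX' XX'; have [_ <-] := D_A w Uy dX.
rewrite -(cc_A cc w Uy) -(derive_comp w (cc_diff cc Uy) dX').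
exact: (D_onU w Uy XX').
Qed.

Lemma D_metric y u v w : U y ->
  'D_w (fun z => bil (g z) u v) y
  = 'D_(A y w) (fun z => bil (g' z) (A y u) (A y v)) (phi y)
    + bil (g' (phi y)) (B y w u) (A y v) + bil (g' (phi y)) (A y u) (B y w v).
Proof.
move=> Uy; have [_ /(_ w) e] := pull_leibniz (T := fun z => bil (g' z)) Uy
  (fun z _ => bil_is_bilinear (g' (phi z)))
  (fun a b => differentiable_bil a b (reg_metric rF' (imU Uy)))
  (cc_diffA cc u Uy) (cc_diffA cc v Uy).
rewrite -!(cc_B cc _ _ Uy) -[RHS]e {e}.
by apply: (D_onU _ Uy) => z Uz; rewrite metricE.
Qed.

Lemma D_mul y u v w : U y ->
  B y w (m y u v) + A y ('D_w (fun z => m z u v) y)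
  = 'D_(A y w) (fun z => m' z (A y u) (A y v)) (phi y)
    + m' (phi y) (B y w u) (A y v) + m' (phi y) (A y u) (B y w v).
Proof.
move=> Uy; have [_ e] := D_A (X := fun z => m z u v) w Uy (reg_mul rF u v Uy).
rewrite -[LHS]e {e}.
have [_ /(_ w) e] := pull_leibniz (T := m') Uy
  (fun z Uz => reg_bilinear rF' (imU Uz))
  (fun a b => reg_mul rF' a b (imU Uy)) (cc_diffA cc u Uy) (cc_diffA cc v Uy).
rewrite -!(cc_B cc _ _ Uy) -[RHS]e {e}.
by apply: (D_onU _ Uy) => z Uz; rewrite mulE.
Qed.

(** The inhomogeneous transformation law of the connection: by Koszul's formula,
where all terms in B cancel except B(u, v), by the symmetry of B and of the
metric. *)
Lemma gammaE y u v : U y ->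
  gamma g' (phi y) (A y u) (A y v) = A y (gamma g y u v) - B y u v.
Proof.
move=> Uy; have dg := reg_metric rF Uy; have dg' := reg_metric rF' (imU Uy).
have sg := reg_metric_sym rF Uy; have sg' := reg_metric_sym rF' (imU Uy).
have ng := reg_metric_nondeg rF Uy; have ng' := reg_metric_nondeg rF' (imU Uy).
apply: (bil_nondegenerate ng') => w'; have [w <-] := A_surj w' Uy.
rewrite bilBl (metricE _ _ Uy).
rewrite (koszul _ _ _ dg' sg' ng').
rewrite (koszul _ _ _ dg sg ng).
rewrite !(D_metric _ _ _ Uy).
rewrite (cc_sym2 cc v u Uy) (cc_sym2 cc w u Uy) (cc_sym2 cc w v Uy).
rewrite (bil_sym (A y u) (B y v w) sg') (bil_sym (A y w) (B y u v) sg').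
move: ('D__ _ _) ('D__ _ _) ('D__ _ _) (bil _ (B y u v) _) => a b c p.
move: (bil _ (B y u w) _) (bil _ (B y v w) _) => q r.
by field.
Qed.

Lemma nabla_related (X X' : P -> P) y u : U y -> differentiable X y ->
  differentiable X' (phi y) -> (forall z, U z -> X' (phi z) = A z (X z)) ->
  nabla_at F' X' (phi y) (A y u) = A y (nabla_at F X y u).
Proof.
move=> Uy dX dX' XX'; rewrite /nabla_at (D_related u Uy dX dX' XX') XX' //.
rewrite gammaE // (A_add _ _ Uy).
by rewrite addrC subrKA addrC.
Qed.

(** The terms in B and in its derivative are symmetric in u and v, and cancel in
the curvature. *)
Lemma riemannE y u v w : U y ->
  riemann F' (phi y) (A y u) (A y v) (A y w) = A y (riemann F y u v w).
Proof.
move=> Uy; have bG' := gamma_is_bilinear g' (phi y).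
have half a b : 'D_(A y a) (fun z => gamma g' z (A y b) (A y w)) (phi y)
    + gamma g' (phi y) (A y a) (gamma g' (phi y) (A y b) (A y w))
  = A y ('D_a (fun z => gamma g z b w) y + gamma g y a (gamma g y b w))
    - ('D_a (fun z => B z b w) y + gamma g' (phi y) (B y a b) (A y w)
       + (gamma g' (phi y) (A y b) (B y a w)
          + gamma g' (phi y) (A y a) (B y b w))).
  have [_ /(_ a) e1] := pull_leibniz (T := gamma g') Uy
    (fun z _ => gamma_is_bilinear g' (phi z))
    (fun c d => reg_gamma rF' c d (imU Uy)) (cc_diffA cc b Uy) (cc_diffA cc w Uy).
  have dGbw : differentiable (fun z => gamma g z b w) y by exact: reg_gamma rF _ _ _ Uy.
  have [dAG e2] := D_A (X := fun z => gamma g z b w) a Uy dGbw.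
  have e3 : 'D_a (fun z => gamma g' (phi z) (A z b) (A z w)) y
      = B y a (gamma g y b w) + A y ('D_a (fun z => gamma g z b w) y)
        - 'D_a (fun z => B z b w) y.
    rewrite -e2 -deriveB; [|exact: diff_derivable|exact/diff_derivable/(cc_diffB cc)].
    by apply: (D_onU _ Uy) => z Uz; rewrite gammaE.
  rewrite gammaE // (linB (bG'.2 _)) gammaE // (A_add _ _ Uy).
  rewrite e3 !(cc_B cc _ _ Uy) in e1.
  have /esym/(canRL (addrK _))/(canRL (addrK _)) -> := e1.
  move: (A y ('D_a _ y)) (A y (gamma _ _ _ _)) => p q.
  move: (B y a (gamma g y b w)) ('D_a _ y) => r s.
  move: (gamma _ _ (B y a b) _) (gamma _ _ _ (B y a w)) (gamma _ _ _ (B y b w)).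
  move=> p' q' r'; apply/rowP => i; rewrite !mxE; ring.
rewrite /riemann (A_sub _ _ Uy).
apply: (etrans (f_equal2 (fun a b => a - b) (half u v) (half v u))).
rewrite (cc_sym2 cc v u Uy) (cc_sym3 cc v u w Uy).
by rewrite [gamma _ _ (A y u) (B y v w) + _]addrC opprB subrKA.
Qed.

Lemma nabla_c3E y w u v t : U y ->
  nabla_c3 F' (phi y) (A y w) (A y u) (A y v) (A y t) = nabla_c3 F y w u v t.
Proof.
move=> Uy; have bm' := reg_bilinear rF' (imU Uy).
have dg' := reg_metric rF' (imU Uy).
have c3E p q r : c3 F' (phi y) (A y p) (A y q) (A y r) = c3 F y p q r.
  by rewrite /c3 mulE // metricE.
have [dX eX] := pull_leibniz (T := m') Uy
  (fun z Uz => reg_bilinear rF' (imU Uz))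
  (fun a b => reg_mul rF' a b (imU Uy)) (cc_diffA cc u Uy) (cc_diffA cc v Uy).
have [_ /(_ w) e1] := pull_leibniz (T := fun z => bil (g' z)) Uy
  (fun z _ => bil_is_bilinear (g' (phi z)))
  (fun a b => differentiable_bil a b dg') dX (cc_diffA cc t Uy).
have nb : \forall z \near phi y, linear (fun x => bil (g' z) x (A y t) : C).
  by near=> z; exact: bil_linl.
have [_ /(_ (A y w)) e2] := leibniz1 nb
  (fun a => differentiable_bil a (A y t) dg') (reg_mul rF' (A y u) (A y v) (imU Uy)).
have dc : 'D_w (fun z => c3 F z u v t) y
  = 'D_(A y w) (fun z => c3 F' z (A y u) (A y v) (A y t)) (phi y)
    + c3 F' (phi y) (B y w u) (A y v) (A y t)
    + c3 F' (phi y) (A y u) (B y w v) (A y t)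
    + c3 F' (phi y) (A y u) (A y v) (B y w t).
  transitivity ('D_w (fun z => bil (g' (phi z))
      (m' (phi z) (A z u) (A z v)) (A z t)) y).
    by apply: (D_onU _ Uy) => z Uz; rewrite /c3 mulE // metricE.
  rewrite e1 eX !(cc_B cc _ _ Uy) !bilDl.
  by rewrite [X in _ = X + _ + _ + _]e2 !addrA.
have c3Bl p q r r' : c3 F' (phi y) (p - q) r r'
    = c3 F' (phi y) p r r' - c3 F' (phi y) q r r'.
  by rewrite /c3 (linB (bm'.1 _)) bilBl.
have c3Bm p q r r' : c3 F' (phi y) r (p - q) r'
    = c3 F' (phi y) r p r' - c3 F' (phi y) r q r'.
  by rewrite /c3 (linB (bm'.2 _)) bilBl.
have c3Br p q r r' : c3 F' (phi y) r r' (p - q)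
    = c3 F' (phi y) r r' p - c3 F' (phi y) r r' q.
  by rewrite /c3 bilBr.
rewrite /nabla_c3 [X in _ = X - _ - _ - _]dc !(gammaE _ _ Uy).
rewrite c3Bl c3Bm c3Br !c3E.
move: ('D__ _ _) (c3 F y (gamma _ _ _ _) _ _) (c3 F y u (gamma _ _ _ _) _).
move=> a b c.
move: (c3 F y u v _) (c3 _ _ (B y w u) _ _) (c3 _ _ _ (B y w v) _).
move=> d p q; move: (c3 _ _ _ _ (B y w t)) => r; ring.
Unshelve. all: by end_near. Qed.

(** The covariant derivative of the Euler field is natural on a whole
neighbourhood, so that it can be differentiated once more. *)
Lemma hessian_eulerE y u v : U y ->
  hessian_euler F' (phi y) (A y u) (A y v) = A y (hessian_euler F y u v).
Proof.
move=> Uy; have dphi := cc_diff cc Uy.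
have SE z w : U z -> nabla_at F' E' (phi z) (A z w) = A z (nabla_at F E z w).
  move=> Uz.
  exact: nabla_related Uz (reg_euler rF Uz) (reg_euler rF' (imU Uz)) eulerE.
have dS := differentiable_nabla_euler rF v Uy.
have dS' w := differentiable_nabla_euler rF' w (imU Uy).
have dSp w : differentiable (fun z => nabla_at F' E' (phi z) w) y.
  exact: (differentiable_comp dphi (dS' w)).
have nl : \forall z \near y, linear (fun w => nabla_at F' E' (phi z) w).
  by apply: filterS (nearU Uy) => z Uz; exact (nabla_euler_linear rF' (imU Uz)).
have [_ /(_ u) e1] := leibniz1 nl dSp (cc_diffA cc v Uy).
have e2 : 'D_u (fun z => nabla_at F' E' (phi z) (A y v)) y
    = 'D_(A y u) (fun z => nabla_at F' E' z (A y v)) (phi y).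
  by rewrite -(cc_A cc u Uy); exact: (derive_comp u dphi (dS' (A y v))).
have [_ e3] := D_A (X := fun z => nabla_at F E z v) u Uy dS.
have e4 : 'D_u (fun z => nabla_at F' E' (phi z) (A z v)) y
    = 'D_u (fun z => A z (nabla_at F E z v)) y.
  by apply: (D_onU _ Uy) => z Uz; exact: SE.
move: e1; rewrite e2 e4 e3 (cc_B cc _ _ Uy) => /esym/(canRL (addrK _)) e1.
rewrite /hessian_euler (A_sub _ _ Uy) (A_add _ _ Uy) [X in X + _ - _]e1.
rewrite !(gammaE _ _ Uy) (SE _ _ Uy) (gammaE _ _ Uy).
have -> : nabla_at F' E' (phi y) (A y (gamma g y u v) - B y u v)
    = A y (nabla_at F E y (gamma g y u v)) - nabla_at F' E' (phi y) (B y u v).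
  rewrite -(SE _ _ Uy); exact: linB (nabla_euler_linear rF' (imU Uy)) _ _.
move: (A y ('D_u _ y)) (A y (gamma _ _ _ _)) (A y (nabla_at _ _ _ _)) => p q r.
move: (B y u _) (nabla_at F' E' _ _) => s t.
apply/rowP => i; rewrite !mxE; ring.
Qed.

Lemma lie_mulE y u v : U y ->
  lie_mul F' (phi y) (A y u) (A y v) = A y (lie_mul F y u v).
Proof.
move=> Uy; have bm' := reg_bilinear rF' (imU Uy).
have dE a : 'D_(A y a) E' (phi y) = B y a (E y) + A y ('D_a E y).
  exact: D_related Uy (reg_euler rF Uy) (reg_euler rF' (imU Uy)) eulerE.
rewrite /lie_mul eulerE // mulE // !dE 2!(A_add _ _ Uy) (A_sub _ _ Uy).
rewrite (linD (bm'.1 _)) (linD (bm'.2 _)) !mulE //.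
have /esym/(canRL (addrK _))/(canRL (addrK _)) -> := D_mul u v (E y) Uy.
rewrite (cc_sym2 cc (E y) u Uy) (cc_sym2 cc (E y) v Uy).
rewrite (cc_sym2 cc (E y) (m y u v) Uy).
have alg (e a p q b c d : P) :
    e + a - p - q - (e + b) + (q + c) + (p + d) = a - b + c + d.
  by apply/rowP => i; rewrite !mxE; ring.
exact: alg.
Qed.

Lemma lie_metricE y u v : U y ->
  lie_metric F' (phi y) (A y u) (A y v) = lie_metric F y u v.
Proof.
move=> Uy.
have dE a : 'D_(A y a) E' (phi y) = B y a (E y) + A y ('D_a E y).
  exact: D_related Uy (reg_euler rF Uy) (reg_euler rF' (imU Uy)) eulerE.
have e1 : bil (g' (phi y)) ('D_(A y u) E' (phi y)) (A y v)
    = bil (g' (phi y)) (B y (E y) u) (A y v) + bil (g y) ('D_u E y) v.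
  by rewrite dE bilDl (metricE _ _ Uy) (cc_sym2 cc (E y) u Uy).
have e2 : bil (g' (phi y)) (A y u) ('D_(A y v) E' (phi y))
    = bil (g' (phi y)) (A y u) (B y (E y) v) + bil (g y) u ('D_v E y).
  by rewrite dE bilDr (metricE _ _ Uy) (cc_sym2 cc (E y) v Uy).
rewrite /lie_metric (eulerE Uy) e1 e2 [X in _ = X + _ + _](D_metric _ _ _ Uy).
have alg (a p q b c : C) : a + (p + b) + (q + c) = a + p + q + b + c by ring.
exact: alg.
Qed.

(** Each side of an identity at phi y corresponds under A, which is invertible,
to the same side at y. *)
Lemma frobenius_atE d y : U y -> frobenius_at F d y <-> frobenius_at F' d (phi y).
Proof.
move=> Uy; have A0 : A y 0 = 0 by exact: lin0 (A_linear Uy).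
have sA w' : exists u, A y u = w' by exact: A_surj.
have A_inj' u v : A y u = A y v -> u = v by exact: A_inj.
have nuE w : nabla_at F' (funit F') (phi y) (A y w) = A y (nabla_at F (funit F) y w).
  exact: nabla_related Uy (reg_unit rF Uy) (reg_unit rF' (imU Uy)) unitE.
have mE u v := mulE u v Uy; have gE u v := metricE u v Uy.
have rE u v w := riemannE u v w Uy; have cE w u v t := nabla_c3E w u v t Uy.
have hE u v := hessian_eulerE u v Uy; have lE u v := lie_mulE u v Uy.
have kE u v := lie_metricE u v Uy.
have uE := unitE Uy.
split=> -[mC mA m1 inv fl uf cs ea em eg]; split.
- by move=> u' v'; have [[u <-] [v <-]] := (sA u', sA v'); rewrite !mE mC.
- move=> u' v' w'; have [[u <-] [v <-] ] := (sA u', sA v').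
  by have [w <-] := sA w'; rewrite !mE mA.
- by move=> u'; have [u <-] := sA u'; rewrite uE mE m1.
- move=> u' v' w'; have [[u <-] [v <-] ] := (sA u', sA v').
  by have [w <-] := sA w'; rewrite !mE !gE inv.
- move=> u' v' w'; have [[u <-] [v <-] ] := (sA u', sA v').
  by have [w <-] := sA w'; rewrite rE fl A0.
- by move=> w'; have [w <-] := sA w'; rewrite nuE uf A0.
- move=> w' u' v' t'; have [[u <-] [v <-] ] := (sA u', sA v').
  by have [[w <-] [t <-] ] := (sA w', sA t'); rewrite !cE; exact: cs.
- by move=> u' v'; have [[u <-] [v <-]] := (sA u', sA v'); rewrite hE ea A0.
- by move=> u' v'; have [[u <-] [v <-]] := (sA u', sA v'); rewrite lE em mE.
- by move=> u' v'; have [[u <-] [v <-]] := (sA u', sA v'); rewrite kE gE eg.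
- by move=> u v; apply: A_inj'; rewrite -!mE mC.
- by move=> u v w; apply: A_inj'; rewrite -!mE mA.
- by move=> u; apply: A_inj'; rewrite -mE -uE m1.
- by move=> u v w; rewrite -!gE -!mE inv.
- by move=> u v w; apply: A_inj'; rewrite -rE fl A0.
- by move=> w; apply: A_inj'; rewrite -nuE uf A0.
- by move=> w u v t; rewrite -!cE; exact: cs.
- by move=> u v; apply: A_inj'; rewrite -hE ea A0.
- by move=> u v; apply: A_inj'; rewrite -lE -mE em.
- by move=> u v; rewrite -kE -gE eg.
Qed.

Lemma frobenius_push d : is_frobenius F U d -> is_frobenius F' (phi @` U) d.
Proof.
move=> fF; apply: (frobenius_at_is rF') => _ [y Uy <-].
exact: (frobenius_atE d Uy).1 (is_frobenius_at fF Uy).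
Qed.

Lemma frobenius_pull d : is_frobenius F' (phi @` U) d -> is_frobenius F U d.
Proof.
move=> fF'; apply: (frobenius_at_is rF) => y Uy.
exact: (frobenius_atE d Uy).2 (is_frobenius_at fF' (imU Uy)).
Qed.

End Naturality.

(** * The complex exponential *)

Section ComplexExponential.
Context {R : realType}.
Local Notation C := (cplx R).
Local Open Scope complex_scope.

Lemma complex_mulE (a b c d : R) :
  (Complex a b : C) * Complex c d = Complex (a * c - b * d) (a * d + b * c).
Proof. by []. Qed.

Lemma expCD (a b : C) : expC (a + b) = expC a * expC b.
Proof.
case: a => a1 a2; case: b => b1 b2.
have -> : expC (Complex a1 a2 + Complex b1 b2 : C)
  = Complex (expR (a1 + b1) * cos (a2 + b2)) (expR (a1 + b1) * sin (a2 + b2)).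
  by [].
by rewrite expRD cosD sinD complex_mulE; congr Complex; ring.
Qed.

Lemma expC0 : expC (0 : C) = 1.
Proof. by rewrite /expC /= expR0 cos0 sin0 mulr1 mulr0. Qed.

Lemma expCN_mul (a : C) : expC a * expC (- a) = 1.
Proof. by rewrite -expCD subrr expC0. Qed.

Lemma expC_neq0 (a : C) : expC a != 0.
Proof.
apply/eqP => e0; have := expCN_mul a; rewrite e0 mul0r => /eqP.
by rewrite eq_sym oner_eq0.
Qed.

Lemma real_first_order (f : R -> R) (d e : R) : is_derive (0 : R) (1 : R) f d ->
  0 < e -> \forall h \near (0 : R), `|f h - f 0 - d * h| <= e * `|h|.
Proof.
move=> [df dE] e0; have df' : differentiable f (0 : R) by apply/derivable1_diffP.
have /eqaddoP/(_ e e0) := diff_locally df'.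
apply: filterS => h; congr (`|_| <= _).
have -> : d * h = 'd f (0 : R) h.
  rewrite -dE deriveE // -{2}[h]mulr1 -[h * 1]/(h *: (1 : R)) linearZ /=.
  by rewrite mulrC.
by rewrite /GRing.add /GRing.opp /= [h + 0]addr0 opprD addrA.
Qed.

Lemma norm_complex_le (a b : R) : `|Complex a b : C| <= (`|a| + `|b|)%:C.
Proof.
have -> : (Complex a b : C) = a%:C + 'i%C * b%:C.
  by rewrite -[LHS]/(Complex a b : R[i]) [LHS]complexE.
apply: le_trans (ler_normD _ _) _.
rewrite normrM rmorphD /= !normc_def /= !expr0n /= addr0 add0r expr1n sqrtr1.
by rewrite mul1r !addr0 !sqrtr_sqr.
Qed.

Lemma norm_Re_Im_le (a b : R) :
  `|a|%:C <= `|Complex a b : C| /\ `|b|%:C <= `|Complex a b : C|.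
Proof.
rewrite normc_def !lecR /= -!sqrtr_sqr.
by split; apply: ler_wsqrtr; rewrite (lerDl, lerDr) sqr_ge0.
Qed.

(** To first order exp(a + i b) = 1 + (a + i b): both components are compared
with the real exponential, cosine and sine. *)
Lemma expC_first_order (e : C) : 0 < e ->
  \forall h \near (0 : C), `|expC h - 1 - h| <= e * `|h|.
Proof.
move=> e0; have [e' e'E] : exists e' : R, e = e'%:C.
  by exists (complex.Re e); rewrite RRe_real // gtr0_real.
move: e0; rewrite e'E ltcR => e'0 {e e'E}.
(* The remainder is bounded by terms adding up to 7 d |h|. *)
pose d := e' / 7.
have d0 : 0 < d by rewrite divr_gt0.
have ne : \forall h \near (0 : R), `|expR h - 1 - h| <= d * `|h|.
  have := real_first_order (is_derive_expR (0 : R)) d0.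
  by apply: filterS => h; rewrite expR0 mul1r.
have nc : \forall h \near (0 : R), `|cos h - 1| <= d * `|h|.
  have := real_first_order (is_derive_cos (0 : R)) d0.
  by apply: filterS => h; rewrite cos0 sin0 oppr0 mul0r subr0.
have ns : \forall h \near (0 : R), `|sin h - h| <= d * `|h|.
  have := real_first_order (is_derive_sin (0 : R)) d0.
  by apply: filterS => h; rewrite sin0 cos0 mul1r subr0.
have [r /= r0 Pr] : \forall h \near (0 : R),
    [/\ `|expR h - 1 - h| <= d * `|h|, `|cos h - 1| <= d * `|h|,
        `|sin h - h| <= d * `|h|, `|h| <= 1 & `|h| <= d].
  near=> h; split.
  - exact: (near ne h).
  - exact: (near nc h).
  - exact: (near ns h).
  - by near: h; exact: (@nbhs0_le _ R^o _ ltr01).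
  - by near: h; exact: (@nbhs0_le _ R^o _ d0).
apply/nbhs_ballP; exists (r%:C) => /=; first by rewrite ltcR.
move=> h; rewrite /ball_ /= add0r normrN; case: h => a b hr.
have [na nb] := norm_Re_Im_le a b.
have ball (x : R) : `|x|%:C <= `|Complex a b : C| -> ball_ (fun t : R => `|t|) 0 r x.
  by move=> xh; rewrite /ball_ /= add0r normrN -ltcR (le_lt_trans xh).
have [e1 _ _ a1 a2] := Pr a (ball a na).
have [_ c2 s2 _ _] := Pr b (ball b nb).
have [N NE] : exists N : R, `|Complex a b : C| = N%:C by eexists; exact: normc_def.
move: na nb; rewrite NE !lecR => na nb.
have -> : expC (Complex a b : C) - 1 - Complex a b
    = Complex (expR a * cos b - 1 - a) (expR a * sin b - b) :> C.
  by apply/eqP; rewrite eq_complex /= subr0 !eqxx.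
apply: le_trans (norm_complex_le _ _) _; rewrite -rmorphM lecR.
have -> : expR a * cos b - 1 - a
    = (expR a - 1 - a) * cos b + (1 + a) * (cos b - 1) by ring.
have -> : expR a * sin b - b
    = (expR a - 1 - a) * sin b + (1 + a) * (sin b - b) + a * b by ring.
have N0 : 0 <= N by apply: le_trans na.
have b1a : `|1 + a| <= 2.
  by apply: le_trans (ler_normD _ _) _; rewrite normr1 lerD.
have bd (x : R) : `|x| <= N -> d * `|x| <= d * N by move=> ?; rewrite ler_pM2l.
have bde (t : R) : `|t| <= 1 -> `|(expR a - 1 - a) * t| <= d * N.
  move=> t1; rewrite normrM -[leRHS]mulr1 ler_pM //.
  exact: le_trans e1 (bd _ na).
have bdb (t : R) : `|t| <= d * `|b| -> `|(1 + a) * t| <= 2 * (d * N).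
  by move=> t1; rewrite normrM ler_pM //; exact: le_trans t1 (bd _ nb).
have bab : `|a * b| <= d * N by rewrite normrM ler_pM.
have -> : e' * N = (d * N + 2 * (d * N)) + ((d * N + 2 * (d * N)) + d * N).
  by rewrite /d; field.
apply: lerD.
  apply: le_trans (ler_normD _ _) _; apply: lerD; last exact: bdb.
  by apply: bde; rewrite cos_max.
apply: le_trans (ler_normD _ _) _; apply: lerD => //.
apply: le_trans (ler_normD _ _) _; apply: lerD; last exact: bdb.
by apply: bde; rewrite sin_max.
Unshelve. all: by end_near. Qed.

Lemma expC_differential (z : C) : differentiable (@expC R) z /\
  forall v, 'D_v (@expC R) z = expC z * v.
Proof.
apply: (@first_order_differential C C C (@expC R) z ( *:%R (expC z))).
  exact: scaler_continuous.
move=> e e0; have nz : 0 < `|expC z| by rewrite normr_gt0 expC_neq0.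
have := expC_first_order (divr_gt0 e0 nz); apply: filterS => h he.
have -> : expC (h + z) - expC z - expC z *: h = expC z * (expC h - 1 - h).
  by rewrite !mulrBr mulr1 addrC [h + z]addrC expCD addrC.
by rewrite normrM -ler_pdivlMl // mulrA [_^-1 * e]mulrC.
Qed.

Lemma differentiable_expC (z : C) : differentiable (@expC R) z.
Proof. exact: (expC_differential z).1. Qed.

Lemma derive_expC (z v : C) : 'D_v (@expC R) z = expC z * v.
Proof. exact: (expC_differential z).2. Qed.

End ComplexExponential.

(** * Exponential polynomials *)

Section SmoothFunctions.
Context {R : realType} {n : nat}.
Local Notation C := (cplx R).
Local Notation P := 'rV[C]_n.
Variables p q : 'I_n.
Implicit Types (f g : P -> C) (y v : P) (a : 'I_n).

(** Polynomials in the coordinates, the inverse of the p-th one and the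
exponentials of the q-th one: an algebra of functions on y^p != 0 that is
closed under differentiation, hence consists of smooth functions. *)
Inductive smooth : (P -> C) -> Prop :=
| smooth_cst c : smooth (fun=> c)
| smooth_coord i : smooth (fun y => y 0 i)
| smooth_inv : smooth (fun y => (y 0 p)^-1)
| smooth_exp c : smooth (fun y => expC (c * y 0 q))
| smoothD f g : smooth f -> smooth g -> smooth (fun y => f y + g y)
| smoothM f g : smooth f -> smooth g -> smooth (fun y => f y * g y).

Lemma smooth_ext f g : f =1 g -> smooth f -> smooth g.
Proof. by move=> /funext ->. Qed.

Lemma smooth_sum (I : Type) (r : seq I) (Q : pred I) (f : I -> P -> C) :
  (forall i, Q i -> smooth (f i)) ->
  smooth (fun y => \sum_(i <- r | Q i) f i y).
Proof.
move=> sf; elim: r => [|i r ih].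
  by apply: smooth_ext (smooth_cst 0) => y; rewrite big_nil.
have [Qi|nQi] := boolP (Q i).
  by apply: smooth_ext (smoothD (sf i Qi) ih) => y; rewrite big_cons Qi.
by apply: smooth_ext ih => y; rewrite big_cons (negPf nQi).
Qed.

Definition slit : set P := [set y | y 0 p != 0].

Lemma partial_coord a i y : partial a (fun z => z 0 i) y = (a == i)%:R.
Proof.
have di : differentiable (id : P -> P) y by exact: ex_diff.
rewrite /partial -(derive_entry _ _ _ di) derive_id mxE.
by rewrite eqxx eq_sym.
Qed.

Lemma smooth_partial f : smooth f -> exists f' : 'I_n -> P -> C,
  (forall a, smooth (f' a)) /\
  forall y, slit y -> differentiable f y /\ forall a, partial a f y = f' a y.
Proof.
have dc i y : differentiable (fun z : P => z 0 i) y.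
  exact: differentiable_coord.
have dcst (c : C) y : differentiable (fun _ : P => c) y.
  exact: differentiable_cst.
elim=> {f} [c|i||c|f g _ [f' [sf ef]] _ [g' [sg eg]]|f g sf0 [f' [sf ef]] sg0 [g' [sg eg]]].
- exists (fun _ _ => 0); split=> [a|y _]; first exact: smooth_cst.
  by split=> // a; rewrite /partial derive_cst.
- exists (fun a _ => (a == i)%:R); split=> [a|y _]; first exact: smooth_cst.
  by split=> // a; rewrite partial_coord.
- exists (fun a y => - (a == p)%:R * ((y 0 p)^-1 * (y 0 p)^-1)); split=> [a|y yp].
    by apply: smoothM; [exact: smooth_cst|apply: smoothM; exact: smooth_inv].
  split=> [|a]; first exact: differentiableV.
  rewrite /partial deriveV //; last exact: diff_derivable.
  rewrite -/(partial a (fun z => z 0 p) y) partial_coord.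
  by rewrite -expr2 -exprVn scaleNr mulNr [LHS]/(- (_ * _)) mulrC.
- exists (fun a y => (a == q)%:R * c * expC (c * y 0 q)).
  split=> [a|y _]; first by apply: smoothM; [exact: smooth_cst|exact: smooth_exp].
  have dcq : differentiable (fun z : P => c * z 0 q) y by exact: differentiableM.
  have de := differentiable_expC (c * y 0 q).
  split=> [|a]; first exact: (differentiable_comp dcq de).
  have := derive_comp (delta_mx 0 a) dcq de; rewrite derive_expC => e.
  apply: etrans e _.
  have -> : 'D_(delta_mx 0 a) (fun z : P => c * z 0 q) y = c * (a == q)%:R.
    have [_ e'] := scale_product_rule (dcst c y) (dc q y).
    apply: etrans (e' _) _.
    by rewrite derive_cst scale0r add0r -(partial_coord a q y).
  by rewrite [LHS]mulrC [c * _]mulrC.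
- exists (fun a y => f' a y + g' a y); split=> [a|y ys]; first exact: smoothD.
  have [[df pf] [dg pg]] := (ef y ys, eg y ys); split=> [|a].
    exact: differentiableD.
  rewrite /partial -[LHS]/('D_(delta_mx 0 a) (f + g) y).
  by rewrite deriveD -?pf -?pg //; exact: diff_derivable.
- exists (fun a y => f y * g' a y + g y * f' a y); split=> [a|y ys].
    by apply: smoothD; exact: smoothM.
  have [[df pf] [dg pg]] := (ef y ys, eg y ys); split=> [|a].
    exact: differentiableM.
  rewrite /partial -[LHS]/('D_(delta_mx 0 a) (f * g) y).
  by rewrite deriveM -?pf -?pg //; exact: diff_derivable.
Qed.

Lemma smooth_differentiable f y : smooth f -> slit y -> differentiable f y.
Proof. by move=> /smooth_partial[f' [_ ef]] /ef[]. Qed.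

Lemma smooth_mx_differentiable k m (M : P -> 'M[C]_(k, m)) y :
  (forall i j, smooth (fun z => M z i j)) -> slit y -> differentiable M y.
Proof.
by move=> sM ys; apply: differentiable_mx => i j; exact: smooth_differentiable.
Qed.

Lemma smooth_derive f v : smooth f -> exists2 f', smooth f' &
  forall y, slit y -> 'D_v f y = f' y.
Proof.
move=> /smooth_partial[f' [sf ef]]; exists (fun y => \sum_a v 0 a * f' a y).
  by apply: smooth_sum => a _; apply: smoothM; [exact: smooth_cst|exact: sf].
move=> y ys; have [df pf] := ef y ys; rewrite derive_row //.
by apply: eq_bigr => a _; rewrite -pf.
Qed.

Lemma smooth_mx_derive k m (M : P -> 'M[C]_(k, m)) v :
  (forall i j, smooth (fun z => M z i j)) ->
  exists2 M' : P -> 'M[C]_(k, m), (forall i j, smooth (fun z => M' z i j)) &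
    forall y, slit y -> 'D_v M y = M' y.
Proof.
move=> sM.
have /choice[f' ef] (ij : 'I_k * 'I_m) : exists f', smooth f' /\
    forall y, slit y -> 'D_v (fun z => M z ij.1 ij.2) y = f' y.
  by have [f' ? ?] := smooth_derive v (sM ij.1 ij.2); exists f'.
exists (fun y => \matrix_(i, j) f' (i, j) y) => [i j|y ys].
  by apply: smooth_ext (ef (i, j)).1 => y; rewrite mxE.
apply/matrixP => i j; rewrite mxE -(ef (i, j)).2 //= derive_entry //.
exact: smooth_mx_differentiable.
Qed.

Lemma differentiable_mulmx (V : normedModType C) (k m r : nat)
    (M : V -> 'M[C]_(k, m)) (N : V -> 'M[C]_(m, r)) (y : V) :
  differentiable M y -> differentiable N y ->
  differentiable (fun z => M z *m N z) y /\
  forall w, 'D_w (fun z => M z *m N z) y = 'D_w M y *m N y + M y *m 'D_w N y.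
Proof.
move=> dM dN.
have dMi i j : differentiable (fun z => M z i j) y by exact: differentiable_entry.
have dNi i j : differentiable (fun z => N z i j) y by exact: differentiable_entry.
have dMN i j s : differentiable (fun z => M z i s * N z s j) y.
  exact: differentiableM.
have dS : differentiable (fun z => M z *m N z) y.
  apply: differentiable_mx => i j.
  rewrite (_ : (fun z => _) = fun z => \sum_s M z i s * N z s j).
    by apply: differentiable_sumf => s _.
  by rewrite funeqE => z; rewrite mxE.
split=> // w; apply/matrixP => i j; rewrite derive_entry //.
have -> : (fun z => (M z *m N z) i j) = fun z => \sum_s M z i s * N z s j.
  by rewrite funeqE => z; rewrite mxE.
rewrite derive_sumf // !mxE -big_split /=; apply: eq_bigr => s _.
have [_ e] := scale_product_rule (dMi i s) (dNi s j); apply: etrans (e w) _.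
by rewrite !derive_entry.
Qed.

(** If the metric is the inverse of a smooth matrix N, then
d(eta) = - eta d(N) eta shows that the metric is twice differentiable, hence
that the Christoffel symbols are differentiable. *)
Lemma regular_smooth (G : frobenius R n) (U : set P) (N : P -> 'M[C]_n)
    (X : P -> P) : open U -> U `<=` slit -> tame G U ->
  (forall i j, smooth (fun z => N z i j)) ->
  (forall i, smooth (fun z => X z 0 i)) ->
  (forall y, U y -> invmx (fmetric G y) = N y) ->
  (forall y, U y -> feuler G y = X y) -> regular G U.
Proof.
move=> oU UL tG sN sX NE XE.
have nU y : U y -> \forall z \near y, U z.
  by move=> Uy; exact: open_nbhs_nbhs.
have onU (W : normedModType C) (f h : P -> W) y : U y ->
    (forall z, U z -> f z = h z) -> differentiable f y -> differentiable h y.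
  move=> Uy fh; apply: near_differentiable.
  by apply: filterS (nU y Uy) => z /fh.
have dg y (Uy : U y) := reg_metric tG Uy.
have ng y (Uy : U y) := reg_metric_nondeg tG Uy.
pose g := fmetric G.
have dgE a : exists2 N' : P -> 'M[C]_n,
    (forall y, U y -> differentiable N' y) &
    forall y, U y -> 'D_(delta_mx 0 a) g y = - (g y *m N' y *m g y).
  have [N' sN' N'E] := smooth_mx_derive (delta_mx 0 a) sN.
  exists N' => y Uy; first exact: smooth_mx_differentiable (UL _ Uy).
  have dN : differentiable N y by exact: smooth_mx_differentiable (UL _ Uy).
  have [_ /(_ (delta_mx 0 a))] := differentiable_mulmx (dg y Uy) dN.
  have -> : 'D_(delta_mx 0 a) (fun z => fmetric G z *m N z) y = 0.
    rewrite -(derive_cst (1%:M : 'M[C]_n) y (delta_mx 0 a)).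
    apply: near_eq_derive; apply: filterS (nU y Uy) => z Uz.
    by rewrite -NE // mulmxV // ng.
  rewrite N'E; last exact: UL.
  rewrite -NE // => /esym/eqP; rewrite addr_eq0 => /eqP e.
  by rewrite -[LHS](mulmxKV (ng y Uy)) e mulNmx.
have dpart a i j y : U y -> differentiable (partial a (fun z => g z i j)) y.
  move=> Uy; have [N' dN' gE] := dgE a.
  apply: (onU _ (fun z => (- (g z *m N' z *m g z)) i j) _ _ Uy) => [z Uz|].
    by rewrite -gE // derive_entry //; exact: dg.
  apply/differentiable_entry/differentiableN.
  apply: (differentiable_mulmx _ _).1; last exact: dg.
  by apply: (differentiable_mulmx _ _).1; [exact: dg|exact: dN'].
split=> // [u v y Uy|v y Uy].
  apply: differentiable_mx => i j; rewrite (_ : (fun z => _) =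
    fun z => \sum_a \sum_b christoffel g z j a b * u 0 a * v 0 b); last first.
    by rewrite funeqE => z; rewrite gamma.unlock mxE.
  apply: differentiable_sumf => a _; apply: differentiable_sumf => b _.
  apply: differentiableM; last exact: differentiable_cst.
  apply: differentiableM; last exact: differentiable_cst.
  apply: (onU _ (fun z => 2^-1 * \sum_m N z j m *
    (partial a (fun z => g z m b) z + partial b (fun z => g z m a) z
     - partial m (fun z => g z a b) z)) _ _ Uy) => [z Uz|].
    by rewrite /christoffel NE.
  apply: differentiableM; first exact: differentiable_cst.
  apply: differentiable_sumf => m _; apply: differentiableM.
    by apply: smooth_differentiable; [exact: sN|exact: UL].
  by apply: differentiableB; [apply: differentiableD|]; exact: dpart.
have sX2 (i : 'I_1) j : smooth (fun z => X z i j) by rewrite ord1.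
have [X' sX' X'E] := smooth_mx_derive v sX2.
apply: (onU _ X' _ _ Uy) => [z Uz|].
  rewrite -X'E; last exact: UL.
  by apply: near_eq_derive; apply: filterS (nU z Uz) => t /XE.
exact: smooth_mx_differentiable (UL _ Uy).
Qed.

End SmoothFunctions.

(** * Pull-back of forms and of Frobenius structures *)

Section Pullback.
Context {R : realType} {n : nat}.
Local Notation C := (cplx R).
Local Notation P := 'rV[C]_n.
Implicit Types (F : frobenius R n) (f g phi psi : P -> P) (y u v w : P).

Lemma bil_delta (M : 'M[C]_n) i j : bil M (delta_mx 0 i) (delta_mx 0 j) = M i j.
Proof. by rewrite /bil trmx_delta -rowE -colE !mxE. Qed.

Lemma bil_mulmx (M Q : 'M[C]_n) u v :
  bil M (u *m Q) (v *m Q) = bil (Q *m M *m Q^T) u v.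
Proof. by rewrite /bil trmx_mul !mulmxA. Qed.

Lemma jacobian_row f y (J : 'M[C]_n) :
  differentiable f y -> (forall u, 'D_u f y = u *m J) -> 'J f y = J.
Proof.
move=> df fJ; apply/row_matrixP => i.
by rewrite !rowE -deriveEjacobian // fJ.
Qed.

Lemma partial_jacobian f y a i : differentiable f y ->
  partial a (fun z => f z 0 i) y = 'J f y a i.
Proof.
move=> df; rewrite /partial -derive_entry // deriveEjacobian //.
by rewrite -rowE mxE.
Qed.

Lemma components_jacobian f M y : differentiable f y ->
  components f M y = ('J f y)^T *m M *m 'J f y.
Proof.
move=> df; apply/matrixP => i j; rewrite !mxE exchange_big /=.
apply: eq_bigr => b _; rewrite [X in X * _]mxE mulr_suml.
apply: eq_bigr => a _; rewrite [_^T i a]mxE !partial_jacobian //.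
by rewrite -!mulrA [M a b * _]mulrC.
Qed.

Lemma components_comp f g M y :
  differentiable f y -> differentiable g (f y) ->
  components (fun z => g (f z)) M y = components g (components f M y) (f y).
Proof.
move=> df dg; have dgf := differentiable_comp df dg.
have Jgf : 'J (g \o f) y = 'J f y *m 'J g (f y).
  apply: (jacobian_row dgf) => u.
  by rewrite (derive_comp u df dg) (deriveEjacobian _ dg) (deriveEjacobian _ df) mulmxA.
rewrite (components_jacobian _ dgf) (components_jacobian _ df).
by rewrite (components_jacobian _ dg) Jgf trmx_mul !mulmxA.
Qed.

(** Both directions of transport: the pull-back along phi is the case theta = phi
with Q the Jacobian of phi, the push-forward is the case theta = phi^-1 with Q
the inverse of that Jacobian at theta. *)
Definition pullback (theta : P -> P) (Q : P -> 'M[C]_n) F : frobenius R n :=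
  Frobenius
    (fun z u v => fmul F (theta z) (u *m Q z) (v *m Q z) *m invmx (Q z))
    (fun z => Q z *m fmetric F (theta z) *m (Q z)^T)
    (fun z => funit F (theta z) *m invmx (Q z))
    (fun z => feuler F (theta z) *m invmx (Q z)).

Lemma differentiable_trmx (V : normedModType C) k m (M : V -> 'M[C]_(k, m)) (y : V) :
  differentiable M y -> differentiable (fun z => (M z)^T) y.
Proof.
move=> dM; apply: differentiable_mx => i j.
rewrite (_ : (fun z => _) = fun z => M z j i); last first.
  by rewrite funeqE => z; rewrite mxE.
exact: differentiable_entry.
Qed.

Lemma tame_pullback theta Q F (U U0 : set P) : open U ->
  (forall z, U z -> U0 (theta z)) ->
  (forall z, U z -> differentiable theta z) ->
  (forall z, U z -> differentiable Q z) ->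
  (forall z, U z -> differentiable (fun p => invmx (Q p)) z) ->
  (forall z, U z -> Q z \in unitmx) ->
  tame F U0 -> tame (pullback theta Q F) U.
Proof.
move=> oU UU0 dt dQ dQi uQ tF.
have bil_pull z : U z -> is_bilinear (fmul F (theta z)).
  by move=> Uz; exact: reg_bilinear tF _ (UU0 z Uz).
have comp (W : normedModType C) (h : P -> W) z : U z ->
    differentiable h (theta z) -> differentiable (fun p => h (theta p)) z.
  by move=> Uz dh; exact: (differentiable_comp (dt z Uz) dh).
split=> [u v z Uz|z Uz|z Uz|z Uz|z Uz|z Uz|z Uz] /=.
- apply: (differentiable_mulmx _ (dQi z Uz)).1.
  have dX (x : P) : differentiable (fun p => x *m Q p) z.
    exact: (differentiable_mulmx (differentiable_cst x z) (dQ z Uz)).1.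
  have nb : \forall p \near z, is_bilinear (fmul F (theta p)).
    by apply: filterS (open_nbhs_nbhs (conj oU Uz)) => p /bil_pull.
  have dm a b : differentiable (fun p => fmul F (theta p) a b) z.
    by apply: (comp _ (fun p => fmul F p a b)) => //; exact: reg_mul tF _ _ _ (UU0 z Uz).
  exact: (leibniz nb dm (dX u) (dX v)).1.
- apply: (differentiable_mulmx _ (differentiable_trmx (dQ z Uz))).1.
  apply: (differentiable_mulmx (dQ z Uz) _).1.
  by apply: comp => //; exact: reg_metric tF _ (UU0 z Uz).
- apply: (differentiable_mulmx _ (dQi z Uz)).1.
  by apply: comp => //; exact: reg_unit tF _ (UU0 z Uz).
- apply: (differentiable_mulmx _ (dQi z Uz)).1.
  by apply: comp => //; exact: reg_euler tF _ (UU0 z Uz).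
- have [bl br] := bil_pull z Uz.
  split=> [v|u] a x x'.
    by rewrite mulmxDl -scalemxAl bl mulmxDl -scalemxAl.
  by rewrite mulmxDl -scalemxAl br mulmxDl -scalemxAl.
- by rewrite !trmx_mul trmxK (reg_metric_sym tF (UU0 z Uz)) mulmxA.
- by rewrite !unitmx_mul unitmx_tr uQ // (reg_metric_nondeg tF (UU0 z Uz)).
Qed.

Variables (U : set P) (phi : P -> P) (J : P -> 'M[C]_n).
Hypothesis dphi : forall y, U y -> differentiable phi y.
Hypothesis phiJ : forall y u, U y -> 'D_u phi y = u *m J y.
Hypothesis uJ : forall y, U y -> J y \in unitmx.

Let JE y : U y -> 'J phi y = J y.
Proof. by move=> Uy; apply: jacobian_row => [|u]; [exact: dphi|exact: phiJ]. Qed.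

Lemma pullback_iso F : frobenius_local_iso U phi (pullback phi J F) F.
Proof.
move=> y Uy; split=> [|u v|u v||] /=.
- by rewrite JE //; split; [exact: dphi|exact: uJ].
- by rewrite !phiJ // mulmxKV // uJ.
- by rewrite !phiJ // /bil trmx_mul !mulmxA.
- by rewrite phiJ // mulmxKV // uJ.
- by rewrite phiJ // mulmxKV // uJ.
Qed.

Lemma pushforward_iso psi F : (forall y, U y -> psi (phi y) = y) ->
  frobenius_local_iso U phi F (pullback psi (fun z => invmx (J (psi z))) F).
Proof.
move=> psiK y Uy; split=> [|u v|u v||] /=; rewrite ?psiK ?phiJ // ?invmxK.
- by rewrite JE //; split; [exact: dphi|exact: uJ].
- by rewrite !mulmxK // uJ.
- rewrite /bil !trmx_mul !mulmxA mulmxK ?uJ // -!mulmxA.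
  by rewrite trmx_inv mulKmx // unitmx_tr uJ.
- by [].
- by [].
Qed.

Section Forms.
Variables F F' : frobenius R n.
Hypothesis tF : tame F U.
Hypothesis tF' : tame F' (phi @` U).
Hypothesis iso : frobenius_local_iso U phi F F'.

Lemma metric_local_iso y : U y ->
  fmetric F y = J y *m fmetric F' (phi y) *m (J y)^T.
Proof.
move=> Uy; have [_ _ e _ _] := iso Uy; apply/matrixP => i j.
by rewrite -[LHS]bil_delta e !phiJ // bil_mulmx bil_delta.
Qed.

Lemma inverse_metric_local_iso y : U y ->
  invmx (fmetric F' (phi y)) = (J y)^T *m invmx (fmetric F y) *m J y.
Proof.
move=> Uy; have nF := reg_metric_nondeg tF Uy.
have nF' : fmetric F' (phi y) \in unitmx.
  by apply: (reg_metric_nondeg tF'); exists y.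
apply: (can_inj (mulmxK nF')); rewrite mulVmx //.
have uJT : (J y)^T \in unitmx by rewrite unitmx_tr uJ.
apply: (can_inj (mulmxK uJT)); rewrite mul1mx -!mulmxA.
rewrite [_ *m (_ *m _^T)]mulmxA -metric_local_iso //.
by rewrite mulVmx // mulmx1.
Qed.

Lemma intersection_form_entry G y i j :
  intersection_form G y i j = bil (fmetric G y)
    (fmul G y (sharp G y (delta_mx 0 i)) (sharp G y (delta_mx 0 j))) (feuler G y).
Proof. by rewrite mxE. Qed.

Lemma intersection_form_bil G y w w' : is_bilinear (fmul G y) ->
  bil (intersection_form G y) w w' = bil (fmetric G y)
    (fmul G y (sharp G y w) (sharp G y w')) (feuler G y).
Proof.
move=> [ml mr].
have sl a x x' : sharp G y (a *: x + x') = a *: sharp G y x + sharp G y x'.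
  by rewrite /sharp mulmxDl -scalemxAl.
pose T x x' : C := bil (fmetric G y)
  (fmul G y (sharp G y x) (sharp G y x')) (feuler G y).
have Tl x' : linear (fun x => T x x').
  by move=> a x1 x2; rewrite /T sl ml (bil_linl _ _).
have Tr x : linear (T x).
  by move=> a x1 x2; rewrite /T sl mr (bil_linl _ _).
rewrite -/(T w w') (linear_row_sum w (Tl w')) bil_sum; apply: eq_bigr => i _.
rewrite (linear_row_sum w' (Tr _)) scaler_sumr; apply: eq_bigr => j _.
by rewrite scalerA intersection_form_entry mulrAC.
Qed.

Lemma intersection_form_local_iso y : U y ->
  intersection_form F' (phi y) = (J y)^T *m intersection_form F y *m J y.
Proof.
move=> Uy; have [_ em eg _ eE] := iso Uy.
have sE w : sharp F' (phi y) w = sharp F y (w *m (J y)^T) *m J y.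
  by rewrite /sharp inverse_metric_local_iso // !mulmxA.
apply/matrixP => i j; rewrite intersection_form_entry !sE -!phiJ // -em -eE -eg.
rewrite -intersection_form_bil; last exact: (reg_bilinear tF Uy).
by rewrite bil_mulmx trmxK bil_delta.
Qed.

End Forms.

(** If e is the unity and e^* the dual 1-form, then i_E (e^* . w) = i_E w for
every 1-form w. *)
Lemma euler_intersection_form F y : is_bilinear (fmul F y) ->
  (fmetric F y)^T = fmetric F y -> fmetric F y \in unitmx ->
  (forall u, fmul F y (funit F y) u = u) ->
  flat F y (funit F y) *m intersection_form F y = feuler F y.
Proof.
move=> bm sg ng m1; apply/rowP => i.
have := intersection_form_bil (flat F y (funit F y)) (delta_mx 0 i) bm.
have -> : sharp F y (flat F y (funit F y)) = funit F y.
  by rewrite /sharp /flat mulmxK.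
have br (M : 'M[C]_n) w : bil M w (delta_mx 0 i) = (w *m M) 0 i.
  by rewrite /bil trmx_delta -colE mxE.
rewrite m1 br (bil_sym _ _ sg) => ->.
rewrite /bil /sharp trmx_mul trmx_inv sg mulmxA mulmxK //.
by rewrite trmx_delta -colE mxE.
Qed.

End Pullback.

(** * Contraction of elementary symmetric functions *)

Section ElementarySymmetric.
Context {R : realType} {l : nat}.
Local Notation C := (cplx R).
Implicit Types (z : 'I_l -> C) (m : 'I_l).

(** The point of this operation is that elem_sym j (cut m z) is the derivative of
elem_sym j.+1 with respect to the m-th variable, at z. *)
Definition cut m z : 'I_l -> C := fun i => if i == m then 0 else z i.

Lemma elem_sym0 z : elem_sym 0 z = 1.
Proof.
rewrite /elem_sym (big_pred1 finset.set0) ?finset.big_set0 // => A.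
by rewrite cards_eq0.
Qed.

Lemma elem_sym_big z j : (l < j)%N -> elem_sym j z = 0.
Proof.
move=> lj; rewrite /elem_sym big_pred0 // => A; apply: contraTF lj => /eqP <-.
by rewrite -leqNgt -[leqRHS]card_ord max_card.
Qed.

Lemma elem_sym_top z : elem_sym l z = \prod_i z i.
Proof.
rewrite /elem_sym (big_pred1 (finset.setT : {set 'I_l})) => [|A].
  by apply: eq_bigl => i; rewrite inE.
rewrite /= eqEcard finset.subsetT cardsT card_ord.
have := max_card (mem A); rewrite card_ord => Al.
by rewrite eqn_leq Al.
Qed.

Lemma elem_sym_eq z z' j : z =1 z' -> elem_sym j z = elem_sym j z'.
Proof. by move=> zz'; apply: eq_bigr => A _; apply: eq_bigr. Qed.

Lemma elem_sym_cutE j m z :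
  elem_sym j (cut m z)
  = \sum_(A : {set 'I_l} | (#|A| == j) && (m \notin A)) \prod_(i in A) z i.
Proof.
rewrite /elem_sym (bigID (fun A : {set 'I_l} => m \in A)) /=.
rewrite big1 ?add0r => [|A /andP[_ mA]]; last first.
  by rewrite (bigD1 m) //= /cut eqxx mul0r.
apply: eq_bigr => A /andP[_ mA]; apply: eq_bigr => i iA; rewrite /cut.
by case: eqP iA mA => // -> ->.
Qed.

Lemma mul_elem_sym_cut j m z :
  z m * elem_sym j (cut m z)
  = \sum_(A : {set 'I_l} | (#|A| == j.+1) && (m \in A)) \prod_(i in A) z i.
Proof.
rewrite elem_sym_cutE big_distrr /=.
rewrite [RHS](reindex_onto (fun B => m |: B) (fun A => A :\ m)) /=; last first.
  by move=> A /andP[_ mA]; rewrite finset.setD1K.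
apply: eq_big => [B|B /andP[_ mB]]; last by rewrite finset.big_setU1.
rewrite finset.setU11 andbT; have [mB|mB] := boolP (m \in B).
  rewrite andbF; apply/esym/negP => /andP[_ /eqP e].
  by move: mB; rewrite -e !inE eqxx.
by rewrite cardsU1 mB add1n eqSS finset.setU1K // eqxx !andbT.
Qed.

Lemma elem_sym_cut j m z :
  elem_sym j.+1 z = elem_sym j.+1 (cut m z) + z m * elem_sym j (cut m z).
Proof.
rewrite mul_elem_sym_cut elem_sym_cutE /elem_sym.
by rewrite (bigID (fun A : {set 'I_l} => m \in A)) /= addrC.
Qed.

Lemma sum_mul_cut j z :
  \sum_m z m * elem_sym j (cut m z) = j.+1%:R * elem_sym j.+1 z.
Proof.
under eq_bigr do rewrite mul_elem_sym_cut.
rewrite (exchange_big_dep (fun A : {set 'I_l} => #|A| == j.+1)) /=; last first.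
  by move=> m A _ /andP[].
rewrite big_distrr /=; apply: eq_bigr => A /eqP Aj.
rewrite (eq_bigl (mem A)) => [|i]; last by rewrite Aj eqxx.
by rewrite sumr_const Aj mulr_natl.
Qed.

Lemma sum_cut j z : \sum_m elem_sym j (cut m z) = (l%:R - j%:R) * elem_sym j z.
Proof.
case: j => [|j].
  under eq_bigr do rewrite elem_sym0.
  by rewrite sumr_const card_ord elem_sym0 subr0 mulr1.
have -> : (l%:R - j.+1%:R) * elem_sym j.+1 z
    = \sum_(m < l) elem_sym j.+1 z - \sum_m z m * elem_sym j (cut m z).
  by rewrite sum_mul_cut sumr_const card_ord mulrBl [l%:R * _]mulr_natl.
rewrite -sumrB.
by apply: eq_bigr => m _; rewrite (elem_sym_cut j m z) addrK.
Qed.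

(** The contraction of the differentials of sigma_(p+1) and sigma_(q+1) with the
form diag(z_m), as a polynomial in the sigma_j.  Expanding sigma_(p+1) and
sigma_(q+1) in the m-th variable lowers p at the expense of q. *)
Fixpoint newton (s : nat -> C) (p q : nat) : C :=
  if p is p'.+1
  then newton s p' q.+1 - (p'%:R - q%:R) * s p'.+1 * s q.+1
  else q.+1%:R * s q.+1.

Lemma newtonE z p q :
  \sum_m z m * elem_sym p (cut m z) * elem_sym q (cut m z)
  = newton (fun j => elem_sym j z) p q.
Proof.
elim: p q => [|p ih] q /=.
  by under eq_bigr do rewrite elem_sym0 mulr1; exact: sum_mul_cut.
have -> : (p%:R - q%:R) * elem_sym p.+1 z * elem_sym q.+1 z
    = \sum_m (z m * elem_sym p (cut m z) * elem_sym q.+1 z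
              - z m * elem_sym q (cut m z) * elem_sym p.+1 z).
  rewrite big_split /= sumrN -!mulr_suml !sum_mul_cut !mulrSr; ring.
rewrite -ih -sumrB; apply: eq_bigr => m _.
by rewrite (elem_sym_cut p m z) (elem_sym_cut q m z); ring.
Qed.

(** The same for the form diag(z_m (4 - z_m)). *)
Definition quad (s : nat -> C) (p q : nat) : C :=
  4 * newton s p q - q.+1%:R * s p.+1 * s q.+1 + newton s p.+1 q.

Lemma quadE z p q :
  \sum_m z m * (4 - z m) * elem_sym p (cut m z) * elem_sym q (cut m z)
  = quad (fun j => elem_sym j z) p q.
Proof.
have e : q.+1%:R * elem_sym p.+1 z * elem_sym q.+1 z
    = \sum_m z m * elem_sym q (cut m z) * elem_sym p.+1 z.
  by rewrite -mulr_suml sum_mul_cut mulrAC.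
rewrite /quad -!newtonE e mulr_sumr -sumrB -big_split /=; apply: eq_bigr => m _.
by rewrite (elem_sym_cut p m z); ring.
Qed.

Lemma quad_sym z p q :
  quad (fun j => elem_sym j z) p q = quad (fun j => elem_sym j z) q p.
Proof. by rewrite -!quadE; apply: eq_bigr => m _; rewrite mulrAC. Qed.

Lemma linE z p :
  \sum_m (4 - z m) * elem_sym p (cut m z)
  = 4 * (l%:R - p%:R) * elem_sym p z - p.+1%:R * elem_sym p.+1 z.
Proof.
rewrite -mulrA -sum_cut -sum_mul_cut mulr_sumr -sumrB.
by apply: eq_bigr => m _; rewrite mulrBl.
Qed.

Lemma newton_big (s : nat -> C) p q : (forall j, (l < j)%N -> s j = 0) ->
  (l <= q)%N -> newton s p q = 0.
Proof.
move=> s0; elim: p q => [|p ih] q lq /=; rewrite (s0 q.+1) // mulr0 //.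
by rewrite subr0 ih // (leq_trans lq).
Qed.

Lemma newton_last (s : nat -> C) p q : s 0 = 1 ->
  (forall j, (l < j)%N -> s j = 0) -> q.+1 = l ->
  newton s p q = (l%:R - p%:R) * s p * s l.
Proof.
move=> s0 sl ql; case: p => [|p] /=; first by rewrite ql s0 subr0 mulr1.
rewrite newton_big ?ql // sub0r -!mulNr -ql !mulrSr; congr (_ * _ * _); ring.
Qed.

(** The divisibility by the last symmetric function is an identity in s: it
applies to any point of the orbit space, without writing the coordinates as
symmetric functions of roots. *)
Lemma quad_last (s : nat -> C) p q : s 0 = 1 ->
  (forall j, (l < j)%N -> s j = 0) -> q.+1 = l ->
  quad s p q = s l * (4 * (l%:R - p%:R) * s p - p.+1%:R * s p.+1).
Proof.
move=> s0 sl ql; rewrite /quad !(newton_last _ s0 sl ql) ql !mulrSr; ring.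
Qed.

End ElementarySymmetric.

(** * Coordinatewise and linear maps *)

Section SpecialMaps.
Context {R : realType} {n : nat}.
Local Notation C := (cplx R).
Local Notation P := 'rV[C]_n.
Implicit Types (y v : P).

Lemma derive_const_along (W : normedModType C) (f : P -> W) y v :
  (forall t : C, f (t *: v + y) = f y) -> 'D_v f y = 0.
Proof.
move=> fv; rewrite /derive (_ : (fun h => _) = cst 0).
  by apply: cvg_lim => //; exact: cvg_cst.
by rewrite funeqE => h /=; rewrite fv subrr scaler0.
Qed.

Lemma differentiable_prodf (V : normedModType C) (I : Type) (r : seq I)
    (Q : pred I) (f : I -> V -> C) (y : V) :
  (forall i, Q i -> differentiable (f i) y) ->
  differentiable (fun z => \prod_(i <- r | Q i) f i z) y.
Proof.
move=> df; elim: r => [|i r ih].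
  rewrite (_ : (fun z => _) = cst 1); first exact: differentiable_cst.
  by rewrite funeqE => z; rewrite big_nil.
have [Qi|nQi] := boolP (Q i); last first.
  rewrite (_ : (fun z => _) = fun z => \prod_(j <- r | Q j) f j z) //.
  by rewrite funeqE => z; rewrite big_cons (negPf nQi).
rewrite (_ : (fun z => _) = fun z => f i z * \prod_(j <- r | Q j) f j z).
  by apply: differentiableM; [exact: df|exact: ih].
by rewrite funeqE => z; rewrite big_cons Qi.
Qed.

Lemma product_rule (V : normedModType C) (f g : V -> C) (y v : V) :
  differentiable f y -> differentiable g y ->
  'D_v (fun z => f z * g z) y = 'D_v f y * g y + f y * 'D_v g y.
Proof. by move=> df dg; have [_ e] := scale_product_rule df dg; exact: e. Qed.

Lemma sum_rule (V : normedModType C) (f g : V -> C) (y v : V) :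
  differentiable f y -> differentiable g y ->
  'D_v (fun z => f z + g z) y = 'D_v f y + 'D_v g y.
Proof. by move=> df dg; apply: deriveD; exact: diff_derivable. Qed.

Lemma exp_coord_differential (c : C) (q : 'I_n) y :
  differentiable (fun z : P => expC (c * z 0 q)) y /\
  forall a, partial a (fun z : P => expC (c * z 0 q)) y
    = (a == q)%:R * (c * expC (c * y 0 q)).
Proof.
have dc : differentiable (fun z : P => c * z 0 q) y.
  by apply: differentiableM; [exact: differentiable_cst|exact: differentiable_coord].
have de := differentiable_expC (c * y 0 q).
split=> [|a]; first exact: (differentiable_comp dc de).
apply: etrans (derive_comp (delta_mx 0 a) dc de) _; rewrite derive_expC.
rewrite product_rule; [|exact: differentiable_cst|exact: differentiable_coord].
rewrite derive_cst mul0r add0r (partial_coord a q y : 'D_(delta_mx 0 a) _ y = _).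
ring.
Qed.

Lemma coordinatewise_differential (f : 'I_n -> C -> C) (d : 'I_n -> C) y :
  (forall i, differentiable (f i) (y 0 i) /\
     forall t, 'D_t (f i) (y 0 i) = d i * t) ->
  let F := (fun z => \row_i f i (z 0 i)) : P -> P in
  differentiable F y /\ forall v, 'D_v F y = v *m diag_mx (\row_i d i).
Proof.
move=> fd F.
have dFi i j : differentiable (fun z => F z i j) y.
  rewrite (_ : (fun z => _) = f j \o (fun z : P => z 0 j)).
    by apply: differentiable_comp; [exact: differentiable_coord|exact: (fd j).1].
  by rewrite funeqE => z /=; rewrite mxE.
have dF : differentiable F y by exact: differentiable_mx.
split=> // v; apply/rowP => j; rewrite derive_entry //.
rewrite (_ : (fun z => _) = f j \o (fun z : P => z 0 j)); last first.
  by rewrite funeqE => z /=; rewrite mxE.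
rewrite derive_comp; [|exact: differentiable_coord|exact: (fd j).1].
rewrite (fd j).2 mul_mx_diag !mxE mulrC; congr (_ * _).
have di : differentiable (id : P -> P) y by exact: ex_diff.
by rewrite -(derive_entry _ 0 j di) derive_id.
Qed.

Lemma mulmx_differential (T : 'M[C]_n) y :
  differentiable (fun z : P => z *m T) y /\
  forall v, 'D_v (fun z : P => z *m T) y = v *m T.
Proof.
have di : differentiable (id : P -> P) y by exact: ex_diff.
have [d e] := differentiable_mulmx di (differentiable_cst T y).
by split=> // v; rewrite e derive_id derive_cst mulmx0 addr0.
Qed.

Lemma components_mulmx (T M : 'M[C]_n) y :
  components (fun z => z *m T) M y = T^T *m M *m T.
Proof.
have [d e] := mulmx_differential T y.
by rewrite components_jacobian // (jacobian_row d e).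
Qed.

Lemma components_coordinatewise (f : 'I_n -> C -> C) (d : 'I_n -> C) e y :
  (forall i, differentiable (f i) (y 0 i) /\
     forall t, 'D_t (f i) (y 0 i) = d i * t) ->
  components (fun z => \row_i f i (z 0 i)) (diag_mx e) y
  = diag_mx (\row_i (d i ^+ 2 * e 0 i)).
Proof.
move=> fd; have [dF eF] := coordinatewise_differential fd.
rewrite components_jacobian // (jacobian_row dF eF) tr_diag_mx !mulmx_diag.
by congr diag_mx; apply/rowP => i; rewrite !mxE mulrAC -expr2 mulrC.
Qed.

Lemma components_diag (f : P -> P) e y i j :
  components f (diag_mx e) y i j
  = \sum_a partial a (fun z => f z 0 i) y * partial a (fun z => f z 0 j) y * e 0 a.
Proof.
rewrite mxE; apply: eq_bigr => a _; rewrite (bigD1 a) //= big1 ?addr0.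
  by rewrite !mxE eqxx.
by move=> b ba; rewrite !mxE eq_sym (negPf ba) mulr0.
Qed.

End SpecialMaps.

(** * The intersection forms on the orbit spaces *)

Section OrbitMetrics.
Context {R : realType} (l k : nat).
Local Notation C := (cplx R).
Local Notation P := 'rV[C]_l.+1.
Implicit Types (c x y : P) (i a : 'I_l.+1) (m : 'I_l) (j : nat).

Definition low m : 'I_l.+1 := widen_ord (leqnSn l) m.

Lemma lowE m : low m = m :> nat. Proof. by []. Qed.

Lemma low_lt m : (low m < l)%N. Proof. exact: (ltn_ord m). Qed.

Lemma low_neq_max m : (low m == ord_max) = false.
Proof. by rewrite -val_eqE /= ltn_eqF. Qed.

Variant index_spec i : Type :=
| IndexLow m of i = low m : index_spec i
| IndexMax of i = ord_max : index_spec i.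

Lemma indexP i : index_spec i.
Proof.
have [il|li] := ltnP i l; first by apply: (@IndexLow i (Ordinal il)); exact: val_inj.
apply: IndexMax; apply: val_inj => /=; apply/eqP.
by rewrite eqn_leq li -ltnS ltn_ord.
Qed.

Lemma low_eq m m' : (low m == low m') = (m == m').
Proof. by rewrite -!val_eqE. Qed.

Definition sqz c m : C := c 0 (low m) ^+ 2.

Definition deg (i : nat) : C := (minn i.+1 k)%:R.

(** The map yC in the coordinates c_m = 2 cos pi (x_m - x_(m-1)), m <= l, and
c_(l+1) = 2 pi i x_(l+1), in which the form is diagonal. *)
Definition hC c : P := \row_i
  if (i < l)%N then expC (deg i * c 0 ord_max) * elem_sym i.+1 (sqz c)
  else c 0 ord_max.

(** The form of type C in the coordinates c: if c = 2 cos t, then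
(dc, dc) = 4 sin^2 t (dt, dt) = (4 - c^2) (dt, dt). *)
Definition dform c : P := \row_a
  if (a < l)%N then 1 - c 0 a ^+ 2 / 4 else k%:R^-1.

Lemma hC_low c m :
  hC c 0 (low m) = expC (deg m * c 0 ord_max) * elem_sym m.+1 (sqz c).
Proof. by rewrite mxE low_lt. Qed.

Lemma hC_max c : hC c 0 ord_max = c 0 ord_max.
Proof. by rewrite mxE /= ltnn. Qed.

Lemma differentiable_coord0 i c : differentiable (fun y : P => y 0 i) c.
Proof. exact: differentiable_coord. Qed.

Lemma differentiable_sqz m c : differentiable (fun y : P => sqz y m) c.
Proof. by apply: differentiableM; exact: differentiable_coord0. Qed.

Lemma differentiable_elem_sym j (z : P -> 'I_l -> C) c :
  (forall m, differentiable (fun y => z y m) c) ->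
  differentiable (fun y => elem_sym j (z y)) c.
Proof.
by move=> dz; apply: differentiable_sumf => A _; apply: differentiable_prodf.
Qed.

Lemma differentiable_cut_sqz j m c :
  differentiable (fun y : P => elem_sym j (cut m (sqz y))) c.
Proof.
apply: differentiable_elem_sym => m'; rewrite /cut.
by case: (m' == m); [exact: differentiable_cst|exact: differentiable_sqz].
Qed.

Lemma differentiable_elem_sqz j c :
  differentiable (fun y : P => elem_sym j (sqz y)) c.
Proof. by apply: differentiable_elem_sym => m; exact: differentiable_sqz. Qed.

Lemma partial_cut_sqz j m c :
  partial (low m) (fun y : P => elem_sym j (cut m (sqz y))) c = 0.
Proof.
apply: derive_const_along => t; apply: elem_sym_eq => m'; rewrite /cut /sqz.
case: eqP => // /eqP m'm; rewrite !mxE low_eq (negPf m'm) andbF.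
by rewrite mulr0 add0r.
Qed.

Lemma partial_coord_low m m' c :
  partial (low m) (fun y : P => y 0 (low m')) c = (m == m')%:R.
Proof. by rewrite partial_coord low_eq. Qed.

Lemma partial_elem_sym j m c :
  partial (low m) (fun y : P => elem_sym j.+1 (sqz y)) c
  = 2 * c 0 (low m) * elem_sym j (cut m (sqz c)).
Proof.
rewrite (_ : (fun y : P => _) = fun y : P => elem_sym j.+1 (cut m (sqz y))
    + y 0 (low m) * y 0 (low m) * elem_sym j (cut m (sqz y))); last first.
  by rewrite funeqE => y; rewrite (elem_sym_cut j m) -expr2.
have d1 := differentiable_cut_sqz j.+1 m c.
have d0 := differentiable_cut_sqz j m c.
have dm := differentiable_coord0 (low m) c.
have dmm : differentiable (fun y : P => y 0 (low m) * y 0 (low m)) c.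
  exact: differentiableM.
rewrite /partial sum_rule //; last exact: differentiableM.
rewrite !product_rule // -!/(partial _ _ _) !partial_cut_sqz.
by rewrite !partial_coord_low eqxx /=; ring.
Qed.

Lemma partial_max_elem_sym j c :
  partial ord_max (fun y : P => elem_sym j (sqz y)) c = 0.
Proof.
apply: derive_const_along => t; apply: elem_sym_eq => m.
by rewrite /sqz !mxE low_neq_max andbF mulr0 add0r.
Qed.

(** The components of k times the Euler field, which are also the derivatives of
the y^i along y^(l+1) at fixed zeta. *)
Definition eul y i : C := if (i < l)%N then deg i * y 0 i else 1.

(** The derivative of hC^i with respect to c_m, where sigma_(i+1) depends on c_m
through c_m^2. *)
Definition gradC c i m : C :=
  if (i < l)%N
  then expC (deg i * c 0 ord_max) * (2 * c 0 (low m) * elem_sym i (cut m (sqz c)))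
  else 0.

Lemma differentiable_hC c : differentiable hC c.
Proof.
apply: differentiable_mx => i0 i.
have [m ->|->] := indexP i; last first.
  rewrite (_ : (fun y : P => _) = fun y : P => y 0 ord_max).
    exact: differentiable_coord0.
  by rewrite funeqE => y; rewrite ord1 hC_max.
rewrite (_ : (fun y : P => _) = fun y : P =>
    expC (deg m * y 0 ord_max) * elem_sym m.+1 (sqz y)); last first.
  by rewrite funeqE => y; rewrite ord1 hC_low.
apply: differentiableM; first exact: (exp_coord_differential _ _ _).1.
exact: differentiable_elem_sqz.
Qed.

Lemma partial_hC c i :
  (forall m, partial (low m) (fun y => hC y 0 i) c = gradC c i m) /\
  partial ord_max (fun y => hC y 0 i) c = eul (hC c) i.
Proof.
rewrite /gradC /eul.
have [m' ->|->] := indexP i; last first.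
  rewrite (_ : (fun y => _) = fun y : P => y 0 ord_max); last first.
    by rewrite funeqE => y; rewrite hC_max.
  rewrite partial_coord /= ltnn eqxx; split=> // m.
  by rewrite partial_coord low_neq_max.
rewrite low_lt (_ : (fun y => _) = fun y : P =>
    expC (deg m' * y 0 ord_max) * elem_sym m'.+1 (sqz y)); last first.
  by rewrite funeqE => y; rewrite hC_low.
have [de pe] := exp_coord_differential (deg m') (ord_max : 'I_l.+1) c.
have ds := differentiable_elem_sqz m'.+1 c.
have pr a : partial a (fun y : P =>
    expC (deg m' * y 0 ord_max) * elem_sym m'.+1 (sqz y)) c
  = partial a (fun y : P => expC (deg m' * y 0 ord_max)) c * elem_sym m'.+1 (sqz c)
    + expC (deg m' * c 0 ord_max)
      * partial a (fun y : P => elem_sym m'.+1 (sqz y)) c.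
  exact: product_rule.
split=> [m|]; rewrite pr pe.
  by rewrite low_neq_max !mul0r add0r partial_elem_sym.
by rewrite eqxx partial_max_elem_sym mulr0 addr0 mul1r hC_low mulrA.
Qed.

Lemma inord_low m : inord m = low m.
Proof. by apply: val_inj; rewrite /= inordK // ltnS ltnW. Qed.

(** The value of sigma_j(zeta) at the point with coordinates y. *)
Definition sig y j : C :=
  if j is j'.+1
  then if (j' < l)%N then expC (- deg j' * y 0 ord_max) * y 0 (inord j') else 0
  else 1.

Lemma sig_hC c j : sig (hC c) j = elem_sym j (sqz c).
Proof.
case: j => [|j] /=; first by rewrite elem_sym0.
case: ltnP => [jl|lj]; last by rewrite elem_sym_big.
rewrite -[j]/(Ordinal jl : nat) inord_low hC_max hC_low mulrA -expCD.
by rewrite mulNr addNr expC0 mul1r.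
Qed.

(** The first term comes from dx_(l+1), the second one from the contraction of
d sigma_(i+1) and d sigma_(i'+1).  The recursion behind quad treats its
arguments differently; they are put in order, so that quad_last applies to the
row of y^l. *)
Definition GC y : 'M[C]_l.+1 := \matrix_(i, i')
  (k%:R^-1 * eul y i * eul y i' +
   if ((i < l) && (i' < l))%N
   then expC ((deg i + deg i') * y 0 ord_max)
        * quad (sig y) (minn i i') (maxn i i')
   else 0).

Lemma big_low (F : 'I_l.+1 -> C) : \sum_a F a = \sum_m F (low m) + F ord_max.
Proof. exact: big_ord_recr. Qed.

Lemma dform_low c m : dform c 0 (low m) = 1 - c 0 (low m) ^+ 2 / 4.
Proof. by rewrite mxE low_lt. Qed.

Lemma dform_max c : dform c 0 ord_max = k%:R^-1.
Proof. by rewrite mxE /= ltnn. Qed.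

Lemma components_hC c : components hC (diag_mx (dform c)) c = GC (hC c).
Proof.
apply/matrixP => i i'; rewrite components_diag big_low [RHS]mxE.
have [pi pmi] := partial_hC c i; have [pi' pmi'] := partial_hC c i'.
rewrite pmi pmi' dform_max [RHS]addrC; congr (_ + _); last first.
  by rewrite mulrC mulrA.
under eq_bigr do rewrite pi pi' dform_low.
rewrite /gradC; case: (ltnP i l) => il /=; last first.
  by rewrite big1 // => m _; rewrite !mul0r.
case: (ltnP i' l) => il' /=; last first.
  by rewrite big1 // => m _; rewrite mulr0 mul0r.
have -> : sig (hC c) = fun j => elem_sym j (sqz c).
  by rewrite funeqE => j; rewrite sig_hC.
have -> : quad (fun j => elem_sym j (sqz c)) (minn i i') (maxn i i')
    = quad (fun j => elem_sym j (sqz c)) i i'.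
  by case: (leqP i i') => // _; rewrite quad_sym.
rewrite -quadE hC_max mulrDl expCD mulr_sumr; apply: eq_bigr => m _.
rewrite /sqz; move: (expC _) (expC _) (elem_sym _ _) (elem_sym _ _) => a b e f.
by field.
Qed.

Hypothesis hk : (1 <= k <= l)%N.

Lemma l_gt0 : (0 < l)%N. Proof. by case/andP: hk; apply: leq_trans. Qed.

Lemma k_neq0 : k%:R != 0 :> C.
Proof. by rewrite pnatr_eq0 -lt0n; case/andP: hk. Qed.

Definition top : 'I_l.+1 := inord l.-1.

Lemma topE : top = l.-1 :> nat.
Proof. by rewrite inordK // ltnS leq_pred. Qed.

Lemma top_lt : (top < l)%N.
Proof. by rewrite topE prednK ?l_gt0. Qed.

Lemma succ_top : top.+1 = l.
Proof. by rewrite topE prednK ?l_gt0. Qed.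

Lemma eq_top i : (i.+1 == l) = (i == top).
Proof.
apply/eqP/eqP => [il|->]; last exact: succ_top.
by apply/val_inj/succn_inj; rewrite [LHS]il; exact/esym/succ_top.
Qed.

Lemma deg_top : deg top = k%:R.
Proof. by rewrite /deg succ_top (minn_idPr _) //; case/andP: hk. Qed.

(** The row of y^l in the form of type C, divided by y^l. *)
Definition lastrow y i : C := eul y i +
  if (i < l)%N
  then expC (deg i * y 0 ord_max)
       * (4 * (l%:R - i%:R) * sig y i - i.+1%:R * sig y i.+1)
  else 0.

Lemma sig_big y j : (l < j)%N -> sig y j = 0.
Proof. by case: j => // j; rewrite ltnS /= ltnNge => ->. Qed.

Lemma GC_sym y i i' : GC y i i' = GC y i' i.
Proof.
by rewrite !mxE minnC maxnC andbC [deg i + _]addrC mulrAC.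
Qed.

Lemma GC_top y i : GC y top i = y 0 top * lastrow y i.
Proof.
rewrite [LHS]mxE /lastrow [RHS]mulrDr.
have -> : k%:R^-1 * eul y top * eul y i = y 0 top * eul y i.
  by rewrite {1}/eul top_lt deg_top mulrA mulVf ?k_neq0 // mul1r.
congr (_ + _); rewrite top_lt; case: ltnP => il; last by rewrite mulr0.
have it : (i <= top)%N by rewrite -ltnS succ_top.
rewrite (minn_idPr it) (maxn_idPl it) (quad_last _ _ (sig_big y) succ_top) //.
have -> : sig y l = sig y top.+1 by congr sig; exact/esym/succ_top.
rewrite [sig y top.+1]/= top_lt mulrDl expCD /=.
have -> : inord top = top by apply: val_inj; rewrite /= inordK.
have e := expCN_mul (deg top * y 0 ord_max).
rewrite [- deg top * _]mulNr.
move: (4 * _ * _ - _) (expC _) (expC _) (expC _) (y 0 top) e => q a b d t e.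
have -> : d * a * (b * t * q) = d * b * (t * (a * q)) by ring.
by rewrite e mul1r.
Qed.

(** The derivative of the i-th component of ybar, which depends on the i-th
coordinate only. *)
Definition slope i (t : C) : C :=
  if (i.+1 < l)%N then 1 else if i.+1 == l then 2 * t
  else if (k < l)%N then 1 else 2^-1.

Lemma slope_top t : slope top t = 2 * t.
Proof. by rewrite /slope succ_top ltnn eqxx. Qed.

Lemma slope_other i t : i != top -> slope i t = slope i 0.
Proof. by rewrite /slope eq_top => /negPf ->. Qed.

Lemma slope_neq0 i t : i != top -> slope i t != 0.
Proof.
rewrite /slope eq_top => /negPf ->.
by do 2!(case: ifP => _; first exact: oner_neq0); rewrite invr_eq0 pnatr_eq0.
Qed.

Lemma ybar_top y : ybar k y 0 top = y 0 top ^+ 2.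
Proof. by rewrite mxE succ_top ltnn eqxx. Qed.

Lemma ybar_other y i : i != top -> ybar k y 0 i = slope i 0 * y 0 i.
Proof.
rewrite mxE /slope eq_top => /negPf ->.
by do 2!(case: ifP => _; first by rewrite mul1r).
Qed.

(** The map yB in the diagonalising coordinates: only sigma_l = (c_1 ... c_l)^2 is
replaced by its square root, and the last coordinate is rescaled. *)
Definition hB c : P := \row_i
  if i == top then expC (k%:R / 2 * c 0 ord_max) * \prod_m c 0 (low m)
  else (slope i 0)^-1 * hC c 0 i.

Lemma hB_top c :
  hB c 0 top = expC (k%:R / 2 * c 0 ord_max) * \prod_m c 0 (low m).
Proof. by rewrite mxE eqxx. Qed.

Lemma hB_other c i : i != top -> hB c 0 i = (slope i 0)^-1 * hC c 0 i.
Proof. by rewrite mxE => /negPf ->. Qed.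

Lemma exp_half (t : C) : expC (k%:R / 2 * t) ^+ 2 = expC (k%:R * t).
Proof. by rewrite expr2 -expCD; congr expC; field. Qed.

Lemma ybar_hB c : ybar k (hB c) = hC c.
Proof.
apply/rowP => i; have [->|it] := eqVneq i top; last first.
  by rewrite ybar_other // hB_other // mulVKf // slope_neq0.
rewrite ybar_top hB_top exprMn exp_half mxE top_lt deg_top; congr (_ * _).
have -> : elem_sym top.+1 (sqz c) = elem_sym l (sqz c).
  by congr (elem_sym _ (sqz c)); exact: succ_top.
by rewrite elem_sym_top prodrXl.
Qed.

(** The intersection form of type B; its entries in the row of y^l are those of
type C divided by the derivative of ybar^l, which is possible at y^l = 0 too. *)
Definition GB y : 'M[C]_l.+1 := \matrix_(i, i')
  if i == top then
    if i' == top then 4^-1 * lastrow (ybar k y) top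
    else 2^-1 * y 0 top * (slope i' 0)^-1 * lastrow (ybar k y) i'
  else if i' == top then 2^-1 * y 0 top * (slope i 0)^-1 * lastrow (ybar k y) i
  else (slope i 0)^-1 * (slope i' 0)^-1 * GC (ybar k y) i i'.

Lemma cut_top m (z : 'I_l -> C) :
  elem_sym top (cut m z) = \prod_(m' | m' != m) z m'.
Proof.
rewrite elem_sym_cutE (big_pred1 (finset.setC (finset.set1 m))) => [|A].
  by apply: eq_bigl => m'; rewrite !inE.
have cm : #|finset.setC (finset.set1 m)| = top.
  by rewrite cardsC1 card_ord topE.
apply/andP/eqP => [[/eqP cA mA]|->]; last first.
  by split; [apply/eqP; exact: cm|rewrite !inE negbK].
apply/eqP; rewrite eqEcard cm cA leqnn andbT.
by apply/fintype.subsetP => m' m'A; rewrite !inE; apply: contraNneq mA => <-.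
Qed.

Lemma differentiable_hB_top c : differentiable (fun y => hB y 0 top) c /\
  (forall m, partial (low m) (fun y => hB y 0 top) c
     = expC (k%:R / 2 * c 0 ord_max) * \prod_(m' | m' != m) c 0 (low m')) /\
  partial ord_max (fun y => hB y 0 top) c = k%:R / 2 * hB c 0 top.
Proof.
rewrite (_ : (fun y => hB y 0 top) = fun y : P =>
    expC (k%:R / 2 * y 0 ord_max) * \prod_m y 0 (low m)); last first.
  by rewrite funeqE => y; rewrite hB_top.
have [de pe] := exp_coord_differential (k%:R / 2) (ord_max : 'I_l.+1) c.
have dp (Q : pred 'I_l) :
    differentiable (fun y : P => \prod_(m | Q m) y 0 (low m)) c.
  by apply: differentiable_prodf => m _; exact: differentiable_coord0.
have pr a : partial a (fun y : P =>
    expC (k%:R / 2 * y 0 ord_max) * \prod_m y 0 (low m)) c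
  = partial a (fun y : P => expC (k%:R / 2 * y 0 ord_max)) c
      * \prod_m c 0 (low m)
    + expC (k%:R / 2 * c 0 ord_max)
      * partial a (fun y : P => \prod_m y 0 (low m)) c.
  exact: product_rule.
split; first exact: differentiableM.
split=> [m|]; rewrite pr pe.
  rewrite low_neq_max !mul0r add0r; congr (_ * _).
  rewrite (_ : (fun y : P => _) = fun y : P =>
      y 0 (low m) * \prod_(m' | m' != m) y 0 (low m')); last first.
    by rewrite funeqE => y; rewrite (bigD1 m).
  rewrite /partial product_rule //; last exact: differentiable_coord0.
  rewrite -!/(partial _ _ _) partial_coord_low eqxx mul1r.
  rewrite [X in _ + _ * X](_ : _ = 0) ?mulr0 ?addr0 //.
  apply: derive_const_along => t; apply: eq_bigr => m' m'm.
  by rewrite !mxE low_eq (negPf m'm) andbF mulr0 add0r.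
rewrite eqxx mul1r [X in _ + _ * X](_ : _ = 0) ?mulr0 ?addr0 ?hB_top ?mulrA //.
apply: derive_const_along => t; apply: eq_bigr => m' _.
by rewrite !mxE low_neq_max andbF mulr0 add0r.
Qed.

Lemma partial_hB_other c i a : i != top ->
  partial a (fun y => hB y 0 i) c
  = (slope i 0)^-1 * partial a (fun y => hC y 0 i) c.
Proof.
move=> it; rewrite (_ : (fun y => _) = fun y => (slope i 0)^-1 * hC y 0 i).
  rewrite /partial product_rule; [|exact: differentiable_cst|].
    by rewrite derive_cst mul0r add0r.
  by apply: differentiable_entry; exact: differentiable_hC.
by rewrite funeqE => y; rewrite hB_other.
Qed.

Lemma differentiable_hB c : differentiable hB c.
Proof.
apply: differentiable_mx => i0 i; rewrite ord1.
have [->|it] := eqVneq i top; first exact: (differentiable_hB_top c).1.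
rewrite (_ : (fun y => _) = fun y => (slope i 0)^-1 * hC y 0 i).
  apply: differentiableM; first exact: differentiable_cst.
  by apply: differentiable_entry; exact: differentiable_hC.
by rewrite funeqE => y; rewrite hB_other.
Qed.

(** The product of the c_m' with m' <> m, times c_m, is again the whole product:
the sum over m is the linear form computed by linE. *)
Lemma components_top_other c i :
  \sum_m (expC (k%:R / 2 * c 0 ord_max) * \prod_(m' | m' != m) c 0 (low m'))
      * gradC c i m * (1 - c 0 (low m) ^+ 2 / 4)
    + k%:R / 2 * hB c 0 top * eul (hC c) i * k%:R^-1
  = 2^-1 * hB c 0 top * lastrow (hC c) i.
Proof.
rewrite /lastrow [RHS]mulrDr addrC; congr (_ + _).
  have k0 := k_neq0; move: (hB _ _ _) (eul _ _) => a b; by field.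
rewrite /gradC; case: (ltnP i l) => il; last first.
  by rewrite mulr0 big1 // => m _; rewrite mulr0 mul0r.
rewrite !sig_hC -linE hC_max hB_top !mulr_sumr; apply: eq_bigr => m _.
rewrite [in RHS](bigD1 m) //= /sqz.
move: (expC _) (expC _) (elem_sym _ _) (\prod_(_ < _ | _) _) => a b e f.
by field.
Qed.

Lemma components_top_top c :
  \sum_m (expC (k%:R / 2 * c 0 ord_max) * \prod_(m' | m' != m) c 0 (low m'))
      * (expC (k%:R / 2 * c 0 ord_max) * \prod_(m' | m' != m) c 0 (low m'))
      * (1 - c 0 (low m) ^+ 2 / 4)
    + k%:R / 2 * hB c 0 top * (k%:R / 2 * hB c 0 top) * k%:R^-1
  = 4^-1 * lastrow (hC c) top.
Proof.
rewrite /lastrow [RHS]mulrDr addrC; congr (_ + _).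
  rewrite /eul top_lt deg_top -ybar_hB ybar_top.
  have k0 := k_neq0; move: (hB _ _ _) => a; by field.
rewrite top_lt deg_top !sig_hC -linE hC_max !mulr_sumr; apply: eq_bigr => m _.
rewrite cut_top -exp_half /sqz prodrXl.
move: (expC _) (\prod_(_ < _ | _) _) => a f; by field.
Qed.

Lemma components_hB c : components hB (diag_mx (dform c)) c = GB (hB c).
Proof.
apply/matrixP => i i'; rewrite [RHS]mxE ybar_hB components_diag.
have [_ [pt pmt]] := differentiable_hB_top c.
have [pi pmi] := partial_hC c i; have [pi' pmi'] := partial_hC c i'.
have [->|it] := eqVneq i top; have [->|it'] := eqVneq i' top.
- rewrite big_low pmt dform_max -components_top_top.
  by congr (_ + _); apply: eq_bigr => m _; rewrite pt dform_low.
- rewrite big_low pmt dform_max partial_hB_other // pmi'.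
  transitivity ((slope i' 0)^-1 * (2^-1 * hB c 0 top * lastrow (hC c) i')).
    rewrite -components_top_other mulrDr mulr_sumr; congr (_ + _); last by ring.
    apply: eq_bigr => m _; rewrite pt partial_hB_other // pi' dform_low; ring.
  by rewrite mulrA [_^-1 * _]mulrC.
- rewrite big_low pmt dform_max partial_hB_other // pmi.
  transitivity ((slope i 0)^-1 * (2^-1 * hB c 0 top * lastrow (hC c) i)).
    rewrite -components_top_other mulrDr mulr_sumr; congr (_ + _); last by ring.
    apply: eq_bigr => m _; rewrite pt partial_hB_other // pi dform_low; ring.
  by rewrite mulrA [_^-1 * _]mulrC.
- rewrite -components_hC components_diag mulr_sumr; apply: eq_bigr => a _.
  rewrite !partial_hB_other //.
  have alg (p q r s t : C) : p * q * (r * s) * t = p * r * (q * s * t) by ring.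
  exact: alg.
Qed.

End OrbitMetrics.

(** * Flat coordinates *)

Section FlatCoordinates.
Context {R : realType} (l k : nat) (hk : (1 <= k <= l)%N).
Local Notation C := (cplx R).
Local Notation P := 'rV[C]_l.+1.
Local Notation low := (@low l).
Local Notation top := (top l).
Local Notation slope := (@slope R l k).
Implicit Types (x : P) (i a : 'I_l.+1) (m : 'I_l).

Lemma pi_neq0 : piC R != 0.
Proof.
apply/eqP => p0; have : (pi : R) = 0 by apply: (@complexI R); exact: p0.
by apply/eqP; rewrite gt_eqF // pi_gt0.
Qed.

(** Applied to x_m - x_(m-1) for m <= l and to x_(l+1), these functions give the
coordinates c. *)
Definition wave i (t : C) : C :=
  if (i < l)%N then expC ('i * (piC R * t)) + expC (- ('i * (piC R * t)))
  else 2 * piC R * 'i * t.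

Definition dwave i (t : C) : C :=
  if (i < l)%N
  then 'i * piC R * (expC ('i * (piC R * t)) - expC (- ('i * (piC R * t))))
  else 2 * piC R * 'i.

Lemma scale_differential (c t : C) : differentiable (fun s : C => c * s) t /\
  forall r, 'D_r (fun s : C => c * s) t = c * r.
Proof.
have dc : differentiable (fun s : C => c * s) t.
  by apply: differentiableM; [exact: differentiable_cst|exact: ex_diff].
split=> // r; rewrite product_rule; [|exact: differentiable_cst|exact: ex_diff].
by rewrite derive_cst mul0r add0r derive_id.
Qed.

Lemma wave_differential i t : differentiable (wave i) t /\
  forall v, 'D_v (wave i) t = dwave i t * v.
Proof.
rewrite /wave /dwave; case: ifP => _; last exact: scale_differential.
have ex (c : C) : differentiable (fun s : C => expC (c * s)) t /\
    forall v, 'D_v (fun s : C => expC (c * s)) t = expC (c * t) * (c * v).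
  have [dc ec] := scale_differential c t; have de := differentiable_expC (c * t).
  split=> [|v]; first exact: (differentiable_comp dc de).
  by apply: etrans (derive_comp v dc de) _; rewrite derive_expC ec.
have [d1 e1] := ex ('i * piC R); have [d2 e2] := ex (- ('i * piC R)).
rewrite (_ : (fun s : C => _) = fun s : C =>
    expC ('i * piC R * s) + expC (- ('i * piC R) * s)); last first.
  by rewrite funeqE => s; rewrite mulNr !mulrA.
split; first exact: differentiableD.
move=> v; rewrite sum_rule // e1 e2 mulNr (mulrA 'i (piC R) t).
move: ('i * piC R) => c; move: (expC (c * t)) (expC _) => a b; ring.
Qed.

Definition waves x : P := \row_i wave i (x 0 i).

Lemma differentiable_waves x : differentiable waves x.
Proof. exact: (coordinatewise_differential (fun i => wave_differential i _)).1. Qed.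

Definition flat_form : P :=
  \row_i if (i < l)%N then (4 * piC R ^+ 2)^-1 else - (4 * piC R ^+ 2 * k%:R)^-1.

Lemma components_waves x :
  components waves (diag_mx flat_form) x = diag_mx (dform k (waves x)).
Proof.
rewrite /waves (components_coordinatewise _ (fun i => wave_differential i _)).
congr diag_mx; apply/rowP => i; rewrite !mxE /dwave /wave.
have p0 := pi_neq0; have ii : 'i ^+ 2 = -1 :> C := sqrCi _.
have k0 : k%:R != 0 :> C by exact: k_neq0 hk.
case: ifP => _.
  have := expCN_mul ('i * (piC R * x 0 i)).
  move: (expC _) (expC _) => b a ab.
  have -> : ('i * piC R * (a - b)) ^+ 2 / (4 * piC R ^+ 2)
      = 'i ^+ 2 * ((a - b) ^+ 2 / 4).
    by move: (piC R) p0 => p p0; field.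
  by rewrite ii -[X in _ = X - _]ab; field.
have -> : (2 * piC R * 'i) ^+ 2 * - (4 * piC R ^+ 2 * k%:R)^-1
    = 'i ^+ 2 * - k%:R^-1 :> C.
  by move: (piC R) p0 (k%:R) k0 => p p0 q q0; field; rewrite ?p0 ?q0.
by rewrite ii mulN1r opprK.
Qed.

(** The linear map S diagonalises the flat form, and waves acts coordinatewise. *)
Lemma components_through (h : P -> P) (M S : 'M[C]_l.+1) x :
  S^T *m M *m S = diag_mx flat_form -> (forall c, differentiable h c) ->
  components (fun z => h (waves (z *m S))) M x
  = components h (diag_mx (dform k (waves (x *m S)))) (waves (x *m S)).
Proof.
move=> SM dh; have dS := (mulmx_differential S x).1.
have dW := differentiable_waves (x *m S).
have dWS := differentiable_comp dS dW.
rewrite (components_comp M dWS (dh _)).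
by rewrite (components_comp M dS dW) components_mulmx SM components_waves.
Qed.

(** The matrix of x |-> (x_1, x_2 - x_1, ..., x_l - x_(l-1), x_(l+1)). *)
Definition diffmx : 'M[C]_l.+1 :=
  \matrix_(a, i) ((a == i)%:R - ((a.+1 == i) && (i < l))%N%:R).

Lemma sum_diffmx (F : nat -> C) i :
  \sum_(a < l.+1) F a * diffmx a i
  = F i - (if nat_of_ord i is j.+1 then if (i < l)%N then F j else 0 else 0).
Proof.
under eq_bigr do rewrite mxE mulrBr.
rewrite big_split /= sumrN; congr (_ - _).
  rewrite (bigD1 i) //= eqxx mulr1 big1 ?addr0 // => a ai.
  by rewrite (negPf ai) mulr0.
case: i => -[|j] /= ji; first by rewrite big1 // => a _; rewrite mulr0.
case: ltnP => jl; last by rewrite big1 // => a _; rewrite andbF mulr0.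
have jl1 : (j < l.+1)%N by exact: ltnW.
rewrite (bigD1 (Ordinal jl1)) //= eqxx mulr1 big1 ?addr0 // => a ai.
by rewrite andbT eqSS -[a == j :> nat]/(a == Ordinal jl1) (negPf ai) mulr0.
Qed.

Lemma mul_diffmx x m :
  (x *m diffmx) 0 (low m) = xc x m.+1 - xc x m.
Proof.
rewrite mxE.
have := sum_diffmx (fun j => x 0 (inord j)) (low m).
under eq_bigr do rewrite inord_val.
by move=> ->; rewrite /= low_lt; case: (nat_of_ord m) => //; rewrite subr0.
Qed.

Lemma mul_diffmx_max x : (x *m diffmx) 0 ord_max = x 0 ord_max.
Proof.
rewrite mxE; have := sum_diffmx (fun j => x 0 (inord j)) ord_max.
under eq_bigr do rewrite inord_val.
move=> ->; rewrite /= ltnn -[X in inord X]/(nat_of_ord (@ord_max l)) inord_val.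
by rewrite [X in _ - X](_ : _ = 0) ?subr0 //; case: (l).
Qed.

(** The numbers min(m, n) are the scalar products of the partial sums of an
orthonormal family; the differences of the partial sums are that family. *)
Lemma gramC_diagonal : diffmx^T *m gramC R l k *m diffmx = diag_mx flat_form.
Proof.
pose g (a b : nat) : C := if (a < l)%N && (b < l)%N
  then (minn a b).+1%:R / (4 * piC R ^+ 2)
  else if (a == l) && (b == l) then - (4 * piC R ^+ 2 * k%:R)^-1 else 0.
pose g1 (a b : nat) : C := g a b - (if a is a'.+1 then
  if (a < l)%N then g a' b else 0 else 0).
have e1 i b : (diffmx^T *m gramC R l k) i b = g1 i b.
  rewrite mxE; apply: etrans (sum_diffmx (g^~ b) i).
  by apply: eq_bigr => a _; rewrite [_^T i a]mxE mulrC; congr (_ * _); rewrite mxE.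
have g1E (a b : nat) : (a <= l)%N -> (b <= l)%N -> g1 a b =
    if (a < l)%N && (b < l)%N then (a <= b)%N%:R / (4 * piC R ^+ 2)
    else if (a == l) && (b == l) then - (4 * piC R ^+ 2 * k%:R)^-1 else 0.
  move=> al bl; rewrite /g1 /g; case: a al => [|a] al.
    by rewrite subr0 min0n leq0n.
  case: (ltnP a.+1 l) => [al'|la]; last by rewrite subr0.
  rewrite (ltnW al') /=; case: (ltnP b l) => [bl'|lb]; last first.
    by rewrite (ltn_eqF al') (ltn_eqF (ltnW al')) subr0.
  rewrite -mulrBl; congr (_ / _).
  case: (ltnP a b) => [ab|ba].
    by rewrite (minn_idPl ab) mulrSr addrC addKr.
  by rewrite (minn_idPr (leq_trans ba (leqnSn _))) subrr.
apply/matrixP => i j; rewrite mxE.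
under eq_bigr do rewrite e1.
rewrite (sum_diffmx (g1 i)) [RHS]mxE [flat_form _ _]mxE -val_eqE /=.
have il : (i <= l)%N by rewrite -ltnS.
have jl : (j <= l)%N by rewrite -ltnS.
rewrite g1E //; case: (nat_of_ord j) jl => [|j'] jl.
  rewrite subr0 leqn0; case: ltnP => [il'|li] /=.
    case: ltnP => [l0|]; last by rewrite leqNgt (leq_ltn_trans _ il').
    by case: (_ == _); rewrite ?mul1r ?mul0r ?mulr1n ?mulr0n.
  have -> : nat_of_ord i = l by apply/eqP; rewrite eqn_leq il.
  by rewrite eqxx [0%N == l]eq_sym; case: (_ == _).
case: (ltnP j'.+1 l) => [jl'|lj]; last first.
  rewrite subr0 andbF; have -> : j'.+1 = l by apply/eqP; rewrite eqn_leq jl.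
  rewrite eqxx andbT; case: eqP => [->|_]; last by rewrite mulr0n.
  by rewrite ltnn mulr1n.
rewrite g1E //; last exact: ltnW.
rewrite (ltnW jl') (ltn_eqF jl') (ltn_eqF (ltnW jl')) !andbT !andbF.
case: ltnP => [il'|li]; last first.
  by rewrite gtn_eqF ?(leq_trans jl') // subrr mulr0n.
rewrite -mulrBl; case: ltngtP => [ij|ji|->].
- by rewrite -ltnS ij subrr mul0r mulr0n.
- by rewrite leqNgt (ltn_trans _ ji) // subrr mul0r mulr0n.
- by rewrite ltnn subr0 mul1r mulr1n.
Qed.

Lemma diffmx_row m x : waves (x *m diffmx) 0 (low m)
  = expC ('i * (piC R * (xc x m.+1 - xc x m)))
    + expC (- ('i * (piC R * (xc x m.+1 - xc x m)))).
Proof. by rewrite mxE /wave low_lt mul_diffmx. Qed.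

Lemma waves_max x : waves (x *m diffmx) 0 ord_max = 2 * piC R * 'i * x 0 ord_max.
Proof. by rewrite mxE /wave /= ltnn mul_diffmx_max. Qed.

Lemma xc_max x : xc x l.+1 = x 0 ord_max.
Proof. by rewrite /= -[X in inord X]/(nat_of_ord (@ord_max l)) inord_val. Qed.

Lemma xc_low x m : xc x m.+1 = x 0 (low m).
Proof. by rewrite /= inord_low. Qed.

Lemma yC_waves x : yC k x = hC k (waves (x *m diffmx)).
Proof.
apply/rowP => i; have [m ->|->] := indexP i; last first.
  by rewrite hC_max waves_max mxE (ltnn l) xc_max.
rewrite hC_low waves_max mxE low_lt xc_max; congr (_ * _).
  rewrite -[(minn _ _)%:R]/(@deg R k m); congr expC.
  by rewrite mulrCA mulrA [2 * _ * _ * _]mulrC.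
apply: elem_sym_eq => m'; rewrite /sqz diffmx_row /zetaC.
set s := 'i * _; have -> : 2 * piC R * 'i * (xc x m'.+1 - xc x m') = s + s.
  by rewrite /s; ring.
rewrite opprD !expCD; have := expCN_mul s.
move: (expC s) (expC (- s)) => a b ab.
have -> : (a + b) ^+ 2 = a * a + b * b + 2 * (a * b) by ring.
by rewrite ab mulr1.
Qed.

(** The linear map x_l |-> 2 x_l, and x_(l+1) |-> x_(l+1) / 2 if k = l, which
identifies the flat coordinates of type B with those of type C. *)
Definition scale_row : P := \row_i if i == top then 2 else slope i 0.

Definition scalemx : 'M[C]_l.+1 := diag_mx scale_row.

Lemma scale_top : scale_row 0 top = 2.
Proof. by rewrite mxE eqxx. Qed.

Lemma scale_low m : low m != top -> scale_row 0 (low m) = 1.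
Proof.
move=> mt; rewrite mxE (negPf mt) /slope.
have := eq_top hk (low m); rewrite (negPf mt) /= => ml.
by rewrite ltn_neqAle ml low_lt.
Qed.

Lemma scaleE m : scale_row 0 (low m) = 1 + (m.+1 == l)%:R.
Proof.
rewrite -lowE (eq_top hk); have [->|mt] := eqVneq (low m) top.
  by rewrite scale_top.
by rewrite scale_low // addr0.
Qed.

Lemma max_neq_top : ord_max != top.
Proof. by rewrite -val_eqE /= gtn_eqF // (top_lt hk). Qed.

Lemma scale_max : scale_row 0 ord_max = if (k < l)%N then 1 else 2^-1.
Proof.
rewrite mxE (negPf max_neq_top) /slope /= ltnNge leqnSn /=.
by rewrite gtn_eqF.
Qed.

Lemma mul_scalemx x i : (x *m scalemx) 0 i = x 0 i * scale_row 0 i.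
Proof. by rewrite mul_mx_diag mxE. Qed.

Lemma xc_scale x m : xc (x *m scalemx) m.+1 - xc (x *m scalemx) m
  = if low m == top then 2 * xc x m.+1 - xc x m else xc x m.+1 - xc x m.
Proof.
have xc_lt (m' : 'I_l) : (m'.+1 < l)%N ->
    xc (x *m scalemx) m'.+1 = xc x m'.+1.
  move=> ml; rewrite !xc_low mul_scalemx scale_low ?mulr1 //.
  by rewrite -(eq_top hk) /= ltn_eqF.
have -> : xc (x *m scalemx) m = xc x m.
  case: m => -[|m] //= ml.
  exact: (xc_lt (Ordinal (ltnW ml))).
case: ifPn => mt; last first.
  have ml : (m.+1 < l)%N by rewrite ltn_neqAle ltn_ord andbT (eq_top hk (low m)).
  by rewrite (xc_lt m ml).
by rewrite !xc_low mul_scalemx (eqP mt) scale_top mulrC.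
Qed.

Lemma waves_scale_max x : waves (x *m scalemx *m diffmx) 0 ord_max
  = 2 * piC R * 'i * (x 0 ord_max * scale_row 0 ord_max).
Proof. by rewrite waves_max mul_scalemx. Qed.

Lemma waves_scale_low x m :
  waves (x *m scalemx *m diffmx) 0 (low m) = zetaB_half x m.
Proof.
rewrite diffmx_row xc_scale /zetaB_half /cosC -(eq_top hk).
have two (s : C) : s = 2 * (s / 2) by field.
rewrite -[nat_of_ord (low m)]/(nat_of_ord m).
case: (ltnP m.+1 l) => ml; first by rewrite (ltn_eqF ml); exact: two.
by rewrite eqn_leq ltn_ord ml; exact: two.
Qed.

Lemma dB_scale m : low m != top ->
  dB R l k m.+1 = @deg R k m * scale_row 0 ord_max.
Proof.
move=> mt; have ml : (m.+1 < l)%N.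
  by rewrite ltn_neqAle ltn_ord andbT (eq_top hk (low m)).
rewrite /dB scale_max ml /deg; case: ltnP => kl; first by rewrite mulr1.
by rewrite (minn_idPl _) // (leq_trans _ kl).
Qed.

Lemma dB_top : dB R l k l = k%:R / 2 * scale_row 0 ord_max.
Proof.
rewrite /dB scale_max ltnn; case: ltnP => kl; first by rewrite mulr1.
have -> : k = l by apply/eqP; rewrite eqn_leq kl; case/andP: hk => _ ->.
by field.
Qed.

Lemma yB_waves x : yB k x = hB k (waves (x *m (scalemx *m diffmx))).
Proof.
rewrite mulmxA; apply/rowP => i.
have [m ->|->] := indexP i; last first.
  rewrite hB_other ?max_neq_top // hC_max waves_scale_max mxE (ltnn l) xc_max.
  have : slope ord_max 0 != 0 := slope_neq0 hk 0 max_neq_top; rewrite [scale_row _ _]mxE (negPf max_neq_top).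
  move: (slope _ _) => s s0; by field.
have [mt|mt] := eqVneq (low m) top.
  rewrite mt hB_top waves_scale_max mxE (top_lt hk) xc_max -mt /yB_inv.
  have ml : m.+1 = l.
    by rewrite -[nat_of_ord m]/(nat_of_ord (low m)) mt (succ_top hk).
  rewrite /= ml ltnn dB_top; congr (_ * _).
    by congr expC; ring.
  by apply: eq_bigr => m' _; rewrite waves_scale_low.
rewrite hB_other // hC_low waves_scale_max mxE low_lt xc_max.
have := @scale_low m mt; rewrite mxE (negPf mt) => ->.
rewrite invr1 mul1r /yB_inv dB_scale //.
have ml : (m.+1 < l)%N.
  by rewrite ltn_neqAle ltn_ord andbT (eq_top hk (low m)).
rewrite /= ml; congr (_ * _); first by congr expC; ring.
by apply: elem_sym_eq => m'; rewrite /sqz /zetaB waves_scale_low.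
Qed.

Lemma succ_max_eq (a b : nat) : (a < l)%N -> (b < l)%N ->
  ((maxn a b).+1 == l) = (a.+1 == l) || (b.+1 == l).
Proof.
move=> al bl; case: leqP => [ab|/ltnW ba].
  by case: (a.+1 =P l) => //= e; rewrite eqn_leq bl -e ltnS ab.
by case: (b.+1 =P l) => /= [e|]; rewrite ?orbF // orbT eqn_leq al -e ltnS ba.
Qed.

Lemma succ_min_eq (a b : nat) : (a < l)%N -> (b < l)%N ->
  ((minn a b).+1 == l) = (a.+1 == l) && (b.+1 == l).
Proof.
move=> al bl; case: leqP => [ab|/ltnW ba].
  by case: (a.+1 =P l) => //= e; rewrite eqn_leq bl -e ltnS ab.
by case: (b.+1 =P l) => /= [e|]; rewrite ?andbF // andbT eqn_leq al -e ltnS ba.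
Qed.

Lemma gramB_scaled : scalemx^T *m gramB R l k *m scalemx = gramC R l k.
Proof.
rewrite tr_diag_mx; apply/matrixP => i j.
rewrite mul_mx_diag mxE mul_diag_mx mxE.
have [m ->|->] := indexP i; have [m' ->|->] := indexP j.
- rewrite !scaleE [gramB _ _ _ _ _]mxE [gramC _ _ _ _ _]mxE !low_lt !lowE.
  rewrite /= succ_max_eq ?ltn_ord //.
  have mE : ((minn m m').+1 == l) = (m.+1 == l) && (m'.+1 == l).
    by rewrite succ_min_eq ?ltn_ord.
  have p0 := pi_neq0; rewrite mE; move: mE; case: (m.+1 == l); case: (m'.+1 == l) => //= mE.
  + rewrite (eqP mE); move: (piC R) p0 (l%:R) => p p0 q; by field.
  + move: (piC R) p0 ((minn m m').+1%:R) => p p0 q; by field.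
  + move: (piC R) p0 ((minn m m').+1%:R) => p p0 q; by field.
  + move: (piC R) p0 ((minn m m').+1%:R) => p p0 q; by field.
- rewrite [gramB _ _ _ _ _]mxE [gramC _ _ _ _ _]mxE /= ltnn andbF.
  by rewrite ltn_eqF //= mulr0 mul0r.
- rewrite [gramB _ _ _ _ _]mxE [gramC _ _ _ _ _]mxE /= ltnn /=.
  by rewrite [X in _ && X]ltn_eqF // andbF mulr0 mul0r.
- rewrite [gramB _ _ _ _ _]mxE [gramC _ _ _ _ _]mxE /= ltnn !eqxx /=.
  have p0 := pi_neq0; have k0 : k%:R != 0 :> C := k_neq0 hk.
  rewrite scale_max /dB; case: ltnP => kl.
    by rewrite (minn_idPr _) // mul1r mulr1.
  have -> : l = k by apply/eqP; rewrite eqn_leq kl; case/andP: hk => _ ->.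
  move: (piC R) p0 (k%:R) k0 => p p0 q q0; by field; rewrite q0 p0.
Qed.

Lemma yC_metric : metric_in_coordinates (@yC R l k) (gramC R l k) (@GC R l k).
Proof.
move=> x; rewrite yC_waves -components_hC.
rewrite (_ : @yC R l k = fun z => hC k (waves (z *m diffmx))); last first.
  by rewrite funeqE => z; exact: yC_waves.
by rewrite (components_through _ gramC_diagonal (@differentiable_hC R l k)).
Qed.

Lemma gramB_diagonal :
  (scalemx *m diffmx)^T *m gramB R l k *m (scalemx *m diffmx) = diag_mx flat_form.
Proof. by rewrite trmx_mul -gramC_diagonal -gramB_scaled !mulmxA. Qed.

Lemma yB_metric : metric_in_coordinates (@yB R l k) (gramB R l k) (@GB R l k).
Proof.
move=> x; rewrite yB_waves -(components_hB hk).
rewrite (_ : @yB R l k = fun z => hB k (waves (z *m (scalemx *m diffmx)))); last first.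
  by rewrite funeqE => z; exact: yB_waves.
by rewrite (components_through _ gramB_diagonal (@differentiable_hB R l k)).
Qed.

(** In the diagonalising coordinates ybar o yB and yC are the same map. *)
Lemma ybar_yB_metric x :
  components (fun z => ybar k (yB k z)) (gramB R l k) x = GC k (ybar k (yB k x)).
Proof.
rewrite yB_waves ybar_hB // -components_hC.
rewrite (_ : (fun z => _) = fun z => hC k (waves (z *m (scalemx *m diffmx)))).
  by rewrite (components_through _ gramB_diagonal (@differentiable_hC R l k)).
by rewrite funeqE => z; rewrite yB_waves ybar_hB.
Qed.

End FlatCoordinates.

(** * The map ybar as a coordinate change *)

Section YbarChart.
Context {R : realType} (l k : nat) (hk : (1 <= k <= l)%N).
Local Notation C := (cplx R).
Local Notation P := 'rV[C]_l.+1.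
Local Notation top := (top l).
Local Notation slope := (@slope R l k).
Local Notation smooth := (@smooth R l.+1 top ord_max).
Implicit Types (y z u v : P) (i j : 'I_l.+1).

Definition jac y : 'M[C]_l.+1 := diag_mx (\row_i slope i (y 0 i)).

(** The inverse of jac on the locus, in a form with visibly smooth entries. *)
Definition jacV y : 'M[C]_l.+1 := diag_mx (\row_i (slope i (y 0 i))^-1).

Lemma jacE y i j : jac y i j = slope i (y 0 i) *+ (i == j).
Proof. by rewrite !mxE; case: eqP => [->|]. Qed.

Lemma jacVE y i j : jacV y i j = (slope i (y 0 i))^-1 *+ (i == j).
Proof. by rewrite !mxE; case: eqP => [->|]. Qed.

Let slope0 i : i != top -> slope i 0 != 0.
Proof. exact: (slope_neq0 hk 0). Qed.

Lemma locus_slope y i : locus R l y -> slope i (y 0 i) != 0.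
Proof.
move=> yL; have [->|it] := eqVneq i top; last exact: (slope_neq0 hk (y 0 i) it).
by rewrite (slope_top hk) mulf_neq0 ?pnatr_eq0.
Qed.

Lemma jac_jacV y : locus R l y -> jac y *m jacV y = 1%:M.
Proof.
move=> yL; rewrite mulmx_diag -diag_const_mx; congr diag_mx.
by apply/rowP => i; rewrite !mxE divff // locus_slope.
Qed.

Lemma jac_unit y : locus R l y -> jac y \in unitmx.
Proof. by move=> yL; case: (mulmx1_unit (jac_jacV yL)). Qed.

Lemma invmx_jac y : locus R l y -> invmx (jac y) = jacV y.
Proof.
move=> yL; apply: (can_inj (mulKmx (jac_unit yL))).
by rewrite mulmxV ?jac_unit // jac_jacV.
Qed.

Definition bar i (t : C) : C := if i == top then t ^+ 2 else slope i 0 * t.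

Lemma ybarE : ybar k = (fun y : P => \row_i bar i (y 0 i)).
Proof.
rewrite funeqE => y; apply/rowP => i; rewrite [RHS]mxE /bar.
have [->|it] := eqVneq i top; first exact: ybar_top.
exact: ybar_other.
Qed.

Lemma bar_differential i t : differentiable (bar i) t /\
  forall r, 'D_r (bar i) t = slope i t * r.
Proof.
have [->|it] := eqVneq i top; last first.
  rewrite (slope_other hk t it) /bar (negPf it); exact: scale_differential.
have did : differentiable (id : C -> C) t by exact: ex_diff.
rewrite (slope_top hk) /bar eqxx (_ : (fun s : C => s ^+ 2) = fun s : C => s * s).
  split=> [|r]; first exact: (differentiableM did did).
  by rewrite (product_rule r did did) derive_id; ring.
by rewrite funeqE => s; rewrite expr2.
Qed.

Lemma ybar_differential y : differentiable (ybar k) y /\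
  forall v, 'D_v (ybar k) y = v *m jac y.
Proof.
rewrite ybarE; apply: (coordinatewise_differential (f := bar)).
by move=> i; exact: bar_differential.
Qed.

Lemma components_ybar (M : 'M[C]_l.+1) y :
  components (ybar k) M y = (jac y)^T *m M *m jac y.
Proof.
have [d e] := ybar_differential y.
by rewrite components_jacobian // (jacobian_row d e).
Qed.

Lemma GB_GC y : (jac y)^T *m GB k y *m jac y = GC k (ybar k y).
Proof.
rewrite tr_diag_mx; apply/matrixP => i j.
rewrite mul_mx_diag mxE mul_diag_mx mxE ![(\row_ _ _) _ _]mxE [GB k y i j]mxE.
have [->|it] := eqVneq i top; have [->|jt] := eqVneq j top.
- by rewrite GC_top // ybar_top // !(slope_top hk); field.
- rewrite GC_top // ybar_top // !(slope_top hk) !(slope_other hk _ jt).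
  have := slope0 jt; move: (slope _ _) (lastrow _ _ _) => s e s0.
  by field.
- rewrite GC_sym GC_top // ybar_top // !(slope_top hk) !(slope_other hk _ it).
  have := slope0 it; move: (slope _ _) (lastrow _ _ _) => s e s0.
  by field.
- rewrite (slope_other hk _ it) (slope_other hk _ jt).
  have := slope0 it; have := slope0 jt.
  move: (slope _ _) (slope _ _) (GC _ _ _ _) => s s' e s0 s0'; by field; rewrite s0.
Qed.

(** Only y^l is changed non-linearly, and quadratically: the second differential
of ybar is constant. *)
Lemma ybar_coordinate_change (U : set P) : open U -> U `<=` locus R l ->
  coordinate_change U (ybar k) (fun y u => u *m jac y)
    (fun _ u v => u *m diag_mx (\row_i if i == top then 2 * v 0 i else 0)).
Proof.
move=> oU UL.
have vJ v y : differentiable (fun z => v *m jac z) y /\ forall u,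
    'D_u (fun z => v *m jac z) y
    = u *m diag_mx (\row_i if i == top then 2 * v 0 i else 0).
  rewrite (_ : (fun z => _) = fun z : P => \row_i (v 0 i * slope i (z 0 i))); last first.
    by rewrite funeqE => z; apply/rowP => i; rewrite mul_mx_diag !mxE.
  apply: (coordinatewise_differential (f := fun i t => v 0 i * slope i t)) => i.
  have [->|it] := eqVneq i top; last first.
    rewrite (_ : (fun t => _) = cst (v 0 i * slope i 0)).
      by split=> [|t]; [exact: differentiable_cst|rewrite derive_cst mul0r].
    by rewrite funeqE => t; rewrite (slope_other hk).
  rewrite (_ : (fun t => _) = fun t => 2 * v 0 top * t).
    exact: scale_differential.
  by rewrite funeqE => t; rewrite (slope_top hk); ring.
split.
- exact: oU.
- move=> y _; exact: (ybar_differential y).1.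
- move=> y u _; exact: (ybar_differential y).2.
- move=> v y _; exact: (vJ v y).1.
- move=> u v y _; exact: (vJ v y).2.
- move=> u v y _; exact: differentiable_cst.
- move=> u v y _; apply/rowP => i; rewrite !mul_mx_diag !mxE.
  by case: ifP => _; rewrite ?mulr0 // mulrCA [v 0 i * _]mulrC mulrA mulrC.
- move=> w u v y _; exact: etrans (derive_cst _ _ _) (esym (derive_cst _ _ _)).
- move=> y Uy; have [d e] := ybar_differential y.
  rewrite (jacobian_row d e); exact: jac_unit (UL _ Uy).
Qed.

Lemma smooth_if (b : bool) (f g : P -> C) : smooth f -> smooth g ->
  smooth (fun y => if b then f y else g y).
Proof. by case: b. Qed.

Lemma smooth_slope i : smooth (fun y => slope i (y 0 i)).
Proof.
have [->|it] := eqVneq i top.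
  apply: smooth_ext (smoothM (smooth_cst _ _ 2) (smooth_coord _ _ top)) => y.
  by rewrite (slope_top hk).
apply: smooth_ext (smooth_cst _ _ (slope i 0)) => y.
by rewrite (slope_other hk).
Qed.

Lemma smooth_slopeV i : smooth (fun y => (slope i (y 0 i))^-1).
Proof.
have [->|it] := eqVneq i top.
  apply: smooth_ext (smoothM (smooth_cst _ _ 2^-1) (smooth_inv _ _)) => y.
  by rewrite (slope_top hk) invfM.
apply: smooth_ext (smooth_cst _ _ (slope i 0)^-1) => y.
by rewrite (slope_other hk).
Qed.

Lemma smooth_jac i j : smooth (fun y => jac y i j).
Proof.
apply: smooth_ext (smoothM (smooth_slope i) (smooth_cst _ _ (i == j)%:R)) => y.
by rewrite jacE mulr_natr.
Qed.

Lemma smooth_jacV i j : smooth (fun y => jacV y i j).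
Proof.
apply: smooth_ext (smoothM (smooth_slopeV i) (smooth_cst _ _ (i == j)%:R)) => y.
by rewrite jacVE mulr_natr.
Qed.

Lemma smooth_ybar_coord i : smooth (fun y => ybar k y 0 i).
Proof.
have [->|it] := eqVneq i top.
  apply: smooth_ext (smoothM (smooth_coord _ _ top) (smooth_coord _ _ top)) => y.
  by rewrite ybar_top // expr2.
apply: smooth_ext (smoothM (smooth_cst _ _ (slope i 0)) (smooth_coord _ _ i)) => y.
by rewrite ybar_other.
Qed.

(** The algebra of smooth functions is stable under composition with ybar, since
ybar squares y^l and is linear in the other coordinates. *)
Lemma smooth_ybar (f : P -> C) : smooth f -> smooth (fun y => f (ybar k y)).
Proof.
elim=> {f} [c|i||c|f g _ sf _ sg|f g _ sf _ sg].
- exact: smooth_cst.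
- exact: smooth_ybar_coord.
- apply: smooth_ext (smoothM (smooth_inv _ _) (smooth_inv _ _)) => y.
  by rewrite ybar_top // expr2 invfM.
- apply: smooth_ext (smooth_exp _ _ (c * slope ord_max 0)) => y.
  by rewrite ybar_other ?mulrA // (max_neq_top hk).
- exact: (smoothD sf sg).
- exact: (smoothM sf sg).
Qed.

Lemma smooth_mulmx (a b c : nat) (M : P -> 'M[C]_(a, b)) (N : P -> 'M[C]_(b, c)) :
  (forall (i : 'I_a) (j : 'I_b), smooth (fun y => M y i j)) ->
  (forall (i : 'I_b) (j : 'I_c), smooth (fun y => N y i j)) ->
  forall (i : 'I_a) (j : 'I_c), smooth (fun y => (M y *m N y) i j).
Proof.
move=> sM sN i j; apply: (@smooth_ext _ _ _ _ (fun y => \sum_s M y i s * N y s j)).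
  by move=> y; rewrite mxE.
by apply: smooth_sum => s _; apply: smoothM.
Qed.

Lemma smooth_sig (j : nat) : smooth (fun y => sig k y j).
Proof.
case: j => [|j] /=; first exact: smooth_cst.
apply: smooth_if; last exact: smooth_cst.
by apply: smoothM; [exact: smooth_exp|exact: smooth_coord].
Qed.

Lemma smooth_newton p q : smooth (fun y => newton (sig k y) p q).
Proof.
elim: p q => [|p ih] q.
  exact: (smoothM (smooth_cst _ _ q.+1%:R) (smooth_sig q.+1)).
apply: (@smooth_ext _ _ _ _ (fun y => newton (sig k y) p q.+1
    + (-1) * ((p%:R - q%:R) * sig k y p.+1 * sig k y q.+1))).
  by move=> y; rewrite mulN1r.
apply: smoothD => //; apply: smoothM; first exact: smooth_cst.
apply: smoothM; last exact: smooth_sig.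
by apply: smoothM; [exact: smooth_cst|exact: smooth_sig].
Qed.

Lemma smooth_eul i : smooth (fun y => eul k y i).
Proof.
apply: smooth_if; last exact: smooth_cst.
by apply: smoothM; [exact: smooth_cst|exact: smooth_coord].
Qed.

Lemma smooth_GC i j : smooth (fun y => GC k y i j).
Proof.
apply: (@smooth_ext _ _ _ _ (fun y => k%:R^-1 * eul k y i * eul k y j +
   if ((i < l) && (j < l))%N
   then expC ((@deg R k i + @deg R k j) * y 0 ord_max)
        * quad (sig k y) (minn i j) (maxn i j)
   else 0)); first by move=> y; rewrite mxE.
apply: smoothD.
  apply: smoothM; last exact: smooth_eul.
  by apply: smoothM; [exact: smooth_cst|exact: smooth_eul].
apply: smooth_if; last exact: smooth_cst.
apply: smoothM; first exact: smooth_exp.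
move: (minn i j) (maxn i j) => p q.
apply: (@smooth_ext _ _ _ _ (fun y => 4 * newton (sig k y) p q
    + (- q.+1%:R) * sig k y p.+1 * sig k y q.+1 + newton (sig k y) p.+1 q)).
  by move=> y; rewrite /quad !mulNr.
apply: smoothD; last exact: smooth_newton.
apply: smoothD.
  by apply: smoothM; [exact: smooth_cst|exact: smooth_newton].
apply: smoothM; last exact: smooth_sig.
by apply: smoothM; [exact: smooth_cst|exact: smooth_sig].
Qed.

Lemma locus_ybar y : locus R l (ybar k y) <-> locus R l y.
Proof.
rewrite /locus /= -[inord l.-1]/top ybar_top // expf_eq0 /=.
by [].
Qed.

Definition dGC y : 'M[C]_l.+1 :=
  \matrix_(i, j) partial (inord k.-1) (fun z => GC k z i j) y.

Lemma smooth_dGC : exists2 N : P -> 'M[C]_l.+1,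
  (forall i j, smooth (fun y => N y i j)) &
  forall y, locus R l y -> dGC y = N y.
Proof.
have [N sN eN] := smooth_mx_derive (ek R l k) smooth_GC.
exists N => // y yL; rewrite -(eN y yL); apply/matrixP => i j.
rewrite mxE derive_entry //; exact: (smooth_mx_differentiable smooth_GC yL).
Qed.

Definition eulerC y : P := k%:R^-1 *:
  (\sum_(j < l.+1 | (j < l)%N) ((minn j.+1 k)%:R * y 0 j) *: delta_mx 0 j
   + delta_mx 0 ord_max).

Lemma eulerCE y i : eulerC y 0 i = k%:R^-1 * eul k y i.
Proof.
rewrite !mxE summxE eqxx /=; congr (_ * _); rewrite /eul.
have [il|li] := ltnP i l.
  rewrite (bigD1 i) //= !mxE !eqxx mulr1 -val_eqE /= (ltn_eqF il) addr0.
  rewrite big1 ?addr0 // => j /andP[_ ji].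
  by rewrite !mxE eqxx eq_sym (negPf ji) mulr0.
have -> : (i == ord_max) by rewrite -val_eqE /= eqn_leq li -ltnS ltn_ord.
rewrite big1 ?add0r // => j jl; rewrite !mxE eqxx -val_eqE /=.
by rewrite gtn_eqF ?mulr0 // (leq_trans jl).
Qed.

Lemma smooth_eulerC i : smooth (fun y => eulerC y 0 i).
Proof.
apply: smooth_ext (smoothM (smooth_cst _ _ k%:R^-1) (smooth_eul i)) => y.
by rewrite eulerCE.
Qed.

Lemma GC_max y i : GC k y ord_max i = k%:R^-1 * eul k y i.
Proof. by rewrite mxE {1}/eul /= ltnn mulr1 addr0. Qed.

Lemma delta_GC y : delta_mx 0 ord_max *m GC k y = eulerC y.
Proof. by apply/rowP => i; rewrite -rowE mxE GC_max eulerCE. Qed.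

(** The component g^(l+1, j) of the intersection form is the j-th component of
the Euler field, whose derivative along y^k is d/dy^k. *)
Lemma delta_dGC y : delta_mx 0 ord_max *m dGC y = ek R l k.
Proof.
apply/rowP => i; rewrite -rowE !mxE eqxx /=.
have -> : (fun z => GC k z ord_max i) = fun z => k%:R^-1 * eul k z i.
  by rewrite funeqE => z; rewrite GC_max.
have k0 : k%:R != 0 :> C := k_neq0 hk.
have kl : (k.-1 < l)%N by case/andP: hk => k1; rewrite -{1}(prednK k1).
have kE : (inord k.-1 : 'I_l.+1) = k.-1 :> nat by rewrite inordK // ltnW.
rewrite /eul; case il: (i < l)%N; last first.
  rewrite /partial derive_cst; case: eqP => // ik; move: il.
  by rewrite ik kE kl.
rewrite (_ : (fun z => _) = fun z : P => k%:R^-1 * @deg R k i * z 0 i); last first.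
  by rewrite funeqE => z; rewrite mulrA.
rewrite /partial product_rule; [|exact: differentiable_cst|exact: differentiable_coord].
rewrite derive_cst mul0r add0r -/(partial _ _ _) partial_coord.
rewrite eq_sym; case: eqP => [->|_]; last by rewrite mulr0.
rewrite mulr1 /deg kE prednK; last by case/andP: hk.
by rewrite minnn mulVf.
Qed.

End YbarChart.

(** * Local inverses of ybar *)

Section LocalInverse.
Context {R : realType}.
Local Notation C := (cplx R).
Implicit Types s t w : C.

(** The square root of w nearest to s: an inverse of squaring near s != 0. *)
Definition root s w : C :=
  let r := sqrtC w in if `|r - s| <= `|r + s| then r else - r.

Lemma root_sqr s w : root s w ^+ 2 = w.
Proof. by rewrite /root; case: ifP => _; rewrite ?sqrrN sqrtCK. Qed.

Lemma root_near s w : `|root s w - s| <= `|root s w + s|.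
Proof.
rewrite /root; case: ifPn => // h.
have -> : - sqrtC w - s = - (sqrtC w + s) by rewrite opprD.
have -> : - sqrtC w + s = - (sqrtC w - s) by rewrite opprB addrC.
by rewrite !normrN; case: (real_leP (normr_real _) (normr_real _)) h => // /ltW.
Qed.

Lemma two_norm s t : 2 * `|s| <= `|t + s| + `|t - s|.
Proof.
have -> : 2 * `|s| = `|(t + s) - (t - s)|.
  by rewrite (_ : _ - _ = 2 * s) ?normrM ?normr_nat //; ring.
exact: ler_normB.
Qed.

Lemma root_far s w : `|s| <= `|root s w + s|.
Proof.
rewrite -(ler_pM2l (_ : 0 < 2)) ?ltr0n //; apply: le_trans (two_norm _ (root s w)) _.
by rewrite mulr_natl mulr2n lerD // root_near.
Qed.

Lemma rootK s t : `|t - s| < `|s| -> root s (t ^+ 2) = t.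
Proof.
move=> ts; have /eqP := root_sqr s (t ^+ 2).
rewrite eqf_sqr => /orP[/eqP//|/eqP e]; exfalso.
have := root_near s (t ^+ 2); rewrite e.
have -> : - t - s = - (t + s) by rewrite opprD.
have -> : - t + s = - (t - s) by rewrite opprB addrC.
rewrite !normrN => h.
have := le_lt_trans (le_trans (two_norm s t) (lerD h (lexx _))) (ltrD ts ts).
by rewrite mulr_natl mulr2n ltxx.
Qed.

Lemma root_differentiable s : s != 0 -> differentiable (root s) (s ^+ 2).
Proof.
move=> s0; have ns : 0 < `|s| by rewrite normr_gt0.
suff gf (e : C) : 0 < e -> \forall h \near 0,
    `|root s (h + s ^+ 2) - root s (s ^+ 2) - (2 * s)^-1 *: h| <= e * `|h|.
  exact: (@first_order_differential C C C (root s) _ ( *:%R (2 * s)^-1)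
    (@scaler_continuous _ _ _) gf).1.
move=> e0; have d0 : 0 < 2 * e * `|s| ^+ 3 by rewrite !mulr_gt0 ?exprn_gt0.
near=> h.
have hd : `|h| <= 2 * e * `|s| ^+ 3.
  by near: h; exact: (@nbhs0_le _ C^o _ d0).
rewrite rootK ?subrr ?normr0 //.
have := root_sqr s (h + s ^+ 2); have := root_far s (h + s ^+ 2).
move: (root _ _) => r rs rh.
(* The linear approximation is exact up to the square of r - s, and
   |r - s| <= |h| / |s|. *)
have -> : r - s - (2 * s)^-1 *: h = - (r - s) ^+ 2 / (2 * s).
  have -> : h = r ^+ 2 - s ^+ 2 by rewrite rh addrK.
  by rewrite [_ *: _]mulrC; field.
have hE : `|h| = `|r - s| * `|r + s|.
  by rewrite -normrM; congr (`| _ |); rewrite -subr_sqr rh addrK.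
have rsh : `|r - s| <= `|h| / `|s|.
  by rewrite ler_pdivlMr // hE ler_wpM2l.
rewrite normrM normrN normrX normfV normrM normr_nat.
apply: (@le_trans _ _ ((`|h| / `|s|) ^+ 2 / (2 * `|s|))).
  by rewrite ler_pM2r ?invr_gt0 ?mulr_gt0 // lerXn2r ?nnegrE // divr_ge0.
have alg (a b : C) : b != 0 -> (a / b) ^+ 2 / (2 * b) = a / (2 * b ^+ 3) * a.
  by move=> b0; field.
rewrite alg ?gt_eqF //.
by rewrite ler_wpM2r // ler_pdivrMr ?mulr_gt0 ?exprn_gt0 // mulrA [e * 2]mulrC.
Unshelve. all: by end_near. Qed.

Section Chart.
Variables (l k : nat).
Hypothesis hk : (1 <= k <= l)%N.
Local Notation P := 'rV[C]_l.+1.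
Local Notation top := (top l).
Local Notation slope := (@slope R l k).
Implicit Types (y z : P) (i : 'I_l.+1) (U V : set P).

(** A section of ybar, the inverse of ybar near y0. *)
Definition chart (y0 : P) (z : P) : P :=
  \row_i if i == top then root (y0 0 top) (z 0 i) else (slope i 0)^-1 * z 0 i.

Lemma ybar_chart y0 z : ybar k (chart y0 z) = z.
Proof.
apply/rowP => i; have [->|it] := eqVneq i top.
  by rewrite ybar_top // mxE eqxx root_sqr.
rewrite ybar_other // mxE (negPf it) mulVKf //; exact: (slope_neq0 hk 0 it).
Qed.

Lemma chartK y0 y : `|y 0 top - y0 0 top| < `|y0 0 top| ->
  chart y0 (ybar k y) = y.
Proof.
move=> yy0; apply/rowP => i; rewrite mxE; have [->|it] := eqVneq i top.
  by rewrite ybar_top // rootK.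
rewrite ybar_other // mulKf //; exact: (slope_neq0 hk 0 it).
Qed.

Lemma chart_ybar y0 : locus R l y0 -> chart y0 (ybar k y0) = y0.
Proof. by move=> yL; apply: chartK; rewrite subrr normr0 normr_gt0. Qed.

Lemma chart_differentiable y0 : locus R l y0 ->
  differentiable (chart y0) (ybar k y0).
Proof.
move=> yL; apply: differentiable_mx => i0 i; rewrite ord1.
have dc j : differentiable (fun z : P => z 0 j) (ybar k y0).
  exact: differentiable_coord.
have [->|it] := eqVneq i top.
  rewrite (_ : (fun z => _) = root (y0 0 top) \o fun z : P => z 0 top).
    apply: (differentiable_comp (dc top)).
    rewrite ybar_top //; exact: root_differentiable.
  by rewrite funeqE => z; rewrite /= mxE eqxx.
rewrite (_ : (fun z => _) = fun z : P => (slope i 0)^-1 * z 0 i).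
  by apply: differentiableM; [exact: differentiable_cst|exact: dc].
by rewrite funeqE => z; rewrite mxE (negPf it).
Qed.

Lemma near_chart V y0 : open V -> V `<=` locus R l -> V y0 ->
  \forall z \near ybar k y0, V (chart y0 z).
Proof.
move=> oV VL Vy0.
have : chart y0 z @[z --> ybar k y0] --> chart y0 (ybar k y0).
  exact: differentiable_continuous (chart_differentiable (VL _ Vy0)).
by apply; rewrite chart_ybar; [exact: open_nbhs_nbhs|exact: VL].
Qed.

Lemma open_ybar V : open V -> V `<=` locus R l -> open (ybar k @` V).
Proof.
move=> oV VL; rewrite openE => _ [y0 Vy0 <-].
by apply: filterS (near_chart oV VL Vy0) => z Vz; exists (chart y0 z) => //; exact: ybar_chart.
Qed.

(** The inverse of ybar on V is obtained by choice; near each point it coincides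
with the explicit section, hence is differentiable. *)
Lemma inverse_ybar V : open V -> V `<=` locus R l ->
  {in V &, injective (ybar k)} ->
  exists psi : P -> P, (forall y, V y -> psi (ybar k y) = y) /\
    forall z, (ybar k @` V) z -> differentiable psi z.
Proof.
move=> oV VL inj.
have /choice[psi psiP] z : exists y, (ybar k @` V) z -> V y /\ ybar k y = z.
  have [[y Vy yz]|nz] := pselect ((ybar k @` V) z); first by exists y.
  by exists 0.
have psiK y : V y -> psi (ybar k y) = y.
  move=> Vy; have [Vp ep] := psiP (ybar k y) (imageP _ Vy).
  by apply: inj => //; exact: mem_set.
exists psi; split=> // _ [y0 Vy0 <-].
apply: near_differentiable (chart_differentiable (VL _ Vy0)).
apply: filterS (near_chart oV VL Vy0) => z Vz.
by rewrite -[in RHS](ybar_chart y0 z) psiK.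
Qed.

Lemma near_top y0 : locus R l y0 ->
  nbhs y0 [set y : P | `|y 0 top - y0 0 top| < `|y0 0 top|].
Proof.
move=> y0L; have nz : 0 < `|y0 0 top| by rewrite normr_gt0.
have ct : {for y0, continuous (fun y : P => y 0 top)}.
  exact/differentiable_continuous/differentiable_coord.
have /cvgr_dist_lt/(_ _ nz) cc : y 0 top @[y --> y0] --> (y0 0 top : C^o).
  exact: ct.
have {}cc : nbhs y0 [set y : P | `|y0 0 top - y 0 top| < `|y0 0 top|] by exact: cc.
by apply: filterS cc => y /=; rewrite distrC.
Qed.

Lemma open_locus : open (locus R l).
Proof.
rewrite openE => y0 y0L; rewrite /interior.
apply: filterS (near_top y0L) => y /= yy0.
by apply/eqP => y_0; move: yy0; rewrite y_0 sub0r normrN ltxx.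
Qed.

(** The disc of centre y0^l and radius |y0^l| contains no two opposite points. *)
Lemma locally_injective V y0 : open V -> V `<=` locus R l -> V y0 ->
  exists2 V' : set P, [/\ open V', V' y0 & V' `<=` V] &
    {in V' &, injective (ybar k)}.
Proof.
move=> oV VL Vy0.
pose N := [set y : P | V y /\ `|y 0 top - y0 0 top| < `|y0 0 top|].
exists N^°; last first.
  move=> y y' /set_mem/interior_subset[_ yN] /set_mem/interior_subset[_ yN'] e.
  by rewrite -(chartK yN) e chartK.
split; [exact: open_interior| |by move=> y /interior_subset[]].
have cc := near_top (VL _ Vy0).
rewrite /interior /=.
apply: filterS2 (open_nbhs_nbhs (conj oV Vy0)) cc => y Vy.
by [].
Qed.

Lemma ybar_locus : ybar k @` locus R l = locus R l.
Proof.
apply/seteqP; split=> [_ [y yL <-]|z zL]; first exact/(locus_ybar hk).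
exists (chart 0 z); last exact: ybar_chart.
by apply/(locus_ybar hk); rewrite ybar_chart.
Qed.

End Chart.
End LocalInverse.

(** * Transfer of Frobenius structures *)

Section Transfer.
Context {R : realType} (l k : nat) (hk : (1 <= k <= l)%N).
Local Notation C := (cplx R).
Local Notation P := 'rV[C]_l.+1.
Local Notation locus := (locus R l).
Local Notation jac := (@jac R l k).
Local Notation jacV := (@jacV R l k).
Local Notation smooth := (@smooth R l.+1 (top l) ord_max).
Implicit Types (y z u v e : P) (U V : set P) (F FB FC : frobenius R l.+1).

Lemma congruence_inj (J M N : 'M[C]_l.+1) : J \in unitmx ->
  J^T *m M *m J = J^T *m N *m J -> M = N.
Proof.
move=> uJ /(can_inj (mulmxK uJ)); apply: can_inj; apply: mulKmx.
by rewrite unitmx_tr.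
Qed.

Lemma congruence_inv (J M N : 'M[C]_l.+1) : J \in unitmx ->
  N = J^T *m M *m J -> M = (invmx J)^T *m N *m invmx J.
Proof.
move=> uJ ->; apply: (congruence_inj uJ); rewrite !mulmxA -trmx_mul.
by rewrite mulVmx // trmx1 mul1mx mulmxKV.
Qed.

Lemma differentiable_jac y : locus y -> differentiable jac y.
Proof. exact: smooth_mx_differentiable (smooth_jac hk). Qed.

Lemma differentiable_jacV y : locus y -> differentiable jacV y.
Proof. exact: smooth_mx_differentiable (smooth_jacV hk). Qed.

(** The inverse metric is the derivative of the intersection form along y^k, hence
smooth. *)
Lemma regular_C U F : open U -> U `<=` locus -> tame F U ->
  (forall y, U y -> invmx (fmetric F y) = dGC k y) ->
  (forall y, U y -> feuler F y = eulerC k y) -> regular F U.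
Proof.
move=> oU UL tF gF eF; have [N sN NE] := @smooth_dGC R l k.
apply: (regular_smooth oU UL tF sN (@smooth_eulerC R l k)) => [y Uy|y Uy].
  by rewrite gF // NE //; exact: UL.
by rewrite eF.
Qed.

Lemma regular_B V F : open V -> V `<=` locus -> tame F V ->
  (forall y, V y ->
     invmx (fmetric F y) = (jacV y)^T *m dGC k (ybar k y) *m jacV y) ->
  (forall y, V y -> feuler F y = eulerC k (ybar k y) *m jacV y) -> regular F V.
Proof.
move=> oV VL tF gF eF; have [N sN NE] := @smooth_dGC R l k.
have sJ := @smooth_jacV R l k hk.
have sN' i j : smooth (fun y => N (ybar k y) i j) by exact: (smooth_ybar hk (sN i j)).
have sE (i : 'I_1) j : smooth (fun y => eulerC k (ybar k y) i j).
  by rewrite ord1; exact: (smooth_ybar hk (smooth_eulerC k j)).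
have sNJ := smooth_mulmx (smooth_mulmx sJ sN') sJ.
have sEJ := smooth_mulmx sE sJ 0.
apply: (regular_smooth oV VL tF sNJ sEJ) => [y Vy|y Vy]; last exact: eF.
rewrite gF // tr_diag_mx NE //; apply/(locus_ybar hk); exact: VL.
Qed.

Lemma components_GB z : components (ybar k) (GB k z) z = GC k (ybar k z).
Proof. by rewrite components_ybar // GB_GC. Qed.

(** In the coordinates ybar the form GB is GC, and the field e is d/dy^k. *)
Lemma derive_GC_ybar y e : locus y -> e *m jac y = ek R l k ->
  \matrix_(i, j) 'D_e (fun z => components (ybar k) (GB k z) z i j) y
  = dGC k (ybar k y).
Proof.
move=> yL eJ; apply/matrixP => i j; rewrite [LHS]mxE [RHS]mxE.
have yL' : locus (ybar k y) by apply/(locus_ybar hk).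
have [dy Dy] := ybar_differential hk y.
have dG : differentiable (fun z => GC k z i j) (ybar k y).
  exact: smooth_differentiable (smooth_GC k i j) yL'.
rewrite (_ : (fun z => _) = (fun z => GC k z i j) \o ybar k).
  by rewrite (derive_comp e dy dG) Dy eJ.
by rewrite funeqE => z; rewrite components_GB.
Qed.

Lemma image_locus V : V `<=` locus -> ybar k @` V `<=` locus.
Proof. by move=> VL _ [y Vy <-]; apply/(locus_ybar hk); exact: VL. Qed.

(** The structure FC is pulled back along ybar. *)
Lemma frobenius_B_of_C V FC : open V -> V `<=` locus ->
  frobenius_C k (@GC R l k) (ybar k @` V) FC ->
  exists FB, frobenius_B k (@GB R l k) V FB /\
    frobenius_local_iso V (ybar k) FB FC.
Proof.
move=> oV VL [fC dC].
have dy y : V y -> differentiable (ybar k) y.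
  by move=> _; exact: (ybar_differential hk y).1.
have Dy y u : V y -> 'D_u (ybar k) y = u *m jac y.
  by move=> _; exact: (ybar_differential hk y).2.
have uJ y : V y -> jac y \in unitmx by move=> /VL; exact: jac_unit.
have jV y : V y -> invmx (jac y) = jacV y by move=> /VL; exact: invmx_jac.
pose FB := pullback (ybar k) jac FC.
have tC := is_frobenius_tame fC.
have tB : tame FB V.
  apply: (tame_pullback oV _ dy _ _ uJ tC) => [z Vz|z Vz|z Vz].
  - by exists z.
  - exact: differentiable_jac (VL _ Vz).
  - apply: near_differentiable (differentiable_jacV (VL _ Vz)).
    by apply: filterS (open_nbhs_nbhs (conj oV Vz)) => p /jV.
have iso : frobenius_local_iso V (ybar k) FB FC := pullback_iso dy Dy uJ FC.
have gB y : V y -> dGC k (ybar k y) = (jac y)^T *m invmx (fmetric FB y) *m jac y.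
  move=> Vy; rewrite -(inverse_metric_local_iso Dy uJ tB tC iso Vy).
  by have [_ -> _ _] := dC _ (imageP _ Vy).
have rC : regular FC (ybar k @` V).
  apply: (regular_C (open_ybar hk oV VL) (image_locus VL) tC) => z Uz.
    by have [_ -> _ _] := dC z Uz.
  by have [_ _ _ ->] := dC z Uz.
have rB : regular FB V.
  apply: (regular_B oV VL tB) => y Vy.
    by rewrite (congruence_inv (uJ y Vy) (gB y Vy)) jV.
  have [_ _ _ e] := dC _ (imageP (ybar k) Vy).
  by rewrite -jV // -[eulerC _ _]e.
exists FB; split; last exact: iso.
split; first exact: (frobenius_pull (ybar_coordinate_change hk oV VL) rB rC iso fC).
move=> y Vy; have [iC _ eC _] := dC _ (imageP (ybar k) Vy).
have [_ _ _ De _] := iso y Vy.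
have eJ : funit FB y *m jac y = ek R l k.
  by rewrite -eC -De; exact: esym (Dy y _ Vy).
split.
- apply: (congruence_inj (uJ y Vy)).
  by rewrite -(intersection_form_local_iso Dy uJ tB tC iso Vy) iC GB_GC.
- exact: etrans De eC.
- apply: etrans (components_ybar hk _ y) _.
  apply: etrans (esym (gB y Vy)) _; have yL := VL _ Vy.
  have dE := derive_GC_ybar yL eJ; exact: esym dE.
Qed.

Section StructureB.
Variables (V : set P) (FB : frobenius R l.+1).
Hypothesis VL : V `<=` locus.
Hypothesis fB : frobenius_B k (@GB R l k) V FB.

Let uJ y : V y -> jac y \in unitmx. Proof. by move=> /VL; exact: jac_unit. Qed.

Lemma unit_B y : V y -> funit FB y *m jac y = ek R l k.
Proof.
move=> Vy; rewrite -(ybar_differential hk y).2.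
by have [_ -> _] := fB.2 y Vy.
Qed.

Lemma inverse_metric_B y : V y ->
  dGC k (ybar k y) = (jac y)^T *m invmx (fmetric FB y) *m jac y.
Proof.
move=> Vy; rewrite -(components_ybar hk); have [_ _ ->] := fB.2 y Vy.
have yL := VL Vy; have dE := derive_GC_ybar yL (unit_B Vy); exact: esym dE.
Qed.

(** The Euler field is the contraction of the intersection form with the 1-form
dual to the unity.  This 1-form is the differential of the last coordinate,
because the flat metric maps both to the unity. *)
Lemma euler_B y : V y -> feuler FB y *m jac y = eulerC k (ybar k y).
Proof.
move=> Vy; have tB := is_frobenius_tame fB.1; have u := uJ Vy.
have uT : (jac y)^T \in unitmx by rewrite unitmx_tr.
have ng := reg_metric_nondeg tB Vy.
have [iB _ _] := fB.2 y Vy.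
(* The 1-form dual to the unity, in the coordinates ybar. *)
pose w := funit FB y *m fmetric FB y *m invmx (jac y)^T.
have wd : w *m dGC k (ybar k y) = ek R l k.
  rewrite inverse_metric_B // !mulmxA mulmxKV // mulmxK //; exact: unit_B.
have uD : dGC k (ybar k y) \in unitmx.
  by rewrite inverse_metric_B // !unitmx_mul uT unitmx_inv ng.
have wE : w = delta_mx 0 ord_max.
  by apply: (can_inj (mulmxK uD)); rewrite wd delta_dGC.
rewrite -(euler_intersection_form (reg_bilinear tB Vy)
  (reg_metric_sym tB Vy) ng (frob_mul1 fB.1 Vy)) iB.
rewrite -delta_GC -wE -GB_GC // /w /flat !mulmxA mulmxKV //.
Qed.

Lemma regular_structure_B : open V -> regular FB V.
Proof.
move=> oV; apply: (regular_B oV VL (is_frobenius_tame fB.1)) => y Vy.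
  rewrite (congruence_inv (uJ Vy) (inverse_metric_B Vy)) invmx_jac //.
  exact: VL.
by rewrite -euler_B // -invmx_jac ?mulmxK ?uJ //; exact: VL.
Qed.

(** The structure FB is pushed forward along ybar, which is invertible on V. *)
Lemma frobenius_C_of_B : open V -> {in V &, injective (ybar k)} ->
  exists FC, frobenius_C k (@GC R l k) (ybar k @` V) FC /\
    frobenius_local_iso V (ybar k) FB FC.
Proof.
move=> oV inj; have [psi [psiK dpsi]] := inverse_ybar hk oV VL inj.
have dy y : V y -> differentiable (ybar k) y.
  by move=> _; exact: (ybar_differential hk y).1.
have Dy y u : V y -> 'D_u (ybar k) y = u *m jac y.
  by move=> _; exact: (ybar_differential hk y).2.
have tB := is_frobenius_tame fB.1; have rB := regular_structure_B oV.
have oU := open_ybar hk oV VL; have UL := image_locus VL.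
have psiV z : (ybar k @` V) z -> V (psi z) by move=> [y Vy <-]; rewrite psiK.
pose Q z := invmx (jac (psi z)); pose FC := pullback psi Q FB.
have iso : frobenius_local_iso V (ybar k) FB FC := pushforward_iso dy Dy uJ FB psiK.
have tC : tame FC (ybar k @` V).
  apply: (tame_pullback oU psiV dpsi _ _ _ tB) => z Uz.
  - have dJ := differentiable_comp (dpsi z Uz) (differentiable_jacV (VL (psiV z Uz))).
    apply: near_differentiable dJ.
    apply: filterS (open_nbhs_nbhs (conj oU Uz)) => t Ut /=.
    by rewrite /Q invmx_jac //; exact: VL (psiV t Ut).
  - have dJ := differentiable_comp (dpsi z Uz) (differentiable_jac (VL (psiV z Uz))).
    rewrite (_ : (fun p => _) = jac \o psi) //.
    by rewrite funeqE => t; rewrite /Q invmxK.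
  - by rewrite unitmx_inv uJ //; exact: psiV.
have gC y : V y -> invmx (fmetric FC (ybar k y)) = dGC k (ybar k y).
  move=> Vy; rewrite (inverse_metric_local_iso Dy uJ tB tC iso Vy).
  by rewrite -inverse_metric_B.
have eC y : V y -> feuler FC (ybar k y) = eulerC k (ybar k y).
  by move=> Vy; have [_ _ _ _ <-] := iso y Vy; rewrite Dy // euler_B.
have rC : regular FC (ybar k @` V).
  by apply: (regular_C oU UL tC) => _ [y Vy <-]; [exact: gC|exact: eC].
exists FC; split; last exact: iso.
split.
  exact: (frobenius_push (ybar_coordinate_change hk oV VL) rB rC iso fB.1).
move=> _ [y Vy <-]; have [_ _ _ De _] := iso y Vy; split.
- rewrite (intersection_form_local_iso Dy uJ tB tC iso Vy).
  by have [-> _ _] := fB.2 y Vy; rewrite GB_GC.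
- exact: gC.
- by rewrite -De Dy // unit_B.
- exact: eC.
Qed.

End StructureB.

Lemma is_frobenius_sub U V F d : V `<=` U -> is_frobenius F U d ->
  is_frobenius F V d.
Proof.
move=> VU [] h1 h2 h3 h4 h5 h6 h7 h8 h9 h10 h11 h12 h13 h14 h15 h16 h17.
split; [exact (fun u v y Vy => h1 u v y (VU y Vy))|..].
- exact (fun y Vy => h2 y (VU y Vy)).
- exact (fun y Vy => h3 y (VU y Vy)).
- exact (fun y Vy => h4 y (VU y Vy)).
- exact (fun y Vy => h5 y (VU y Vy)).
- exact (fun y Vy => h6 y (VU y Vy)).
- exact (fun y Vy => h7 y (VU y Vy)).
- exact (fun y Vy => h8 y (VU y Vy)).
- exact (fun y Vy => h9 y (VU y Vy)).
- exact (fun y Vy => h10 y (VU y Vy)).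
- exact (fun y Vy => h11 y (VU y Vy)).
- exact (fun y Vy => h12 y (VU y Vy)).
- exact (fun y Vy => h13 y (VU y Vy)).
- exact (fun y Vy => h14 y (VU y Vy)).
- exact (fun y Vy => h15 y (VU y Vy)).
- exact (fun y Vy => h16 y (VU y Vy)).
- exact (fun y Vy => h17 y (VU y Vy)).
Qed.

(** Near a point of the locus ybar is injective and carries FB to a structure of
type C, which coincides with FC by uniqueness. *)
Lemma local_iso_of_unique FB FC :
  (forall V, open V -> V `<=` locus -> forall F F',
     frobenius_C k (@GC R l k) V F -> frobenius_C k (@GC R l k) V F' ->
     frobenius_eq_on V F F') ->
  frobenius_B k (@GB R l k) locus FB -> frobenius_C k (@GC R l k) locus FC ->
  frobenius_local_iso locus (ybar k) FB FC.
Proof.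
move=> uniq [fB dB] [fC dC] y0 y0L.
have [V [oV Vy0 VL] inj] := locally_injective hk (@open_locus R l) (@subset_refl _ locus) y0L.
have fBV : frobenius_B k (@GB R l k) V FB.
  by split; [exact: (is_frobenius_sub VL fB)|move=> y /VL; exact: dB].
have [FC' [fC' iso]] := frobenius_C_of_B VL fBV oV inj.
have UL := image_locus VL.
have fCU : frobenius_C k (@GC R l k) (ybar k @` V) FC.
  by split; [exact: (is_frobenius_sub UL fC)|move=> y /UL; exact: dC].
have [em eg eu eE] := uniq _ (open_ybar hk oV VL) UL _ _ fCU fC' _ (imageP _ Vy0).
have [d i1 i2 i3 i4] := iso y0 Vy0.
by split; rewrite ?em ?eg ?eu ?eE.
Qed.

End Transfer.

(** * The comparison of types B and C *)

Theorem mainTheorem2 (R : realType) (l k : nat) (hk : (1 <= k <= l)%N) :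
  exists GB GC : 'rV[cplx R]_l.+1 -> 'M[cplx R]_l.+1,
    [/\ metric_in_coordinates (@yB R l k) (gramB R l k) GB,
        metric_in_coordinates (@yC R l k) (gramC R l k) GC &
        (forall x : 'rV[cplx R]_l.+1,
           components (fun z => ybar k (yB k z)) (gramB R l k) x
           = GC (ybar k (yB k x)))
    /\ [/\
        ybar k @` locus R l = locus R l,
        (forall (V : set 'rV[cplx R]_l.+1) (FC : frobenius R l.+1),
           open V -> V `<=` locus R l ->
           frobenius_C k GC (ybar k @` V) FC ->
           exists FB : frobenius R l.+1,
             frobenius_B k GB V FB /\ frobenius_local_iso V (ybar k) FB FC),
        (forall (V : set 'rV[cplx R]_l.+1) (FB : frobenius R l.+1),
           open V -> V `<=` locus R l ->
           {in V &, injective (ybar k)} ->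
           frobenius_B k GB V FB ->
           exists FC : frobenius R l.+1,
             frobenius_C k GC (ybar k @` V) FC
             /\ frobenius_local_iso V (ybar k) FB FC)
      & (forall V : set 'rV[cplx R]_l.+1,
           open V -> V `<=` locus R l ->
           forall FC FC', frobenius_C k GC V FC -> frobenius_C k GC V FC' ->
             frobenius_eq_on V FC FC') ->
        forall FB FC : frobenius R l.+1,
          frobenius_B k GB (locus R l) FB ->
          frobenius_C k GC (locus R l) FC ->
          frobenius_local_iso (locus R l) (ybar k) FB FC]].
Proof.
exists (@GB R l k), (@GC R l k); split.
- exact: yB_metric hk.
- exact: yC_metric hk.
split; first exact: ybar_yB_metric hk.
split.
- exact: (ybar_locus hk).
- move=> V FC oV VL; exact: (frobenius_B_of_C hk oV VL).
- move=> V FB oV VL inj fB; exact: (frobenius_C_of_B hk VL fB oV inj).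
- move=> uniq FB FC; exact: (local_iso_of_unique hk uniq).
Qed.
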